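(* The index set problem for UHF algebras is $\Pi^0_2$ complete. That is, the set of all $e\in\mathbb{N}$ that index a computable (or c.e.) presentation of a UHF algebra is $\Pi^0_2$ complete.
   Context: A UHF (uniformly hyperfinite) algebra is a unital C*-algebra that is an inductive limit of a sequence of full matrix algebras $M_{n_s}(\mathbb{C})$ with unital bonding $*$-homomorphisms. A presentation $\mathbf{A}^\#$ of a C*-algebra $\mathbf{A}$ is a sequence $(a_0,a_1,\dots)$ in $\mathbf{A}$ (special points) generating a dense $*$-subalgebra; generated points are the values $p(a_0,\dots,a_n)$ of $*$-polynomials with coefficients in $\mathbb{Q}(i)$, effectively listed. $\mathbf{A}^\#$ is computable if there is an algorithm that, given a generated point $q$ and $k\in\mathbb{N}$, outputs a rational within $2^{-k}$ of $\|q\|$; it is c.e. if there is an algorithm that, given a generated point $q$, enumerates a decreasing sequence of rationals converging to $\|q\|$. An index of the computable (resp. c.e.) presentation is a natural number coding such an algorithm. The index set problem for a class of structures is the problem of determining whether a natural number indexes a computable (or c.e.) presentation of a structure in the class. A set is $\Pi^0_2$ if it is definable in the form $\forall y\,\exists z\,R(x,y,z)$ with $R$ computable; it is $\Pi^0_2$ complete if in addition every $\Pi^0_2$ set is many-one reducible to it. *)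

(* Defs.v *)
From Stdlib Require Cantor.
From HB Require Import structures.
From mathcomp Require Import all_boot all_order all_algebra.
From mathcomp Require Import complex.
From mathcomp Require Import all_classical all_reals topology normedtype.

Set Implicit Arguments.
Unset Strict Implicit.
Unset Printing Implicit Defensive.

Import Order.TTheory GRing.Theory Num.Theory.
Import numFieldNormedType.Exports.

(* Algorithms are programs for Kleene's partial recursive functions, taken  *)
(* in unary form over the Cantor pairing; tuples of inputs are nested pairs *)
(* and every natural number codes a program.                                *)

Definition pairn (x y : nat) : nat := Cantor.to_nat (x, y).
Definition unpairn (n : nat) : nat * nat := Cantor.of_nat n.

Inductive code : Type :=
| CZero
| CSucc
| CFst
| CSnd
| CPair of code & code
| CComp of code & code
| CPrec of code & code
| CFind of code.

(* [eval c x y]: the program [c] halts on input [x] with output [y].        *)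
(* [CPrec f g] on <a, 0> returns f(a), and on <a, n+1> returns              *)
(* g<a, <n, r>> where r is its value on <a, n>; [CFind f] on x returns the  *)
(* least y such that f<x, y> = 0, all f<x, m> with m < y being defined.     *)
Fixpoint eval (c : code) : nat -> nat -> Prop :=
  match c with
  | CZero => fun x y => y = 0
  | CSucc => fun x y => y = x.+1
  | CFst => fun x y => y = (unpairn x).1
  | CSnd => fun x y => y = (unpairn x).2
  | CPair f g => fun x y =>
      exists u v, [/\ eval f x u, eval g x v & y = pairn u v]
  | CComp f g => fun x y => exists2 u, eval g x u & eval f u y
  | CPrec f g => fun x y =>
      let a := (unpairn x).1 in
      (fix rec (n : nat) : nat -> Prop :=
         match n with
         | 0 => eval f a
         | m.+1 => fun z =>
             exists2 r, rec m r & eval g (pairn a (pairn m r)) z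
         end) (unpairn x).2 y
  | CFind f => fun x y =>
      eval f (pairn x y) 0 /\
      forall m, m < y -> exists v, eval f (pairn x m) v.+1
  end.

(* For n = m + 4, the constructor is m mod 4 and the arguments are coded by *)
(* m / 4; the first argument is fuel, for which n + 1 always suffices.      *)
Fixpoint decode_code_rec (fuel n : nat) : code :=
  if fuel is k.+1 then
    match n with
    | 0 => CZero
    | 1 => CSucc
    | 2 => CFst
    | 3 => CSnd
    | m.+4 =>
        let q := m %/ 4 in
        let f := decode_code_rec k (unpairn q).1 in
        let g := decode_code_rec k (unpairn q).2 in
        match m %% 4 with
        | 0 => CPair f g
        | 1 => CComp f g
        | 2 => CPrec f g
        | _ => CFind (decode_code_rec k q)
        end
    end
  else CZero.

Definition decode_code (n : nat) : code := decode_code_rec n.+1 n.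

Definition phi (e x y : nat) : Prop := eval (decode_code e) x y.

Definition computable_fun (f : nat -> nat) : Prop :=
  exists e, forall x, phi e x (f x).

Definition computable_rel3 (S : nat -> nat -> nat -> bool) : Prop :=
  exists e, forall x y z, phi e (pairn x (pairn y z)) (S x y z).

Definition Pi02 (P : nat -> Prop) : Prop :=
  exists2 S : nat -> nat -> nat -> bool, computable_rel3 S &
    forall x, P x <-> forall y, exists z, S x y z.

Definition many_one_reducible (Q P : nat -> Prop) : Prop :=
  exists2 f : nat -> nat, computable_fun f & forall x, Q x <-> P (f x).

Definition Pi02_complete (P : nat -> Prop) : Prop :=
  Pi02 P /\ forall Q, Pi02 Q -> many_one_reducible Q P.

Local Open Scope ring_scope.

HB.mixin Record Algebra_hasStar (C : numClosedFieldType) A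
    of GRing.Algebra C A := {
  star : A -> A ;
  starD : forall x y : A, star (x + y) = star x + star y ;
  starZ : forall (c : C) (x : A), star (c *: x) = c^* *: star x ;
  starM : forall x y : A, star (x * y) = star y * star x ;
  starK : forall x : A, star (star x) = x }.

#[short(type="starAlgType")]
HB.structure Definition StarAlgebra (C : numClosedFieldType) :=
  {A of GRing.Algebra C A & Algebra_hasStar C A}.

(* The join of [GRing.Algebra] with the normed modules of MathComp-Analysis *)
(* is not available (both sit below [Num.NumDomain]), so the norm and the   *)
(* completeness of the associated metric are stated here.                   *)
HB.mixin Record StarAlgebra_isCStar (R : realType) A
    of StarAlgebra R[i] A := {
  cnorm : A -> R ;
  cnormD : forall x y : A, cnorm (x + y) <= cnorm x + cnorm y ;
  cnormZ : forall (c : R[i]) (x : A), cnorm (c *: x) = Normc.normc c * cnorm x ;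
  cnorm0_eq0 : forall x : A, cnorm x = 0 -> x = 0 ;
  cnormM : forall x y : A, cnorm (x * y) <= cnorm x * cnorm y ;
  cnorm_star : forall x : A, cnorm (star x * x) = cnorm x ^+ 2 ;
  cnorm_complete : forall u : nat -> A,
    (forall eps : R, 0 < eps -> exists N : nat, forall m n : nat,
       (N <= m)%N -> (N <= n)%N -> cnorm (u m - u n) < eps) ->
    exists l : A, forall eps : R, 0 < eps -> exists N : nat, forall n : nat,
      (N <= n)%N -> cnorm (u n - l) < eps }.

#[short(type="cstarAlgType")]
HB.structure Definition CStarAlgebra (R : realType) :=
  {A of StarAlgebra R[i] A & StarAlgebra_isCStar R A}.

Section MatrixStar.
Variables (C : numClosedFieldType) (n : nat).

Definition adjmx (M : 'M[C]_n.+1) : 'M[C]_n.+1 := (map_mx Num.conj M)^T.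

Fact adjmxD M N : adjmx (M + N) = adjmx M + adjmx N.
Proof. by apply/matrixP => i j; rewrite !mxE rmorphD. Qed.

Fact adjmxZ (c : C) M : adjmx (c *: M) = c^* *: adjmx M.
Proof. by apply/matrixP => i j; rewrite !mxE rmorphM. Qed.

Fact adjmxM M N : adjmx (M * N) = adjmx N * adjmx M.
Proof. by rewrite /adjmx map_mxM trmx_mul. Qed.

Fact adjmxK M : adjmx (adjmx M) = M.
Proof. by apply/matrixP => i j; rewrite !mxE conjCK. Qed.

HB.instance Definition _ := Algebra_hasStar.Build C 'M[C]_n.+1
  adjmxD adjmxZ adjmxM adjmxK.
End MatrixStar.

Definition unital_star_hom (C : numClosedFieldType) (A B : starAlgType C)
    (f : A -> B) : Prop :=
  [/\ linear f, monoid_morphism f & forall x, f (star x) = star (f x)].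

Section InductiveLimit.
Variables (R : realType) (D : nat -> starAlgType R[i]).
Variable bond : forall s, D s -> D s.+1.

Definition is_cocone (B : cstarAlgType R) (g : forall s, D s -> B) : Prop :=
  (forall s, unital_star_hom (g s)) /\
  (forall s x, g s.+1 (bond x) = g s x).

Definition is_inductive_limit (A : cstarAlgType R) (i : forall s, D s -> A) :
    Prop :=
  is_cocone i /\
  forall (B : cstarAlgType R) (g : forall s, D s -> B), is_cocone g ->
    exists! u : A -> B, unital_star_hom u /\ forall s x, u (i s x) = g s x.
End InductiveLimit.

(* The sizes are positive: the s-th algebra is M_{n_s}(C) with              *)
(* n_s = (m s).+1. No norm on it is mentioned because *-homomorphisms into  *)
(* a C*-algebra are purely algebraic.                                       *)
Definition UHF (R : realType) (A : cstarAlgType R) : Prop :=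
  exists (m : nat -> nat)
         (bond : forall s, 'M[R[i]]_((m s).+1) -> 'M[R[i]]_((m s.+1).+1))
         (i : forall s, 'M[R[i]]_((m s).+1) -> A),
    (forall s, unital_star_hom (bond s)) /\
    is_inductive_limit (D := fun s => 'M[R[i]]_((m s).+1)) bond i.

(* A letter (j, b) is X_j if b = false and X_j^* if b = true; a             *)
(* *-polynomial is a list of terms, each being a coefficient p + q i with a *)
(* word in the letters. The empty word gives the constant term.             *)
Definition letter : Type := nat * bool.
Definition starpoly : Type := seq ((rat * rat) * seq letter).

Definition decode_rat (n : nat) : rat :=
  let: (p, d) := unpairn n in
  let: (a, b) := unpairn p in
  (a%:Z - b%:Z)%:~R / d.+1%:R.

Definition decode_coef (n : nat) : rat * rat :=
  let: (p, q) := unpairn n in (decode_rat p, decode_rat q).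

Definition decode_letter (n : nat) : letter := (n./2, odd n).

Definition decode_term (n : nat) : (rat * rat) * seq letter :=
  let: (c, w) := unpairn n in
  (decode_coef c, [seq decode_letter l | l <- CodeSeq.decode w]).

Definition decode_starpoly (n : nat) : starpoly :=
  [seq decode_term t | t <- CodeSeq.decode n].

Section Presentation.
Variables (R : realType) (A : cstarAlgType R) (a : nat -> A).

Definition eval_letter (l : letter) : A :=
  if l.2 then star (a l.1) else a l.1.

Definition eval_coef (c : rat * rat) : R[i] := (ratr c.1 +i* ratr c.2)%C.

Definition eval_starpoly (p : starpoly) : A :=
  \sum_(t <- p) eval_coef t.1 *: \prod_(l <- t.2) eval_letter l.

Definition generated_point (q : nat) : A := eval_starpoly (decode_starpoly q).

Inductive in_star_subalgebra : A -> Prop :=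
| in_special n : in_star_subalgebra (a n)
| in_one : in_star_subalgebra 1
| in_add x y :
    in_star_subalgebra x -> in_star_subalgebra y -> in_star_subalgebra (x + y)
| in_scale (c : R[i]) x : in_star_subalgebra x -> in_star_subalgebra (c *: x)
| in_mul x y :
    in_star_subalgebra x -> in_star_subalgebra y -> in_star_subalgebra (x * y)
| in_star x : in_star_subalgebra x -> in_star_subalgebra (star x).

Definition is_presentation : Prop :=
  forall (x : A) (eps : R), 0 < eps ->
    exists2 y, in_star_subalgebra y & cnorm (x - y) < eps.

Definition computable_index (e : nat) : Prop :=
  forall q k : nat, exists2 r : nat, phi e (pairn q k) r &
    `| ratr (decode_rat r) - cnorm (generated_point q) | < 2^-1 ^+ k.

Definition ce_index (e : nat) : Prop :=
  forall q : nat, exists r : nat -> nat,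
    [/\ forall k, phi e (pairn q k) (r k),
        forall k, decode_rat (r k.+1) < decode_rat (r k) &
        ((fun k => ratr (decode_rat (r k)) : R) @ \oo -->
           cnorm (generated_point q))%classic].
End Presentation.

Section IndexSets.
Variables (R : realType) (K : cstarAlgType R -> Prop).

Definition computable_index_set (e : nat) : Prop :=
  exists (A : cstarAlgType R) (a : nat -> A),
    [/\ K A, is_presentation a & computable_index a e].

Definition ce_index_set (e : nat) : Prop :=
  exists (A : cstarAlgType R) (a : nat -> A),
    [/\ K A, is_presentation a & ce_index a e].
End IndexSets.

(* Main.v *)
(* Upper bound. A presentation is determined by the function N sending a code q of a
   *-polynomial to the norm of the generated point, and from an index one enumerates the
   pairs (q, r) with N(q) < r. That N is a C*-seminorm is a [Pi02] condition on this
   relation, and then the completion of the *-polynomials is the presented algebra. Being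
   UHF is local: every approximate system of matrix units must be refined by a larger
   approximate system whose span almost contains the first k special points. For fixed
   tolerances this is of the form "for every system there is a refinement" over relations
   that are recursively enumerable, hence [Pi02]. It holds in a UHF algebra because
   approximate matrix units in a matrix algebra are close to exact ones; conversely, when
   the refinements are iterated, the approximate *-homomorphisms given by the successive
   systems converge to exact ones, whose ranges form an increasing chain of matrix
   algebras with dense union.

   Hardness. For a [Pi02] set given by S, let the program of index f(x) compute the norm of
   C presented by the zero sequence, except that on input y it first searches for z with
   S(x, y, z). It is an index exactly when all these searches succeed. *)

From HB Require Import structures.
From Stdlib Require Ncring Ncring_tac.
From mathcomp Require Import all_boot all_order all_algebra zify ring lra.
From mathcomp Require Import complex.
From mathcomp Require Import all_classical all_reals topology normedtype sequences.
Require Import Defs.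

Set Implicit Arguments.
Unset Strict Implicit.
Unset Printing Implicit Defensive.
Import Order.TTheory GRing.Theory Num.Theory.
Import numFieldNormedType.Exports.

(** * Computable functions *)

(** A c.e. index yields only upper bounds on norms, so the sole information extracted from either
    kind of index is the upper cut N(q) < r. Every axiom must then say that upper bounds or
    decidable conditions force a further upper bound; lower bounds such as 1 <= N(1) become
    decidable conclusions about r. Exact matrix units cannot be expressed this way, but the strict
    inequalities of an approximate system are open conditions, stable under passing to dense sets of
    points, and this is why tolerances appear throughout. The delicate point is that an arbitrary
    approximate system, not only one already built, must be refinable. It is first corrected to an
    exact system of the form e_ij (x) 1 inside one stage, and the quantitative loss in that
    correction dictates the tolerances. UHF is defined by a universal property, with no norm on the
    matrix algebras. Norms of matrices are read through a homomorphism into the given algebra;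
    density of the stages has to be extracted from the universal property, and the universal
    property rebuilt from density, which rests on all such homomorphisms inducing the same norm. *)

Definition recf (f : nat -> nat) : Prop := exists c, forall x, eval c x (f x).

Definition p1 (n : nat) : nat := (unpairn n).1.
Definition p2 (n : nat) : nat := (unpairn n).2.

Lemma pairnK x y : unpairn (pairn x y) = (x, y).
Proof. exact: Cantor.cancel_of_to. Qed.

Lemma p1_pairn x y : p1 (pairn x y) = x.
Proof. by rewrite /p1 pairnK. Qed.

Lemma p2_pairn x y : p2 (pairn x y) = y.
Proof. by rewrite /p2 pairnK. Qed.

Definition pairnE := (p1_pairn, p2_pairn).

Lemma pairn_p n : pairn (p1 n) (p2 n) = n.
Proof.
rewrite /p1 /p2 /pairn /unpairn -[RHS]Cantor.cancel_to_of.
by case: (Cantor.of_nat n).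
Qed.

Lemma pairn_ge x y : x + y <= pairn x y.
Proof. by have := Cantor.to_nat_non_decreasing x y; rewrite -/(pairn x y); lia. Qed.

Lemma p1_le n : p1 n <= n.
Proof. have := pairn_ge (p1 n) (p2 n); rewrite pairn_p; lia. Qed.

Lemma p2_le n : p2 n <= n.
Proof. have := pairn_ge (p1 n) (p2 n); rewrite pairn_p; lia. Qed.

Lemma recf_ext f g : (forall x, f x = g x) -> recf f -> recf g.
Proof. by move=> fg [c cP]; exists c => x; rewrite -fg. Qed.

Lemma recf_comp f g : recf f -> recf g -> recf (fun x => f (g x)).
Proof. by move=> [c cP] [d dP]; exists (CComp c d) => x /=; exists (g x). Qed.

Lemma recf_pairn f g : recf f -> recf g -> recf (fun x => pairn (f x) (g x)).
Proof. by move=> [c cP] [d dP]; exists (CPair c d) => x /=; exists (f x), (g x). Qed.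

Lemma recf_id : recf (fun x => x).
Proof.
exists (CPair CFst CSnd) => x /=.
by exists (p1 x), (p2 x); split => //; rewrite pairn_p.
Qed.

Lemma recf_succ f : recf f -> recf (fun x => (f x).+1).
Proof. by apply: (@recf_comp S); exists CSucc. Qed.

Lemma recf_p1 f : recf f -> recf (fun x => p1 (f x)).
Proof. by apply: (@recf_comp p1); exists CFst. Qed.

Lemma recf_p2 f : recf f -> recf (fun x => p2 (f x)).
Proof. by apply: (@recf_comp p2); exists CSnd. Qed.

Lemma recf_const n : recf (fun _ => n).
Proof. by elim: n => [|n IH]; [exists CZero | exact: recf_succ]. Qed.

(** Bounded iteration is the form in which primitive recursion is used; the basic arithmetic and
    list functions below come from it. *)
Lemma recf_iteri (a b : nat -> nat) (h : nat -> nat -> nat -> nat) :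
  recf a -> recf b -> recf (fun z => h (p1 z) (p1 (p2 z)) (p2 (p2 z))) ->
  recf (fun x => iteri (b x) (h x) (a x)).
Proof.
move=> [ca aP] bP [ch hP].
(* [CPrec] reads both its parameter and its bound from one pair; the general bound [b x] is then
   obtained by composition. *)
suff H : recf (fun z => iteri (p2 z) (h (p1 z)) (a (p1 z))).
  have H2 := recf_comp H (recf_pairn recf_id bP).
  by apply: recf_ext H2 => x; rewrite !pairnE.
exists (CPrec ca ch) => z; rewrite /= -/(p1 z) -/(p2 z).
elim: (p2 z) => [|n IH]; first exact: aP.
by exists (iteri n (h (p1 z)) (a (p1 z))) => //; have := hP (pairn (p1 z) (pairn n
  (iteri n (h (p1 z)) (a (p1 z))))); rewrite !pairnE.
Qed.

Create HintDb recfdb discriminated.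
#[global] Hint Constants Opaque : recfdb.
#[global] Hint Variables Opaque : recfdb.
#[global] Hint Resolve recf_pairn recf_id recf_succ recf_p1 recf_p2 recf_const
  recf_iteri : recfdb.

Ltac cmp := solve [auto 100 with recfdb].

Lemma recf_add f g : recf f -> recf g -> recf (fun x => f x + g x).
Proof.
move=> cf cg; apply: (@recf_ext (fun x => iteri (g x) (fun _ r => r.+1) (f x))); last cmp.
by move=> x; elim: (g x) => [|n /= ->]; rewrite ?addn0 ?addnS.
Qed.
#[global] Hint Resolve recf_add : recfdb.

Lemma recf_mul f g : recf f -> recf g -> recf (fun x => f x * g x).
Proof.
move=> cf cg; apply: (@recf_ext (fun x => iteri (g x) (fun _ r => f x + r) 0)).
  by move=> x; elim: (g x) => [|n /= ->]; rewrite ?muln0 ?mulnS.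
apply: recf_iteri; try cmp.
by apply: recf_add; [apply: (recf_comp cf)|]; cmp.
Qed.
#[global] Hint Resolve recf_mul : recfdb.

Lemma recf_app2 (h : nat -> nat -> nat) f g :
  recf (fun z => h (p1 z) (p2 z)) -> recf f -> recf g ->
  recf (fun x => h (f x) (g x)).
Proof.
move=> ch cf cg; apply: recf_ext (recf_comp ch (recf_pairn cf cg)) => x.
by rewrite !pairnE.
Qed.

Lemma recf_app3 (h : nat -> nat -> nat -> nat) f g k :
  recf (fun z => h (p1 z) (p1 (p2 z)) (p2 (p2 z))) ->
  recf f -> recf g -> recf k -> recf (fun x => h (f x) (g x) (k x)).
Proof.
move=> ch cf cg ck.
apply: recf_ext (recf_comp ch (recf_pairn cf (recf_pairn cg ck))) => x.
by rewrite !pairnE.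
Qed.

#[global] Hint Extern 2 (recf _) =>
  match goal with
  | H : recf ?f |- recf (fun x => ?f (@?g x)) => apply: (@recf_comp f g H)
  | H : recf (fun z => ?h (p1 z) (p2 z)) |- recf (fun x => ?h (@?f x) (@?g x)) =>
      apply: (@recf_app2 h f g H)
  | H : recf (fun z => ?h (p1 z) (p1 (p2 z)) (p2 (p2 z)))
    |- recf (fun x => ?h (@?f x) (@?g x) (@?k x)) =>
      apply: (@recf_app3 h f g k H)
  end : recfdb.

Lemma recf_pred f : recf f -> recf (fun x => (f x).-1).
Proof.
move=> cf; apply: (@recf_ext (fun x => iteri (f x) (fun i _ => i) 0)); last cmp.
by move=> x; case: (f x).
Qed.
#[global] Hint Resolve recf_pred : recfdb.

Lemma recf_sub f g : recf f -> recf g -> recf (fun x => f x - g x).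
Proof.
move=> cf cg; apply: (@recf_ext (fun x => iteri (g x) (fun _ r => r.-1) (f x))); last cmp.
by move=> x; elim: (g x) => [|n /= ->]; rewrite ?subn0 ?subnS.
Qed.
#[global] Hint Resolve recf_sub : recfdb.

Lemma recf_exp f g : recf f -> recf g -> recf (fun x => f x ^ g x).
Proof.
move=> cf cg; apply: (@recf_ext (fun x => iteri (g x) (fun _ r => f x * r) 1)).
  by move=> x; elim: (g x) => [|n /= ->]; rewrite ?expn0 ?expnS.
cmp.
Qed.
#[global] Hint Resolve recf_exp : recfdb.

Lemma recf_leq f g : recf f -> recf g -> recf (fun x => nat_of_bool (f x <= g x)).
Proof.
move=> cf cg; apply: (@recf_ext (fun x => 1 - (f x - g x))); last cmp.
by move=> x; lia.
Qed.
#[global] Hint Resolve recf_leq : recfdb.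

Lemma recf_eqn f g : recf f -> recf g -> recf (fun x => nat_of_bool (f x == g x)).
Proof.
move=> cf cg; apply: (@recf_ext (fun x => (f x <= g x) * (g x <= f x))); last cmp.
by move=> x; rewrite eqn_leq; case: leq; case: leq.
Qed.

Lemma recf_andb (f g : nat -> bool) : recf (fun x => nat_of_bool (f x)) -> recf (fun x => nat_of_bool (g x)) ->
  recf (fun x => nat_of_bool (f x && g x)).
Proof.
move=> cf cg; apply: (@recf_ext (fun x => f x * g x)); last cmp.
by move=> x; case: (f x); case: (g x).
Qed.

Lemma recf_negb (f : nat -> bool) : recf (fun x => nat_of_bool (f x)) ->
  recf (fun x => nat_of_bool (~~ f x)).
Proof.
move=> cf; apply: (@recf_ext (fun x => 1 - f x)); last cmp.
by move=> x; case: (f x).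
Qed.

Lemma recf_implb (f g : nat -> bool) : recf (fun x => nat_of_bool (f x)) -> recf (fun x => nat_of_bool (g x)) ->
  recf (fun x => nat_of_bool (f x ==> g x)).
Proof.
move=> cf cg; apply: (@recf_ext (fun x => (1 - f x) + f x * g x)); last cmp.
by move=> x; case: (f x); case: (g x).
Qed.

Lemma recf_if (b : nat -> bool) f g : recf (fun x => nat_of_bool (b x)) -> recf f -> recf g ->
  recf (fun x => if b x then f x else g x).
Proof.
move=> cb cf cg; apply: (@recf_ext (fun x => b x * f x + (1 - b x) * g x)); last cmp.
by move=> x; case: (b x); lia.
Qed.

Lemma recf_ifb (b f g : nat -> bool) : recf (fun x => nat_of_bool (b x)) ->
  recf (fun x => nat_of_bool (f x)) -> recf (fun x => nat_of_bool (g x)) ->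
  recf (fun x => nat_of_bool (if b x then f x else g x)).
Proof.
move=> cb cf cg; apply: (@recf_ext (fun x => if b x then nat_of_bool (f x) else nat_of_bool (g x))).
  by move=> x; case: (b x).
exact: recf_if.
Qed.
#[global] Hint Resolve recf_eqn recf_andb recf_negb recf_implb recf_if recf_ifb : recfdb.

Definition allb (n : nat) (P : nat -> bool) : bool := iteri n (fun i r => r && P i) true.
Definition hasb (n : nat) (P : nat -> bool) : bool := iteri n (fun i r => r || P i) false.

Lemma allbP n (P : pred nat) : reflect (forall i, i < n -> P i) (allb n P).
Proof.
rewrite /allb; elim: n => [|n IH] /=; first by apply: ReflectT => i.
apply: (iffP andP) => [[/IH Pn Pi] i|H].
  by rewrite ltnS leq_eqVlt => /orP [/eqP ->|/Pn].
by split; [apply/IH => i ilt|]; apply: H; lia.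
Qed.

Lemma hasbP n (P : pred nat) : reflect (exists2 i, i < n & P i) (hasb n P).
Proof.
rewrite /hasb; elim: n => [|n IH] /=; first by apply: ReflectF => -[].
apply: (iffP orP) => [[/IH [i iln Pi]|Pn]|[j]].
- by exists i => //; lia.
- by exists n.
- rewrite ltnS leq_eqVlt => /orP [/eqP ->|iln Pi]; first by right.
  by left; apply/IH; exists j.
Qed.

Lemma recf_allb b (P : nat -> nat -> bool) : recf b ->
  recf (fun z => nat_of_bool (P (p1 z) (p2 z))) ->
  recf (fun x => nat_of_bool (allb (b x) (P x))).
Proof.
move=> cb cP; pose Q x y := nat_of_bool (P x y).
have cQ : recf (fun z => Q (p1 z) (p2 z)) by [].
apply: (@recf_ext (fun x => iteri (b x) (fun i r => r * Q x i) 1)); last cmp.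
by move=> x; rewrite /allb; elim: (b x) => [|n /= ->] //; rewrite mulnb.
Qed.

Lemma recf_hasb b (P : nat -> nat -> bool) : recf b ->
  recf (fun z => nat_of_bool (P (p1 z) (p2 z))) ->
  recf (fun x => nat_of_bool (hasb (b x) (P x))).
Proof.
move=> cb cP; apply: (@recf_ext (fun x => nat_of_bool (~~ allb (b x) (fun i => ~~ P x i)))).
  by move=> x; congr nat_of_bool; rewrite /hasb /allb; elim: (b x) => //= n <-; rewrite negb_and negbK.
by apply: recf_negb; apply: recf_allb => //; apply: recf_negb.
Qed.
#[global] Hint Resolve recf_allb recf_hasb : recfdb.

(** For a downward closed predicate the count is the threshold, so counting replaces bounded
    minimisation: division, the 2-adic valuation and the integer square root are computed this
    way. *)
Definition countb (n : nat) (P : nat -> bool) : nat := iteri n (fun i r => r + P i) 0.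

Lemma recf_countb b (P : nat -> nat -> bool) : recf b ->
  recf (fun z => nat_of_bool (P (p1 z) (p2 z))) ->
  recf (fun x => countb (b x) (P x)).
Proof.
move=> cb cP; pose Q x y := nat_of_bool (P x y).
have cQ : recf (fun z => Q (p1 z) (p2 z)) by [].
by apply: (@recf_ext (fun x => iteri (b x) (fun i r => r + Q x i) 0)) => //; cmp.
Qed.
#[global] Hint Resolve recf_countb : recfdb.

Lemma countbE n (P : pred nat) : countb n P = \sum_(i < n) P i.
Proof. by rewrite /countb; elim: n => [|n IH] /=; rewrite ?big_ord0 ?big_ord_recr //= IH. Qed.

Lemma countb_lt n k : countb n (fun i => i < k) = minn n k.
Proof. by rewrite /countb; elim: n => [|n IH] /=; rewrite ?min0n //= IH; lia. Qed.

Lemma eq_countb n (P Q : pred nat) : P =1 Q -> countb n P = countb n Q.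
Proof. by move=> PQ; rewrite !countbE; apply: eq_bigr => i _; rewrite PQ. Qed.

Lemma recf_divn f g : recf f -> recf g -> recf (fun x => f x %/ g x).
Proof.
move=> cf cg.
apply: (@recf_ext (fun x => if g x == 0 then 0 else countb (f x) (fun i => i.+1 * g x <= f x))).
  move=> x; case: eqP => [->|/eqP g0]; first by rewrite divn0.
  rewrite (@eq_countb _ _ (fun i => i < f x %/ g x)) ?countb_lt; last first.
    by move=> i; rewrite leq_divRL ?lt0n.
  by apply/minn_idPr; exact: leq_div.
cmp.
Qed.
#[global] Hint Resolve recf_divn : recfdb.

Lemma recf_modn f g : recf f -> recf g -> recf (fun x => f x %% g x).
Proof.
move=> cf cg; apply: (@recf_ext (fun x => f x - f x %/ g x * g x)); last cmp.
by move=> x; rewrite {1}(divn_eq (f x) (g x)) addKn.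
Qed.
#[global] Hint Resolve recf_modn : recfdb.

Lemma recf_dvdn f g : recf f -> recf g -> recf (fun x => nat_of_bool (f x %| g x)).
Proof. by move=> cf cg; rewrite /dvdn; cmp. Qed.

Lemma recf_half f : recf f -> recf (fun x => (f x)./2).
Proof. by move=> cf; apply: (@recf_ext (fun x => f x %/ 2)); [move=> x; rewrite divn2|cmp]. Qed.

Lemma recf_odd f : recf f -> recf (fun x => nat_of_bool (odd (f x))).
Proof. by move=> cf; apply: (@recf_ext (fun x => f x %% 2)); [move=> x; rewrite modn2|cmp]. Qed.

Lemma recf_double f : recf f -> recf (fun x => (f x).*2).
Proof. by move=> cf; apply: (@recf_ext (fun x => f x * 2)); [move=> x; rewrite muln2|cmp]. Qed.
#[global] Hint Resolve recf_dvdn recf_half recf_odd recf_double : recfdb.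

(** * Lists *)

Notation dec := CodeSeq.decode.
Notation enc := CodeSeq.code.

(** The code of [h :: s] is 2^h (2 c + 1), where c codes [s]: the head is the 2-adic valuation and
    the tail is half of the odd part, rounded down. *)
Definition hdc (n : nat) : nat := countb n (fun i => 2 ^ i.+1 %| n).
Definition tlc (n : nat) : nat := (n %/ 2 ^ hdc n)./2.
Definition consc (h t : nat) : nat := 2 ^ h * t.*2.+1.

Lemma consE h t : consc h t = enc (h :: dec t).
Proof. by rewrite /= CodeSeq.decodeK. Qed.

Lemma dec_consc h t : dec (consc h t) = h :: dec t.
Proof. by rewrite consE CodeSeq.codeK. Qed.

Lemma hdc_consc h t : hdc (consc h t) = h.
Proof.
set n := consc h t.
have n0 : 0 < n by rewrite muln_gt0 expn_gt0.
have -> : h = logn 2 n.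
  by rewrite lognM ?expn_gt0 // pfactorK // lognE /= dvdn2 /= odd_double addn0.
rewrite logn_count_dvd // /hdc countbE big_add1 big_mkord.
case: n n0 => // n _; rewrite big_ord_recr /= (_ : _ %| _ = false) ?addn0 //.
by apply/negP => /dvdn_leq; have := ltn_expl n.+1 (isT : 1 < 2); lia.
Qed.

Lemma tlc_consc h t : tlc (consc h t) = t.
Proof.
by rewrite /tlc hdc_consc /consc mulKn ?expn_gt0 //= uphalf_double.
Qed.

Lemma recf_hdc f : recf f -> recf (fun x => hdc (f x)).
Proof. by move=> cf; rewrite /hdc; cmp. Qed.
#[global] Hint Resolve recf_hdc : recfdb.

Lemma recf_tlc f : recf f -> recf (fun x => tlc (f x)).
Proof. by move=> cf; rewrite /tlc; cmp. Qed.

Lemma recf_consc f g : recf f -> recf g -> recf (fun x => consc (f x) (g x)).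
Proof. by move=> cf cg; rewrite /consc; cmp. Qed.
#[global] Hint Resolve recf_tlc recf_consc : recfdb.

(** The state pairs the code of the remaining list with the accumulator. It is idle once the list is
    empty, so any number of steps not below the length will do; by [size_dec] the code itself is
    such a number. *)
Definition foldl_step (g : nat -> nat -> nat) (_ s : nat) : nat :=
  if p1 s == 0 then s else pairn (tlc (p1 s)) (g (hdc (p1 s)) (p2 s)).

Lemma foldl_stepE g s k z : size s <= k ->
  iteri k (foldl_step g) (pairn (enc s) z) = pairn 0 (foldl (fun a b => g b a) z s).
Proof.
have iterE j st : iteri j.+1 (foldl_step g) st = iteri j (foldl_step g) (foldl_step g 0 st).
  by elim: j st => //= j IH st; rewrite -IH.
have iter0 j y : iteri j (foldl_step g) (pairn 0 y) = pairn 0 y.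
  by elim: j => //= j ->; rewrite /foldl_step pairnE.
elim: s z k => [|h s IH] z k; first by rewrite iter0.
case: k => // k sk; rewrite iterE {2}/foldl_step !pairnE.
rewrite -[enc (h :: s)]/(consc h (enc s)) hdc_consc tlc_consc.
by rewrite ifN ?IH // -lt0n muln_gt0 expn_gt0.
Qed.

Lemma size_dec n : size (dec n) <= n.
Proof.
rewrite -[X in _ <= X]CodeSeq.decodeK; elim: (dec n) => //= h s IH.
apply: (@leq_trans (1 * (enc s).*2.+1)); first by lia.
by rewrite leq_mul2r expn_gt0 orbT.
Qed.

Lemma recf_foldl (h : nat -> nat -> nat -> nat) z l :
  recf z -> recf l -> recf (fun t => h (p1 t) (p1 (p2 t)) (p2 (p2 t))) ->
  recf (fun x => foldl (fun a b => h x b a) (z x) (dec (l x))).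
Proof.
move=> cz cl ch.
apply: (@recf_ext (fun x => p2 (iteri (l x) (foldl_step (h x)) (pairn (l x) (z x))))).
  move=> x; rewrite -{2}(CodeSeq.decodeK (l x)) foldl_stepE ?pairnE //.
  exact: size_dec.
by rewrite /foldl_step; cmp.
Qed.
#[global] Hint Resolve recf_foldl : recfdb.

Definition revc (n : nat) : nat := foldl (fun a b => consc b a) 0 (dec n).

Lemma dec_revc n : dec (revc n) = rev (dec n).
Proof.
rewrite /revc /rev.
suff H a : dec (foldl (fun a b => consc b a) a (dec n)) = catrev (dec n) (dec a).
  by rewrite H.
elim: (dec n) a => [|h s IH] a //=.
by rewrite IH dec_consc.
Qed.

Lemma recf_revc f : recf f -> recf (fun x => revc (f x)).
Proof.
move=> cf; rewrite /revc.
by apply: (@recf_foldl (fun _ b a => consc b a)); cmp.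
Qed.
#[global] Hint Resolve recf_revc : recfdb.

Lemma recf_foldr (h : nat -> nat -> nat -> nat) z l :
  recf z -> recf l -> recf (fun t => h (p1 t) (p1 (p2 t)) (p2 (p2 t))) ->
  recf (fun x => foldr (h x) (z x) (dec (l x))).
Proof.
move=> cz cl ch.
apply: (@recf_ext (fun x => foldl (fun a b => h x b a) (z x) (dec (revc (l x))))).
  by move=> x; rewrite dec_revc foldl_rev.
by apply: (@recf_foldl h); cmp.
Qed.
#[global] Hint Resolve recf_foldr : recfdb.

Lemma recf_has (P : nat -> nat -> bool) l :
  recf l -> recf (fun z => nat_of_bool (P (p1 z) (p2 z))) ->
  recf (fun x => nat_of_bool (has (P x) (dec (l x)))).
Proof.
move=> cl cP; pose Q x y := nat_of_bool (P x y).
have cQ : recf (fun z => Q (p1 z) (p2 z)) by [].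
apply: (@recf_ext (fun x => foldr (fun a r => if Q x a == 1 then 1 else r) 0 (dec (l x)))).
  by move=> x; elim: (dec (l x)) => //= a s ->; rewrite /Q; case: (P x a).
by apply: (@recf_foldr (fun x a r => if Q x a == 1 then 1 else r)); cmp.
Qed.

Lemma recf_all (P : nat -> nat -> bool) l :
  recf l -> recf (fun z => nat_of_bool (P (p1 z) (p2 z))) ->
  recf (fun x => nat_of_bool (all (P x) (dec (l x)))).
Proof.
move=> cl cP; apply: (@recf_ext (fun x => nat_of_bool (~~ has (fun a => ~~ P x a) (dec (l x))))).
  by move=> x; rewrite -all_predC; congr nat_of_bool; apply: eq_all => a /=; rewrite negbK.
by apply: recf_negb; apply: (@recf_has (fun x a => ~~ P x a)) => //; apply: recf_negb.
Qed.
#[global] Hint Resolve recf_has recf_all : recfdb.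

Definition nthc (l i : nat) : nat := hdc (iteri i (fun _ r => tlc r) l).

Lemma nthcE l i : nthc l i = nth 0 (dec l) i.
Proof.
rewrite /nthc -{1}(CodeSeq.decodeK l); elim: i (dec l) => [|i IH] [|h s] //=.
- exact: (hdc_consc h (enc s)).
- by rewrite (_ : iteri _ _ _ = 0) //; elim: i {IH} => //= i ->.
- rewrite -IH /=; congr hdc; rewrite -/(enc s) -/(consc h (enc s)).
  by elim: i {IH} => [|i /= ->] //; rewrite /= tlc_consc.
Qed.

Lemma recf_nthc f g : recf f -> recf g -> recf (fun x => nthc (f x) (g x)).
Proof. by move=> cf cg; rewrite /nthc; cmp. Qed.
#[global] Hint Resolve recf_nthc : recfdb.

Lemma nthc_mkseq (g : nat -> nat) n i : i < n -> nthc (enc (mkseq g n)) i = g i.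
Proof. by move=> lin; rewrite nthcE CodeSeq.codeK nth_mkseq. Qed.

(** * The halting relation is recursively enumerable *)

Lemma decode_code_fuel k k' n : n < k -> n < k' -> decode_code_rec k n = decode_code_rec k' n.
Proof.
elim: k k' n => // k IH [] // k' [|[|[|[|m]]]] // Hk Hk'.
have leq4 : m %/ 4 <= m by exact: leq_div.
have l1 := p1_le (m %/ 4); have l2 := p2_le (m %/ 4).
by rewrite /= -/(p1 _) -/(p2 _) (IH k' (p1 _)) ?(IH k' (p2 _)) ?(IH k' (m %/ 4)) //; lia.
Qed.

Lemma decode_codeE n : decode_code n.+4 =
  let q := n %/ 4 in
  match n %% 4 with
  | 0 => CPair (decode_code (p1 q)) (decode_code (p2 q))
  | 1 => CComp (decode_code (p1 q)) (decode_code (p2 q))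
  | 2 => CPrec (decode_code (p1 q)) (decode_code (p2 q))
  | _ => CFind (decode_code q)
  end.
Proof.
have leq4 : n %/ 4 <= n by exact: leq_div.
have l1 := p1_le (n %/ 4); have l2 := p2_le (n %/ 4).
have [k nk] : exists k, n.+4 <= k by exists n.+4.
rewrite {1}/decode_code (@decode_code_fuel _ k.+1) //= -/(p1 _) -/(p2 _).
have dE m : m <= n -> decode_code_rec k m = decode_code m.
  by move=> mn; apply: decode_code_fuel; lia.
by rewrite !dE //; lia.
Qed.

Lemma eval_det c x y z : eval c x y -> eval c x z -> y = z.
Proof.
elim: c x y z => [||||f If g Ig|f If g Ig|f If g Ig|f If] x y z /=; try by move=> -> ->.
- by move=> [u [v [fu gv ->]]] [u' [v' [fu' gv' ->]]]; rewrite (If _ _ _ fu fu') (Ig _ _ _ gv gv').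
- by move=> [u gu fy] [u' gu' fz]; move: fy; rewrite (Ig _ _ _ gu gu') => fy; exact: If fy fz.
- elim: (unpairn x).2 y z => [|n IH] y z; first exact: If.
  by move=> [r nr gy] [r' nr' gz]; move: gy; rewrite (IH _ _ nr nr') => gy; exact: Ig gy gz.
- move=> [fy ly] [fz lz]; case: (ltngtP y z) => // [/lz|/ly] [v fv].
    by have := If _ _ _ fy fv.
  by have := If _ _ _ fz fv.
Qed.

Definition triple (e x y : nat) : nat := pairn e (pairn x y).

(* A certificate is a finite list of triples <e, <x, y>> recording computations "program e
   maps x to y", each of which follows from others in the list by one clause of [eval]. *)
Definition justified (L : seq nat) (t : nat) : bool :=
  let e := p1 t in let x := p1 (p2 t) in let y := p2 (p2 t) in
  let q := (e - 4) %/ 4 in let r := (e - 4) %% 4 in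
  let mem s := has (fun u => u == s) L in
  if e <= 3 then
    if e == 0 then y == 0 else if e == 1 then y == x.+1
    else if e == 2 then y == p1 x else y == p2 x
  else if r == 0 then mem (triple (p1 q) x (p1 y)) && mem (triple (p2 q) x (p2 y))
  else if r == 1 then
    has (fun s => (s == triple (p2 q) x (p2 (p2 s))) && mem (triple (p1 q) (p2 (p2 s)) y)) L
  else if r == 2 then
    if p2 x == 0 then mem (triple (p1 q) (p1 x) y) else
    has (fun s => (s == triple e (pairn (p1 x) (p2 x).-1) (p2 (p2 s))) &&
      mem (triple (p2 q) (pairn (p1 x) (pairn (p2 x).-1 (p2 (p2 s)))) y)) L
  else mem (triple q (pairn x y) 0) && allb y (fun m =>
    has (fun s => (s == triple q (pairn x m) (p2 (p2 s))) && (1 <= p2 (p2 s))) L).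

Definition certificate (L : seq nat) : bool := all (justified L) L.

Definition cert_check (e x y l : nat) : bool :=
  certificate (dec l) && has (fun u => u == triple e x y) (dec l).

Lemma recf_cert_check e x y l : recf e -> recf x -> recf y -> recf l ->
  recf (fun z => nat_of_bool (cert_check (e z) (x z) (y z) (l z))).
Proof.
move=> *; rewrite /cert_check /certificate /justified /triple /=; cmp.
Qed.
#[global] Hint Resolve recf_cert_check : recfdb.

Lemma mem_hasE (L : seq nat) s : has (fun u => u == s) L = (s \in L).
Proof. by rewrite has_pred1. Qed.

Lemma code_cases e : (e <= 3) \/ exists q r, [/\ r < 4, e = (q * 4 + r).+4,
  (e - 4) %/ 4 = q & (e - 4) %% 4 = r].
Proof.
case: (leqP e 3) => e3; [by left|right].
exists ((e - 4) %/ 4), ((e - 4) %% 4); split => //; first by rewrite ltn_mod.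
by rewrite -divn_eq; lia.
Qed.

Lemma decode_codeqr q r : r < 4 -> decode_code (q * 4 + r).+4 =
  match r with
  | 0 => CPair (decode_code (p1 q)) (decode_code (p2 q))
  | 1 => CComp (decode_code (p1 q)) (decode_code (p2 q))
  | 2 => CPrec (decode_code (p1 q)) (decode_code (p2 q))
  | _ => CFind (decode_code q)
  end.
Proof.
by move=> r4; rewrite decode_codeE modnMDl divnMDl // modn_small // divn_small // addn0.
Qed.

(** A certificate is not ordered, but it cannot justify itself in a circle: each clause refers to
    smaller program codes, except that of [CPrec], which may keep the code and then lowers the
    recursion argument. Hence induction on [e] and, inside, on that argument. *)
Lemma certificate_sound L e x y :
  certificate L -> triple e x y \in L -> phi e x y.
Proof.
move=> LL; elim/ltn_ind: e x y => e IH x y tL.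
have := allP LL _ tL; rewrite /justified /triple !pairnE !mem_hasE.
case: (code_cases e) => [|[q [r [r4 eE -> ->]]]].
  by move: e IH tL => [|[|[|[|e]]]] //= IH tL _ /eqP ->.
have qe : q < e by lia.
have l1 := p1_le q; have l2 := p2_le q.
have IH0 := IH _ qe.
have IH1 := IH (p1 q) ltac:(lia); have IH2 := IH (p2 q) ltac:(lia).
rewrite leqNgt (_ : 3 < e) /=; last by lia.
rewrite /phi eE decode_codeqr //.
move: r r4 eE => [|[|[|[|r]]]] //= _ eE.
- move=> /andP [/IH1 Hf /IH2 Hg]; exists (p1 y), (p2 y); split => //.
  by rewrite pairn_p.
- case/hasP => s sL; rewrite mem_hasE => /andP [/eqP sE /IH1 Hf].
  by exists (p2 (p2 s)) => //; apply: IH2; rewrite /triple -sE.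
- rewrite -/(p1 x) -/(p2 x); move: tL; rewrite -{1}(pairn_p x).
  elim: (p2 x) y => [|n IHn] y tL /=; first by move/IH1.
  case/hasP => s sL; rewrite mem_hasE => /andP [/eqP sE /IH2 Hg].
  exists (p2 (p2 s)) => //.
  have sL' : triple e (pairn (p1 x) n) (p2 (p2 s)) \in L by rewrite /triple eE -sE.
  (* The inner hypothesis asks for the justification of the predecessor, which holds because that
     triple belongs to the certificate too. *)
  apply: (IHn _ sL'); have := allP LL _ sL'.
  rewrite /justified /triple !pairnE !mem_hasE.
  rewrite leqNgt (_ : 3 < e) /=; last by lia.
  rewrite eE (_ : (q * 4 + 2).+4 - 4 = q * 4 + 2); last by lia.
  rewrite modnMDl divnMDl //= addn0.
  case: n {IHn sE sL' tL Hg} => [|n] //.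
- rewrite -/(pairn x y) => /andP [/IH0 f0 /allbP H]; split => // m my.
  have /hasP [s sL /andP [/eqP sE s0]] := H _ my.
  exists (p2 (p2 s)).-1; rewrite prednK //.
  by apply: IH0; rewrite /triple -sE.
Qed.

Lemma justified_sub (L L' : seq nat) t :
  {subset L <= L'} -> justified L t -> justified L' t.
Proof.
move=> sub; rewrite /justified.
have hs (P Q : pred nat) : (forall s, P s -> Q s) -> has P L -> has Q L'.
  by move=> PQ /hasP [s /sub sL /PQ Qs]; apply/hasP; exists s.
have hm s : has (fun u => u == s) L -> has (fun u => u == s) L' by exact: hs.
case: ifP => // _; case: ifP => _.
  by move=> /andP [/hm -> /hm ->].
case: ifP => _; first by apply: hs => s /andP [-> /hm ->].
case: ifP => _.
  by case: ifP => _; [exact: hm | apply: hs => s /andP [-> /hm ->]].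
move=> /andP [/hm -> /allbP H]; apply/allbP => m my.
exact: hs (H _ my).
Qed.

Definition has_cert (e x y : nat) : Prop :=
  exists L, certificate L /\ triple e x y \in L.

Lemma certificate_cat L L' : certificate L -> certificate L' -> certificate (L ++ L').
Proof.
move=> /allP H /allP H'; apply/allP => t; rewrite mem_cat => /orP [/H|/H'];
  apply: justified_sub => s; rewrite mem_cat => ->; rewrite ?orbT //.
Qed.

Lemma has_cert_step L e x y :
  certificate L -> justified L (triple e x y) -> has_cert e x y.
Proof.
move=> cL jt; exists (triple e x y :: L); split; last exact: mem_head.
have sub : {subset L <= triple e x y :: L} by move=> s; rewrite inE orbC => ->.
rewrite /certificate /= (justified_sub sub jt) /=.
by apply/allP => s /(allP cL); exact: justified_sub.
Qed.

Lemma has_cert_union n (P : nat -> nat -> Prop) :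
  (forall m, m < n -> exists L t, [/\ certificate L, t \in L & P m t]) ->
  exists L, certificate L /\ forall m, m < n -> exists2 t, t \in L & P m t.
Proof.
elim: n => [|n IH] H; first by exists [::].
have [m mn|L [cL HL]] := IH; first by apply: H; lia.
have [L' [t [cL' tL' Pt]]] := H n (ltnSn n).
exists (L ++ L'); split; first exact: certificate_cat.
move=> m; rewrite ltnS leq_eqVlt => /orP [/eqP ->|/HL [s sL Ps]].
  by exists t; rewrite // mem_cat tL' orbT.
by exists s; rewrite // mem_cat sL.
Qed.

(** Certificates of the subcomputations are concatenated, since justification is monotone in the
    list; for [CFind] there are finitely many values below the result to collect. *)
Lemma certificate_complete e x y : phi e x y -> has_cert e x y.
Proof.
rewrite /phi; elim/ltn_ind: e x y => e IH x y.
case: (code_cases e) => [|[q [r [r4 eE qE rE]]]].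
  move: e IH => [|[|[|[|e]]]] //= _ _ -> ; apply: (@has_cert_step [::]) => //;
  by rewrite /justified /triple !pairnE /= ?eqxx.
have qe : q < e by lia.
have l1 := p1_le q; have l2 := p2_le q.
have IH0 := IH _ qe.
have IH1 := IH (p1 q) ltac:(lia); have IH2 := IH (p2 q) ltac:(lia).
have jE L X Y : justified L (triple e X Y) = 
  if r == 0 then (triple (p1 q) X (p1 Y) \in L) && (triple (p2 q) X (p2 Y) \in L)
  else if r == 1 then
    has (fun s => (s == triple (p2 q) X (p2 (p2 s))) && (triple (p1 q) (p2 (p2 s)) Y \in L)) L
  else if r == 2 then
    if p2 X == 0 then triple (p1 q) (p1 X) Y \in L else
    has (fun s => (s == triple e (pairn (p1 X) (p2 X).-1) (p2 (p2 s))) &&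
      (triple (p2 q) (pairn (p1 X) (pairn (p2 X).-1 (p2 (p2 s)))) Y \in L)) L
  else (triple q (pairn X Y) 0 \in L) && allb Y (fun m =>
    has (fun s => (s == triple q (pairn X m) (p2 (p2 s))) && (1 <= p2 (p2 s))) L).
  rewrite /justified {1 2 3 4 5 6 7 8 9 10 11}/triple !pairnE qE rE !mem_hasE leqNgt (_ : 3 < e) /=; last by lia.
  by do ![case: ifP => _]; rewrite ?pairnE //; apply: eq_has => s; rewrite mem_hasE.
have p22 a b c : p2 (p2 (triple a b c)) = c by rewrite /triple !pairnE.
rewrite {1}eE decode_codeqr //.
move: r r4 eE {qE rE} jE => [|[|[|[|r]]]] //= _ eE jE.
- move=> [u [v [/IH1 [L [cL uL]] /IH2 [L' [cL' vL']] ->]]].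
  apply: (has_cert_step (certificate_cat cL cL')).
  by rewrite jE !pairnE !mem_cat uL vL' orbT.
- move=> [u /IH2 [L [cL uL]] /IH1 [L' [cL' vL']]].
  apply: (has_cert_step (certificate_cat cL cL')).
  rewrite jE; apply/hasP; exists (triple (p2 q) x u); first by rewrite mem_cat uL.
  by rewrite p22 eqxx mem_cat vL' orbT.
- rewrite -/(p1 x) -/(p2 x) (_ : has_cert e x y = has_cert e (pairn (p1 x) (p2 x)) y); last by rewrite pairn_p.
  elim: (p2 x) y => [|n IHn] y /=.
    move/IH1 => [L [cL yL]]; apply: (has_cert_step cL).
    by rewrite jE !pairnE.
  move=> [u /IHn [L [cL uL]] /IH2 [L' [cL' vL']]].
  apply: (has_cert_step (certificate_cat cL cL')).
  rewrite jE !pairnE /=; apply/hasP; exists (triple e (pairn (p1 x) n) u).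
    by rewrite mem_cat uL.
  by rewrite p22 eqxx mem_cat vL' orbT.
- move=> [/IH0 [L [cL uL]] H].
  have [|L' [cL' HL']] := @has_cert_union y (fun m t => exists v, t = triple q (pairn x m) v.+1).
    move=> m /H [v /IH0 [L' [cL' vL']]].
    by exists L', (triple q (pairn x m) v.+1); split => //; exists v.
  apply: (has_cert_step (certificate_cat cL cL')).
  rewrite jE mem_cat uL /=; apply/allbP => m /HL' [t tL' [v tE]].
  apply/hasP; exists t; first by rewrite mem_cat tL' orbT.
  by rewrite {2}tE p22 tE p22 eqxx.
Qed.

(** Kleene's normal form, with coded certificates as witnesses of halting. *)
Lemma phiP e x y : phi e x y <-> exists l, cert_check e x y l.
Proof.
split=> [/certificate_complete [L [cL tL]]|[l /andP [cl]]].
  by exists (enc L); rewrite /cert_check CodeSeq.codeK cL mem_hasE.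
by rewrite mem_hasE; exact: certificate_sound.
Qed.

Fixpoint encode (c : code) : nat :=
  match c with
  | CZero => 0
  | CSucc => 1
  | CFst => 2
  | CSnd => 3
  | CPair f g => (pairn (encode f) (encode g) * 4 + 0).+4
  | CComp f g => (pairn (encode f) (encode g) * 4 + 1).+4
  | CPrec f g => (pairn (encode f) (encode g) * 4 + 2).+4
  | CFind f => (encode f * 4 + 3).+4
  end.

Lemma encodeK c : decode_code (encode c) = c.
Proof. by elim: c => //= [f If g Ig|f If g Ig|f If g Ig|f If]; rewrite decode_codeqr // ?pairnE ?If ?Ig. Qed.

Lemma recf_computable f : recf f -> computable_fun f.
Proof. by move=> [c cP]; exists (encode c) => x; rewrite /phi encodeK. Qed.

Fixpoint const_code (n : nat) : code :=
  if n is m.+1 then CComp CSucc (const_code m) else CZero.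

Lemma eval_const_code n x y : eval (const_code n) x y <-> y = n.
Proof.
by elim: n y => [|n IH] y //=; split => [[u /IH -> ->]|->] //; exists n => //; apply/IH.
Qed.

Lemma recf_encode_const f : recf f -> recf (fun x => encode (const_code (f x))).
Proof.
move=> cf; apply: (@recf_ext (fun x => iteri (f x) (fun _ r => (pairn 1 r * 4 + 1).+4) 0)).
  by move=> x; elim: (f x) => //= n ->.
cmp.
Qed.
#[global] Hint Resolve recf_encode_const : recfdb.

(** The s-m-n theorem: the parameter is hard-wired as a program with constant value, whose code is
    recursive in that value. *)
Lemma smn (c : code) : exists2 f, recf f &
  forall x y z, phi (f x) y z <-> eval c (pairn x y) z.
Proof.
have [i iP] := recf_id.
exists (fun x => encode (CComp c (CPair (const_code x) i))); first by rewrite /=; cmp.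
move=> x y z; rewrite /phi encodeK /=; split.
  by move=> [u [a [b [/eval_const_code -> ib ->]]] cz]; rewrite (eval_det (iP y) ib).
by move=> cz; exists (pairn x y) => //; exists x, y; split => //; apply/eval_const_code.
Qed.

(** * Recursively enumerable and [Pi02] predicates *)

Definition re (P : nat -> Prop) : Prop :=
  exists2 S : nat -> nat -> bool, recf (fun z => nat_of_bool (S (p1 z) (p2 z))) &
    forall x, P x <-> exists z, S x z.

Lemma re_dec (b : nat -> bool) : recf (fun x => nat_of_bool (b x)) -> re (fun x => is_true (b x)).
Proof.
move=> cb; exists (fun x _ => b x); last by move=> x; split => [|[]] //; exists 0.
pose B x := nat_of_bool (b x); have cB : recf B by [].
by change (recf (fun z => B (p1 z))); cmp.
Qed.

Lemma recf_appb2 (S : nat -> nat -> bool) f g :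
  recf (fun z => nat_of_bool (S (p1 z) (p2 z))) -> recf f -> recf g ->
  recf (fun x => nat_of_bool (S (f x) (g x))).
Proof. exact: (@recf_app2 (fun x y => nat_of_bool (S x y))). Qed.

#[global] Hint Extern 2 (recf _) =>
  match goal with
  | H : recf (fun x => nat_of_bool (?b x)) |- recf (fun x => nat_of_bool (?b (@?g x))) =>
      apply: (@recf_comp (fun x => nat_of_bool (b x)) g H)
  | H : recf (fun z => nat_of_bool (?h (p1 z) (p2 z)))
    |- recf (fun x => nat_of_bool (?h (@?f x) (@?g x))) => apply: (@recf_appb2 h f g H)
  end : recfdb.

Lemma re_and P Q : re P -> re Q -> re (fun x => P x /\ Q x).
Proof.
move=> [S cS SP] [T cT TQ].
exists (fun x z => S x (p1 z) && T x (p2 z)); first by cmp.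
move=> x; rewrite SP TQ; split => [[[y Sy] [z Tz]]|[z /andP [Sz Tz]]].
  by exists (pairn y z); rewrite !pairnE Sy.
by split; [exists (p1 z)|exists (p2 z)].
Qed.

Lemma re_ex (P : nat -> nat -> Prop) :
  re (fun z => P (p1 z) (p2 z)) -> re (fun x => exists y, P x y).
Proof.
move=> [S cS SP]; exists (fun x z => S (pairn x (p1 z)) (p2 z)); first by cmp.
move=> x; split => [[y]|[z Sz]].
  have := SP (pairn x y); rewrite !pairnE => -> [z Sz].
  by exists (pairn y z); rewrite !pairnE.
exists (p1 z); have := SP (pairn x (p1 z)); rewrite !pairnE => ->.
by exists (p2 z).
Qed.

(** Collection: the finitely many witnesses lie below one bound, and once that bound is given both
    quantifiers are bounded searches. *)
Lemma re_ball b (P : nat -> nat -> Prop) : recf b ->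
  re (fun z => P (p1 z) (p2 z)) -> re (fun x => forall i, i < b x -> P x i).
Proof.
move=> cb [S cS SP].
exists (fun x z => allb (b x) (fun i => hasb z (fun w => S (pairn x i) w))); first by cmp.
have PS x i : P x i <-> exists z, S (pairn x i) z by rewrite -SP !pairnE.
move=> x; split => [H|[z /allbP H] i ib]; last first.
  by apply/PS; have /hasbP [w _ Sw] := H _ ib; exists w.
suff [z zP] : exists z, forall i, i < b x -> exists2 w, w < z & S (pairn x i) w.
  by exists z; apply/allbP => i /zP Hi; apply/hasbP.
elim: (b x) H => [|n IH] H; first by exists 0.
have [i ilt|z zP] := IH; first by apply: H; lia.
have [w Sw] := (PS _ _).1 (H n (ltnSn n)).
exists (maxn z w.+1) => i; rewrite ltnS leq_eqVlt => /orP [/eqP ->|/zP [v vz Sv]].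
  by exists w => //; lia.
by exists v => //; lia.
Qed.

Lemma re_phi e x y : recf e -> recf x -> recf y -> re (fun z => phi (e z) (x z) (y z)).
Proof.
move=> ce cx cy; exists (fun z l => cert_check (e z) (x z) (y z) l); first by cmp.
by move=> z; exact: phiP.
Qed.

Definition pi2 (P : nat -> Prop) : Prop :=
  exists2 S : nat -> nat -> nat -> bool,
    recf (fun z => nat_of_bool (S (p1 z) (p1 (p2 z)) (p2 (p2 z)))) &
    forall x, P x <-> forall y, exists z, S x y z.

Lemma pi2_Pi02 P : pi2 P -> Pi02 P.
Proof.
move=> [S [c cP] SP]; exists S => //; exists (encode c) => x y z.
by have := cP (pairn x (pairn y z)); rewrite /phi encodeK !pairnE.
Qed.

Lemma pi2_iff P Q : (forall x, P x <-> Q x) -> pi2 P -> pi2 Q.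
Proof. by move=> PQ [S cS SP]; exists S => // x; rewrite -PQ. Qed.

Lemma recf_appb3 (S : nat -> nat -> nat -> bool) f g h :
  recf (fun z => nat_of_bool (S (p1 z) (p1 (p2 z)) (p2 (p2 z)))) -> recf f -> recf g -> recf h ->
  recf (fun x => nat_of_bool (S (f x) (g x) (h x))).
Proof. exact: (@recf_app3 (fun x y z => nat_of_bool (S x y z))). Qed.

#[global] Hint Extern 2 (recf _) =>
  match goal with
  | H : recf (fun z => nat_of_bool (?h (p1 z) (p1 (p2 z)) (p2 (p2 z))))
    |- recf (fun x => nat_of_bool (?h (@?f x) (@?g x) (@?k x))) => apply: (@recf_appb3 h f g k H)
  end : recfdb.

(** For every witness of the premise there must be a witness of the conclusion. Nearly all
    conditions of the upper bound are universally quantified implications of this kind. *)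
Lemma pi2_imp P Q : re P -> re Q -> pi2 (fun x => P x -> Q x).
Proof.
move=> [S cS SP] [T cT TQ].
exists (fun x y z => S x y ==> T x z); first by cmp.
move=> x; rewrite SP TQ; split => [H y|H [y Sy]].
  case Sy: (S x y) => /=; last by exists 0.
  by case: H => [|z Tz]; [exists y|exists z].
by have [z] := H y; rewrite Sy; exists z.
Qed.

Lemma pi2_re P : re P -> pi2 P.
Proof.
move=> rP; apply: (@pi2_iff (fun x => is_true true -> P x)).
  by move=> x; split => // H; exact: H.
by apply: pi2_imp rP; apply: re_dec; exact: recf_const.
Qed.

Lemma pi2_all (P : nat -> nat -> Prop) :
  pi2 (fun z => P (p1 z) (p2 z)) -> pi2 (fun x => forall y, P x y).
Proof.
move=> [S cS SP]; exists (fun x y z => S (pairn x (p1 y)) (p2 y) z); first by cmp.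
have PS x y : P x y <-> forall u, exists z, S (pairn x y) u z by rewrite -SP !pairnE.
move=> x; split => [H y|H y]; first exact: (PS _ _).1 (H _) _.
by apply/PS => u; have := H (pairn y u); rewrite !pairnE.
Qed.

Lemma pi2_and P Q : pi2 P -> pi2 Q -> pi2 (fun x => P x /\ Q x).
Proof.
move=> [S cS SP] [T cT TQ].
exists (fun x y z => S x y (p1 z) && T x y (p2 z)); first by cmp.
move=> x; rewrite SP TQ; split => [[HS HT] y|H].
  have [[z Sz] [w Tw]] := (HS y, HT y).
  by exists (pairn z w); rewrite !pairnE Sz.
by split => y; have [z /andP [Sz Tz]] := H y; [exists (p1 z)|exists (p2 z)].
Qed.

Create HintDb redb discriminated.
#[global] Hint Constants Opaque : redb.
#[global] Hint Variables Opaque : redb.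
#[global] Hint Resolve re_dec re_and re_ex re_ball re_phi pi2_all pi2_and pi2_imp | 2 : redb.
#[global] Hint Resolve pi2_re | 50 : redb.
#[global] Hint Extern 1 (recf _) => cmp : redb.
Ltac rec := solve [auto 100 with redb].

(** * Arithmetic on codes *)

Definition ratc (a b d : nat) : nat := pairn (pairn a b) d.
Definition rnum (m : nat) : nat := p1 (p1 m).
Definition rneg (m : nat) : nat := p2 (p1 m).
Definition rden (m : nat) : nat := (p2 m).+1.

Definition radd (m n : nat) : nat :=
  ratc (rnum m * rden n + rnum n * rden m) (rneg m * rden n + rneg n * rden m)
    (rden m * rden n).-1.
Definition rmul (m n : nat) : nat :=
  ratc (rnum m * rnum n + rneg m * rneg n) (rnum m * rneg n + rneg m * rnum n)
    (rden m * rden n).-1.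
Definition ropp (m : nat) : nat := ratc (rneg m) (rnum m) (p2 m).
Definition rlt (m n : nat) : bool :=
  (rnum m * rden n + rneg n * rden m).+1 <= rnum n * rden m + rneg m * rden n.
Definition rle (m n : nat) : bool :=
  rnum m * rden n + rneg n * rden m <= rnum n * rden m + rneg m * rden n.

Lemma recf_ratc f g h : recf f -> recf g -> recf h -> recf (fun x => ratc (f x) (g x) (h x)).
Proof. by move=> *; rewrite /ratc; cmp. Qed.
Lemma recf_rnum f : recf f -> recf (fun x => rnum (f x)).
Proof. by move=> *; rewrite /rnum; cmp. Qed.
Lemma recf_rneg f : recf f -> recf (fun x => rneg (f x)).
Proof. by move=> *; rewrite /rneg; cmp. Qed.
Lemma recf_rden f : recf f -> recf (fun x => rden (f x)).
Proof. by move=> *; rewrite /rden; cmp. Qed.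
#[global] Hint Resolve recf_ratc recf_rnum recf_rneg recf_rden : recfdb.
Lemma recf_radd f g : recf f -> recf g -> recf (fun x => radd (f x) (g x)).
Proof. by move=> *; rewrite /radd; cmp. Qed.
Lemma recf_rmul f g : recf f -> recf g -> recf (fun x => rmul (f x) (g x)).
Proof. by move=> *; rewrite /rmul; cmp. Qed.
Lemma recf_ropp f : recf f -> recf (fun x => ropp (f x)).
Proof. by move=> *; rewrite /ropp; cmp. Qed.
Lemma recf_rlt f g : recf f -> recf g -> recf (fun x => nat_of_bool (rlt (f x) (g x))).
Proof. by move=> *; rewrite /rlt; cmp. Qed.
Lemma recf_rle f g : recf f -> recf g -> recf (fun x => nat_of_bool (rle (f x) (g x))).
Proof. by move=> *; rewrite /rle; cmp. Qed.
#[global] Hint Resolve recf_radd recf_rmul recf_ropp recf_rlt recf_rle : recfdb.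

Definition cfadd (c d : nat) : nat := pairn (radd (p1 c) (p1 d)) (radd (p2 c) (p2 d)).
Definition cfmul (c d : nat) : nat :=
  pairn (radd (rmul (p1 c) (p1 d)) (ropp (rmul (p2 c) (p2 d))))
        (radd (rmul (p1 c) (p2 d)) (rmul (p2 c) (p1 d))).
Definition cfconj (c : nat) : nat := pairn (p1 c) (ropp (p2 c)).
Definition cfone : nat := pairn (ratc 1 0 0) 0.
Definition cfm1 : nat := pairn (ratc 0 1 0) 0.

Lemma recf_cfadd f g : recf f -> recf g -> recf (fun x => cfadd (f x) (g x)).
Proof. by move=> *; rewrite /cfadd; cmp. Qed.
Lemma recf_cfmul f g : recf f -> recf g -> recf (fun x => cfmul (f x) (g x)).
Proof. by move=> *; rewrite /cfmul; cmp. Qed.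
Lemma recf_cfconj f : recf f -> recf (fun x => cfconj (f x)).
Proof. by move=> *; rewrite /cfconj; cmp. Qed.
#[global] Hint Resolve recf_cfadd recf_cfmul recf_cfconj : recfdb.

Definition catc (p q : nat) : nat := foldr consc q (dec p).
Definition mapc (h : nat -> nat) (p : nat) : nat := foldr (fun t r => consc (h t) r) 0 (dec p).
(** Letters 2j and 2j + 1 stand for X_j and its adjoint. *)
Definition flipl (l : nat) : nat := if odd l then l.-1 else l.+1.
Definition starterm (t : nat) : nat := pairn (cfconj (p1 t)) (revc (mapc flipl (p2 t))).
Definition multerm (t u : nat) : nat := pairn (cfmul (p1 t) (p1 u)) (catc (p2 t) (p2 u)).
(** Sums are concatenations and like terms are never collected, so most laws of an algebra fail for
    codes. They can hold only up to differences of norm zero, and so have to be imposed on N one by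
    one. *)
Definition cadd (p q : nat) : nat := catc p q.
Definition cmul (p q : nat) : nat :=
  foldr (fun t r => catc (mapc (multerm t) q) r) 0 (dec p).
Definition cstar (p : nat) : nat := mapc starterm p.
Definition cterm (c w : nat) : nat := consc (pairn c w) 0.
(* Locked because [cconst cfm1] is a unary numeral with two million successors. *)
HB.lock Definition cconst (c : nat) : nat := cterm c 0.
Definition cletter (l : nat) : nat := cterm cfone (consc l 0).
Definition csub (p q : nat) : nat := cadd p (cmul (cconst cfm1) q).
Definition csum (n : nat) (f : nat -> nat) : nat := iteri n (fun i r => cadd r (f i)) 0.

Lemma recf_catc f g : recf f -> recf g -> recf (fun x => catc (f x) (g x)).
Proof. by move=> cf cg; rewrite /catc; apply: (@recf_foldr (fun _ => consc)); cmp. Qed.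
Lemma recf_mapc (h : nat -> nat -> nat) f :
  recf (fun z => h (p1 z) (p2 z)) -> recf f -> recf (fun x => mapc (h x) (f x)).
Proof.
move=> ch cf; rewrite /mapc.
by apply: (@recf_foldr (fun x t r => consc (h x t) r)); cmp.
Qed.
#[global] Hint Resolve recf_catc recf_mapc : recfdb.
Lemma recf_flipl f : recf f -> recf (fun x => flipl (f x)).
Proof. by move=> *; rewrite /flipl; cmp. Qed.
#[global] Hint Resolve recf_flipl : recfdb.
Lemma recf_starterm f : recf f -> recf (fun x => starterm (f x)).
Proof.
move=> cf; rewrite /starterm.
have H := @recf_mapc (fun _ => flipl) (fun x => p2 (f x)).
by apply: recf_pairn; [cmp|apply: recf_revc; apply: H; cmp].
Qed.
Lemma recf_multerm f g : recf f -> recf g -> recf (fun x => multerm (f x) (g x)).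
Proof. by move=> *; rewrite /multerm; cmp. Qed.
#[global] Hint Resolve recf_starterm recf_multerm : recfdb.
Lemma recf_cadd f g : recf f -> recf g -> recf (fun x => cadd (f x) (g x)).
Proof. by move=> *; rewrite /cadd; cmp. Qed.
Lemma recf_cmul f g : recf f -> recf g -> recf (fun x => cmul (f x) (g x)).
Proof.
move=> cf cg; rewrite /cmul.
by apply: (@recf_foldr (fun x t r => catc (mapc (multerm t) (g x)) r)); cmp.
Qed.
Lemma recf_cstar f : recf f -> recf (fun x => cstar (f x)).
Proof.
by move=> cf; rewrite /cstar; apply: (@recf_mapc (fun _ => starterm)); cmp.
Qed.
Lemma recf_cterm f g : recf f -> recf g -> recf (fun x => cterm (f x) (g x)).
Proof. by move=> *; rewrite /cterm; cmp. Qed.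
#[global] Hint Resolve recf_cadd recf_cmul recf_cstar recf_cterm : recfdb.
Lemma recf_cconst f : recf f -> recf (fun x => cconst (f x)).
Proof. by move=> *; rewrite cconst.unlock; cmp. Qed.
Lemma recf_cletter f : recf f -> recf (fun x => cletter (f x)).
Proof. by move=> *; rewrite /cletter; cmp. Qed.
#[global] Hint Resolve recf_cconst recf_cletter : recfdb.
Lemma recf_csub f g : recf f -> recf g -> recf (fun x => csub (f x) (g x)).
Proof. by rewrite /csub; move: (cconst cfm1) => c cf cg; cmp. Qed.
Lemma recf_csum f (g : nat -> nat -> nat) :
  recf f -> recf (fun z => g (p1 z) (p2 z)) -> recf (fun x => csum (f x) (g x)).
Proof.
move=> cf cg; rewrite /csum.
by apply: (@recf_iteri (fun _ => 0) f (fun x i r => cadd r (g x i))); cmp.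
Qed.
#[global] Hint Resolve recf_csub recf_csum : recfdb.

Lemma dec_catc p q : dec (catc p q) = dec p ++ dec q.
Proof. by rewrite /catc; elim: (dec p) => //= h s IH; rewrite dec_consc IH. Qed.

Lemma dec_mapc h p : dec (mapc h p) = map h (dec p).
Proof. by rewrite /mapc; elim: (dec p) => //= t s IH; rewrite dec_consc IH. Qed.

(** * Values of codes as rationals, as complex numbers and in an algebra *)

Local Open Scope classical_set_scope.
Local Open Scope ring_scope.

Definition nrat (m : nat) : rat := ((rnum m)%:R - (rneg m)%:R) / (rden m)%:R.

Lemma decode_ratE m : decode_rat m = nrat m.
Proof.
rewrite /decode_rat /nrat /rnum /rneg /rden /p1 /p2.
by case: (unpairn m) => p d /=; case: (unpairn p) => a b /=; rewrite intrB.
Qed.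

Lemma nrat_ratc a b d : nrat (ratc a b d) = (a%:R - b%:R) / d.+1%:R.
Proof. by rewrite /nrat /rnum /rneg /rden /ratc !pairnE. Qed.

Lemma rden_gt0 m : 0 < (rden m)%:R :> rat.
Proof. by rewrite ltr0n. Qed.

Lemma rden_neq0 m : (rden m)%:R != 0 :> rat.
Proof. by rewrite gt_eqF ?rden_gt0. Qed.

Lemma nrat_radd m n : nrat (radd m n) = nrat m + nrat n.
Proof.
rewrite nrat_ratc /nrat prednK ?muln_gt0 // !(natrD, natrM).
by field; rewrite !rden_neq0.
Qed.

Lemma nrat_rmul m n : nrat (rmul m n) = nrat m * nrat n.
Proof.
rewrite nrat_ratc /nrat prednK ?muln_gt0 // !(natrD, natrM).
by field; rewrite !rden_neq0.
Qed.

Lemma nrat_ropp m : nrat (ropp m) = - nrat m.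
Proof. by rewrite nrat_ratc /nrat -mulNr opprB. Qed.

Lemma rltE m n : rlt m n = (nrat m < nrat n).
Proof.
rewrite /rlt /nrat ltr_pdivrMr ?rden_gt0 // mulrAC ltr_pdivlMr ?rden_gt0 //.
by rewrite -(@ltr_nat rat) !mulrBl ltrBlDr addrAC ltrBrDr !(natrD, natrM).
Qed.

Lemma rleE m n : rle m n = (nrat m <= nrat n).
Proof.
rewrite /rle /nrat ler_pdivrMr ?rden_gt0 // mulrAC ler_pdivlMr ?rden_gt0 //.
by rewrite -(@ler_nat rat) !mulrBl lerBlDr addrAC lerBrDr !(natrD, natrM).
Qed.

Lemma nrat_surj (r : rat) : exists m, nrat m = r.
Proof.
have [d0 dE] : exists d, denq r = d.+1.
  by have := denq_gt0 r; case: (denq r) => [[|d]|] //; exists d.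
have [a [b nE]] : exists a b : nat, numq r = a%:Z - b%:Z.
  by case: (numq r) => n; [exists n, 0; rewrite subr0|exists 0, n.+1; rewrite sub0r NegzE].
by exists (ratc a b d0); rewrite nrat_ratc -[r]divq_num_den nE dE intrB.
Qed.

Lemma nrat0 : nrat 0 = 0.
Proof. by rewrite (_ : 0%N = ratc 0 0 0) // nrat_ratc subrr mul0r. Qed.

Section Coefficients.
Variable R : realType.
Implicit Types (c d : nat).

Definition ccoef c : R[i] := eval_coef R (decode_coef c).

Lemma ccoefE c : ccoef c = (ratr (nrat (p1 c)) +i* ratr (nrat (p2 c)))%C.
Proof.
rewrite /ccoef /decode_coef /eval_coef /p1 /p2.
by case: (unpairn c) => p q /=; rewrite !decode_ratE.
Qed.

Lemma ccoef_add c d : ccoef (cfadd c d) = ccoef c + ccoef d.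
Proof. by rewrite !ccoefE !pairnE !nrat_radd !rmorphD. Qed.

Lemma ccoef_mul c d : ccoef (cfmul c d) = ccoef c * ccoef d.
Proof.
rewrite !ccoefE !pairnE !(nrat_radd, nrat_ropp, nrat_rmul) !(rmorphD, rmorphN, rmorphM) /=.
by [].
Qed.

Lemma ccoef_conj c : ccoef (cfconj c) = (ccoef c)^*.
Proof. by rewrite !ccoefE !pairnE nrat_ropp rmorphN. Qed.

Lemma ccoef_one : ccoef cfone = 1.
Proof. by rewrite ccoefE /cfone !pairnE nrat0 nrat_ratc subr0 divr1 rmorph1 rmorph0. Qed.

Lemma ccoef_m1 : ccoef cfm1 = -1.
Proof.
rewrite ccoefE /cfm1 !pairnE nrat0 nrat_ratc sub0r divr1 rmorphN rmorph1 rmorph0.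
by apply/eqP; rewrite eq_complex /= oppr0 !eqxx.
Qed.

Lemma ccoef0 : ccoef 0 = 0.
Proof. by rewrite ccoefE nrat0 rmorph0. Qed.

End Coefficients.

Section StarBasics.
Variables (C : numClosedFieldType) (A : starAlgType C).
Implicit Types x y : A.

Lemma star0 : star 0 = 0 :> A.
Proof. by apply: (@addIr _ (star 0)); rewrite -starD !add0r. Qed.

Lemma star1 : star 1 = 1 :> A.
Proof. by rewrite -[RHS]starK -[in RHS](mul1r (star 1)) starM starK mul1r. Qed.

Lemma starN x : star (- x) = - star x.
Proof. by apply/eqP; rewrite -subr_eq0 opprK -starD addNr star0. Qed.

Lemma starB x y : star (x - y) = star x - star y.
Proof. by rewrite starD starN. Qed.

Lemma star_sum I (r : seq I) (P : pred I) (F : I -> A) :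
  star (\sum_(i <- r | P i) F i) = \sum_(i <- r | P i) star (F i).
Proof. exact: (big_morph _ starD star0). Qed.

End StarBasics.

Section GeneratedPoints.
Variables (R : realType) (A : cstarAlgType R) (a : nat -> A).

Definition lval (l : nat) : A := eval_letter a (decode_letter l).
Definition wval (w : nat) : A := \prod_(l <- dec w) lval l.
Definition tval (t : nat) : A := ccoef R (p1 t) *: wval (p2 t).

Notation gp := (generated_point a).

Lemma gpE q : gp q = \sum_(t <- dec q) tval t.
Proof.
rewrite /generated_point /eval_starpoly /decode_starpoly big_map.
apply: eq_bigr => t _; rewrite /tval /wval /ccoef /decode_term /p1 /p2.
by case: (unpairn t) => c w /=; rewrite big_map.
Qed.

Lemma gp0 : gp 0 = 0.
Proof. by rewrite gpE big_nil. Qed.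

Lemma gp_consc t q : gp (consc t q) = tval t + gp q.
Proof. by rewrite !gpE dec_consc big_cons. Qed.

Lemma gp_add p q : gp (cadd p q) = gp p + gp q.
Proof. by rewrite !gpE dec_catc big_cat. Qed.

Lemma wval_catc v w : wval (catc v w) = wval v * wval w.
Proof. by rewrite /wval dec_catc big_cat. Qed.

Lemma tval_mul t u : tval (multerm t u) = tval t * tval u.
Proof.
rewrite /tval !pairnE ccoef_mul wval_catc.
by rewrite -scalerAl -scalerAr scalerA.
Qed.

Lemma gp_mul p q : gp (cmul p q) = gp p * gp q.
Proof.
rewrite [gp p]gpE /cmul; elim: (dec p) => [|t s IH] /=.
  by rewrite gp0 big_nil mul0r.
rewrite -[catc _ _]/(cadd _ _) gp_add IH big_cons mulrDl; congr (_ + _).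
by rewrite !gpE dec_mapc big_map mulr_sumr; apply: eq_bigr => u _; rewrite tval_mul.
Qed.

Lemma lval_flip l : lval (flipl l) = star (lval l).
Proof.
have fh : (flipl l)./2 = l./2 by rewrite /flipl; case: ifP => o; lia.
have fo : odd (flipl l) = ~~ odd l by rewrite /flipl; case: ifP => o; lia.
by rewrite /lval /eval_letter /= fh fo; case: (odd l) => //=; rewrite starK.
Qed.

Lemma wval_star w : wval (revc (mapc flipl w)) = star (wval w).
Proof.
rewrite /wval dec_revc dec_mapc -map_rev big_map.
elim: (dec w) => [|l s IH]; first by rewrite !big_nil star1.
rewrite rev_cons -cats1 big_cat IH big_seq1 big_cons starM.
by rewrite lval_flip.
Qed.

Lemma gp_star p : gp (cstar p) = star (gp p).
Proof.
rewrite !gpE dec_mapc big_map star_sum; apply: eq_bigr => t _.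
by rewrite /tval !pairnE ccoef_conj wval_star starZ.
Qed.

Lemma gp_term c w : gp (cterm c w) = ccoef R c *: wval w.
Proof. by rewrite gp_consc gp0 addr0 /tval !pairnE. Qed.

Lemma gp_const c : gp (cconst c) = ccoef R c *: 1.
Proof. by rewrite cconst.unlock gp_term /wval big_nil. Qed.

Lemma gp_letter l : gp (cletter l) = lval l.
Proof.
by rewrite gp_term ccoef_one scale1r /wval dec_consc big_seq1.
Qed.

Lemma gp_sub p q : gp (csub p q) = gp p - gp q.
Proof. by rewrite gp_add gp_mul gp_const ccoef_m1 scaleN1r mulN1r. Qed.

Lemma gp_sum n f : gp (csum n f) = \sum_(i < n) gp (f i).
Proof.
rewrite /csum; elim: n => [|n IH] /=; first by rewrite gp0 big_ord0.
by rewrite gp_add IH big_ord_recr.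
Qed.

End GeneratedPoints.

#[global] Instance ncops (A : pzRingType) : @Ncring.Ring_ops A 0 1 +%R *%R (fun x y => x - y) -%R eq := {}.
#[global] Instance ncring (A : pzRingType) : Ncring.Ring (Ro:=ncops A).
Proof. 
split.
- exact: RelationClasses.eq_equivalence.
- by move=> x y H x' y' H'; rewrite /Algebra_syntax.equality /Ncring.eq_notation H H'.
- by move=> x y H x' y' H'; rewrite /Algebra_syntax.equality /Ncring.eq_notation H H'.
- by move=> x y H x' y' H'; rewrite /Algebra_syntax.equality /Ncring.eq_notation H H'.
- by move=> x y H ; rewrite /Algebra_syntax.equality /Ncring.eq_notation H.
- exact: add0r.
- exact: addrC.
- exact: addrA.
- exact: mul1r.
- exact: mulr1.
- exact: mulrA.
- exact: mulrDl.
- by move=> x y z; exact: mulrDr.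
- by [].
- exact: subrr.
Qed.
Ltac ncr := Ncring_tac.non_commutative_ring.

(** * Norms and limits *)

Section RealSequences.
Variable R : realType.
Implicit Types (e f : nat -> R).

Definition cv0 e : Prop := (e @ \oo --> (0 : R))%classic.

Lemma cv0P e : (forall n, 0 <= e n) ->
  cv0 e <-> forall eps, 0 < eps -> exists N, forall n, (N <= n)%N -> e n < eps.
Proof.
move=> e0; split => [/cvgr0Pnorm_lt H eps /H [N _ NP]|H].
  by exists N => n /NP /=; rewrite ger0_norm.
apply/cvgr0Pnorm_lt => eps /H [N NP]; exists N => // n /NP.
by rewrite /= ger0_norm.
Qed.

Lemma cv0_le e f : (forall n, 0 <= e n <= f n) -> cv0 f -> cv0 e.
Proof.
move=> ef f0; have ef' : \forall n \near \oo, (0 <= e n <= f n) by exists 0%N => // n _; exact: ef.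
exact: (squeeze_cvgr ef' (cvg_cst (0 : R)) f0).
Qed.

Lemma cv0D e f : cv0 e -> cv0 f -> cv0 (fun n => e n + f n).
Proof. by move=> e0 f0; rewrite /cv0 -(addr0 (0 : R)); exact: cvgD. Qed.

Lemma cv0M e f : cv0 e -> cv0 f -> cv0 (fun n => e n * f n).
Proof. by move=> e0 f0; rewrite /cv0 -(mulr0 (0 : R)); exact: cvgM. Qed.

Lemma cv0Ml c e : cv0 e -> cv0 (fun n => c * e n).
Proof. by move=> e0; rewrite /cv0 -(mulr0 c); exact: cvgM (cvg_cst c) e0. Qed.

Lemma cv00 : cv0 (fun=> 0).
Proof. exact: cvg_cst. Qed.

Lemma cv0_half : cv0 (fun n => 2^-1 ^+ n).
Proof.
have h : `|2^-1 : R| < 1 by rewrite ger0_norm; lra.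
have -> : (fun n => 2^-1 ^+ n) = geometric 1 (2^-1 : R).
  by apply/funext => n; rewrite /geometric /= mul1r.
exact: cvg_geometric.
Qed.

Lemma cv0_lt e eps : cv0 e -> 0 < eps -> \forall n \near \oo, e n < eps.
Proof. by move=> e0 eps0; exact: cvgr_lt e0 _ eps0. Qed.

Lemma cv0_shift e k : cv0 e -> cv0 (fun n => e (n + k)%N).
Proof. by rewrite /cv0 -(cvg_shiftn k e). Qed.

Lemma near_ex (P : nat -> Prop) : (\forall n \near \oo, P n) -> exists n, P n.
Proof. by move=> [N _ H]; exists N; exact: (H N (leqnn N)). Qed.

Lemma near_ge (N : nat) : \forall n \near \oo, (N <= n)%N.
Proof. by exists N. Qed.

End RealSequences.

Section Norm.
Variables (R : realType) (A : cstarAlgType R).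
Implicit Types (x y z : A) (u v : nat -> A).
Notation normc := (@Normc.normc R).

Lemma normcN1 : normc (-1) = 1.
Proof. by rewrite /= sqrrN expr1n oppr0 expr0n addr0 sqrtr1. Qed.

Lemma cnormN x : cnorm (- x) = cnorm x.
Proof. by rewrite -scaleN1r cnormZ normcN1 mul1r. Qed.

Lemma cnorm0 : cnorm (0 : A) = 0.
Proof. by rewrite -(scale0r (0 : A)) cnormZ Normc.normc0 mul0r. Qed.

Lemma cnorm_ge0 x : 0 <= cnorm x.
Proof.
have := cnormD x (- x); rewrite subrr cnorm0 cnormN -mulr2n.
by rewrite pmulrn_lge0.
Qed.
Hint Resolve cnorm_ge0 : core.

Lemma cnormB x y : cnorm (x - y) <= cnorm x + cnorm y.
Proof. by apply: le_trans (cnormD _ _) _; rewrite cnormN. Qed.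

Lemma cnormC x y : cnorm (x - y) = cnorm (y - x).
Proof. by rewrite -cnormN opprB. Qed.

Lemma cnorm_tri y x z : cnorm (x - z) <= cnorm (x - y) + cnorm (y - z).
Proof. by rewrite -[x - z](subrKA y); exact: cnormD. Qed.

Lemma cnorm_le x y : cnorm x <= cnorm (x - y) + cnorm y.
Proof. by rewrite -{1}(subrK y x); exact: cnormD. Qed.

Lemma cnorm_dist x y : `|cnorm x - cnorm y| <= cnorm (x - y).
Proof.
rewrite ler_norml; apply/andP; split.
  by have := cnorm_le y x; rewrite cnormC; lra.
by have := cnorm_le x y; lra.
Qed.

Lemma cnorm_starE x : cnorm (star x) = cnorm x.
Proof.
suff H y : cnorm y <= cnorm (star y).
  by apply/le_anti; rewrite H -{2}(starK x) H.
have [->|y0] := eqVneq (cnorm y) 0; first exact: cnorm_ge0.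
have yp : 0 < cnorm y by rewrite lt0r y0 cnorm_ge0.
rewrite -(ler_pM2r yp) -expr2 -cnorm_star.
exact: cnormM.
Qed.

Lemma cnorm1 : cnorm (1 : A) = 1.
Proof.
have := cnorm_star (1 : A); rewrite star1 mulr1 => /esym/eqP.
rewrite expr2 -[X in _ == X]mulr1 -subr_eq0 -mulrBr mulf_eq0 subr_eq0.
case/orP => /eqP // /cnorm0_eq0 /eqP; by rewrite oner_eq0.
Qed.

Lemma cnorm_sum I (r : seq I) (P : pred I) (F : I -> A) :
  cnorm (\sum_(i <- r | P i) F i) <= \sum_(i <- r | P i) cnorm (F i).
Proof.
elim/big_ind2: _ => [|x1 x2 y1 y2 H1 H2|//]; first by rewrite cnorm0.
by apply: le_trans (cnormD _ _) _; exact: lerD.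
Qed.

Lemma cnorm_unitary x : star x * x = 1 -> cnorm x = 1.
Proof.
move=> xx; have := cnorm_star x; rewrite xx cnorm1 => /esym/eqP.
by rewrite sqrf_eq1 => /orP [/eqP //|/eqP xm]; have := cnorm_ge0 x; rewrite xm; lra.
Qed.

Lemma cnorm_sa x : star x = x -> cnorm (x ^+ 2) = cnorm x ^+ 2.
Proof. by move=> xs; rewrite -cnorm_star xs expr2. Qed.

(** Iterating the C*-identity on powers of two gives, together with [pow_trick], what the spectral
    radius formula would give for self-adjoint elements. *)
Lemma cnorm_sa_pow x k : star x = x -> cnorm (x ^+ (2 ^ k)) = cnorm x ^+ (2 ^ k).
Proof.
move=> xs.
have starX n : star (x ^+ n) = x ^+ n.
  by elim: n => [|n IH]; rewrite ?star1 // {1}exprSr starM xs IH -exprS.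
elim: k => [|k IH]; first by rewrite expn0 !expr1.
by rewrite expnSr !exprM cnorm_sa ?IH.
Qed.

Definition cvA u x : Prop := cv0 (fun n => cnorm (u n - x)).

Lemma cvA_le u x e : (forall n, cnorm (u n - x) <= e n) -> cv0 e -> cvA u x.
Proof. by move=> ue; apply: cv0_le => n; rewrite cnorm_ge0 ue. Qed.

Lemma cvA_cst x : cvA (fun=> x) x.
Proof. by apply: cvA_le (@cv00 R) => n; rewrite subrr cnorm0. Qed.

Lemma cvA_ext u v x : (forall n, u n = v n) -> cvA u x -> cvA v x.
Proof. by move=> uv; rewrite (_ : v = u) //; apply/funext => n; rewrite uv. Qed.

Lemma cvA_close u v x : cvA u x -> cv0 (fun n => cnorm (v n - u n)) -> cvA v x.
Proof.
move=> ux vu; apply: cvA_le (cv0D vu ux) => n; exact: cnorm_tri.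
Qed.

Lemma cvA_add u v x y : cvA u x -> cvA v y -> cvA (fun n => u n + v n) (x + y).
Proof.
move=> ux vy; apply: cvA_le (cv0D ux vy) => n.
by rewrite opprD addrACA; exact: cnormD.
Qed.

Lemma cvA_opp u x : cvA u x -> cvA (fun n => - u n) (- x).
Proof. by move=> ux; apply: cvA_le ux => n; rewrite -opprD cnormN. Qed.

Lemma cvA_sub u v x y : cvA u x -> cvA v y -> cvA (fun n => u n - v n) (x - y).
Proof. by move=> ux vy; apply: cvA_add => //; exact: cvA_opp. Qed.

Lemma cvA_scale (c : R[i]) u x : cvA u x -> cvA (fun n => c *: u n) (c *: x).
Proof.
by move=> ux; apply: cvA_le (cv0Ml (normc c) ux) => n; rewrite -scalerBr cnormZ.
Qed.

Lemma cvA_star u x : cvA u x -> cvA (fun n => star (u n)) (star x).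
Proof. by move=> ux; apply: cvA_le ux => n; rewrite -starB cnorm_starE. Qed.

Lemma cvA_mul u v x y : cvA u x -> cvA v y -> cvA (fun n => u n * v n) (x * y).
Proof.
move=> ux vy.
apply: cvA_le (cv0D (cv0D (cv0M ux vy) (cv0Ml (cnorm x) vy)) (cv0Ml (cnorm y) ux)) => n.
rewrite (_ : _ - _ = (u n - x) * (v n - y) + x * (v n - y) + (u n - x) * y); last by ncr.
apply: le_trans (cnormD _ _) _; apply: lerD; last by rewrite mulrC; exact: cnormM.
by apply: le_trans (cnormD _ _) _; apply: lerD; exact: cnormM.
Qed.

Lemma cvA_sum I (r : seq I) (F : I -> nat -> A) (G : I -> A) :
  (forall i, cvA (F i) (G i)) ->
  cvA (fun n => \sum_(i <- r) F i n) (\sum_(i <- r) G i).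
Proof.
move=> FG; elim: r => [|i r IH].
  by rewrite big_nil; apply: cvA_ext (cvA_cst 0) => n; rewrite big_nil.
rewrite big_cons; apply: cvA_ext (cvA_add (FG i) IH) => n.
by rewrite big_cons.
Qed.

Lemma cvA_shift u x k : cvA u x -> cvA (fun n => u (n + k)%N) x.
Proof. exact: (@cv0_shift _ (fun n => cnorm (u n - x))). Qed.

Lemma cvA_norm u x : cvA u x -> ((fun n => cnorm (u n)) @ \oo --> cnorm x)%classic.
Proof.
move=> ux; apply/cvgrPdistC_lt => eps eps0.
by apply: filterS (cv0_lt ux eps0) => n; apply: le_lt_trans; exact: cnorm_dist.
Qed.

Lemma cvA_norm_lt u x t : cvA u x -> cnorm x < t -> \forall n \near \oo, cnorm (u n) < t.
Proof. by move=> /cvA_norm ux xt; exact: cvgr_lt ux _ xt. Qed.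

Lemma cvA_norm_le u x t : cvA u x -> (forall n, cnorm (u n) <= t) -> cnorm x <= t.
Proof.
move=> ux ut; rewrite leNgt; apply/negP => tx.
have [|n] := near_ex (cvA_norm_lt (cvA_sub (cvA_cst x) ux) (_ : _ < cnorm x - t)).
  by rewrite subrr cnorm0 subr_gt0.
by have := cnorm_le x (u n); have := ut n; lra.
Qed.

Lemma cvA_unique u x y : cvA u x -> cvA u y -> x = y.
Proof.
move=> ux uy; apply/eqP; rewrite -subr_eq0; apply/eqP/cnorm0_eq0.
apply/le_anti; rewrite cnorm_ge0 andbT; apply: cvA_norm_le (cvA_sub ux uy) _ => n.
by rewrite subrr cnorm0.
Qed.

Lemma cvAP u x : cvA u x <->
  forall eps : R, 0 < eps -> exists N, forall n, (N <= n)%N -> cnorm (u n - x) < eps.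
Proof. by apply: cv0P. Qed.

Lemma cvA_cauchy u :
  (forall eps : R, 0 < eps -> exists N, forall m n,
     (N <= m)%N -> (N <= n)%N -> cnorm (u m - u n) < eps) -> exists x, cvA u x.
Proof. by move=> /cnorm_complete [x xP]; exists x; apply/cvAP. Qed.

Lemma cvA_geometric u (c : R) : 0 <= c ->
  (forall n, cnorm (u n.+1 - u n) <= c * 2^-1 ^+ n) ->
  exists2 x, cvA u x & forall n, cnorm (u n - x) <= 2 * c * 2^-1 ^+ n.
Proof.
move=> c0 uc; have h0 : 0 <= 2^-1 :> R by lra.
(* The factor 1 - 2^-k is the exact geometric sum; it makes the induction close and is dropped
   afterwards. *)
have tele n k : cnorm (u (n + k)%N - u n) <= 2 * c * 2^-1 ^+ n * (1 - 2^-1 ^+ k).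
  elim: k => [|k IH]; first by rewrite addn0 subrr cnorm0 expr0 subrr mulr0.
  apply: le_trans (cnorm_tri (u (n + k)%N) _ _) _; rewrite addnS.
  have := uc (n + k)%N; rewrite exprD exprS; nra.
have tele2 n k : cnorm (u (n + k)%N - u n) <= 2 * c * 2^-1 ^+ n.
  apply: le_trans (tele n k) _; rewrite ler_piMr //.
    by rewrite !mulr_ge0 ?exprn_ge0 //; lra.
  by rewrite gerBl exprn_ge0.
have dc : cv0 (fun n => 2 * c * 2^-1 ^+ n) by exact: (cv0Ml (2 * c) (@cv0_half R)).
have dc0 n : 0 <= 2 * c * 2^-1 ^+ n by rewrite !mulr_ge0 ?exprn_ge0 //; lra.
have [x ux] : exists x, cvA u x.
  apply: cvA_cauchy => eps eps0.
  have [N NP] := (cv0P dc0).1 dc (eps / 2) ltac:(lra).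
  exists N => m n Nm Nn; apply: le_lt_trans (cnorm_tri (u N) _ _) _.
  have := NP N (leqnn N); have := tele2 N (m - N)%N; have := tele2 N (n - N)%N.
  by rewrite !subnKC // (cnormC (u N)); lra.
exists x => // n; rewrite cnormC.
have H := cvA_sub (cvA_shift n ux) (cvA_cst (u n)).
by apply: (cvA_norm_le H) => k; rewrite addnC.
Qed.

End Norm.
#[global] Hint Resolve cnorm_ge0 : core.

(** * Star homomorphisms *)

Section Homs.
Variables (C : numClosedFieldType) (A B : starAlgType C) (f : A -> B).
Hypothesis hf : unital_star_hom f.

Lemma homD x y : f (x + y) = f x + f y.
Proof. by case: hf => lf _ _; have := lf 1 x y; rewrite !scale1r. Qed.

Lemma hom0 : f 0 = 0.
Proof. by apply: (@addIr _ (f 0)); rewrite -homD !add0r. Qed.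

Lemma homZ c x : f (c *: x) = c *: f x.
Proof. by case: hf => lf _ _; have := lf c x 0; rewrite hom0 !addr0. Qed.

Lemma homN x : f (- x) = - f x.
Proof. by rewrite -scaleN1r homZ scaleN1r. Qed.

Lemma homB x y : f (x - y) = f x - f y.
Proof. by rewrite homD homN. Qed.

Lemma hom1 : f 1 = 1.
Proof. by case: hf => _ [f1 _] _. Qed.

Lemma homM x y : f (x * y) = f x * f y.
Proof. by case: hf => _ [_ fM] _. Qed.

Lemma hom_star x : f (star x) = star (f x).
Proof. by case: hf. Qed.

Lemma hom_sum I (r : seq I) (P : pred I) (F : I -> A) :
  f (\sum_(i <- r | P i) F i) = \sum_(i <- r | P i) f (F i).
Proof. exact: (big_morph f homD hom0). Qed.

Lemma homX x n : f (x ^+ n) = f x ^+ n.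
Proof. by elim: n => [|n IH]; rewrite ?hom1 // !exprS homM IH. Qed.

End Homs.

Lemma hom_comp (C : numClosedFieldType) (A B D : starAlgType C) (f : A -> B) (g : B -> D) :
  unital_star_hom f -> unital_star_hom g -> unital_star_hom (g \o f).
Proof.
move=> hf hg; split.
- by move=> c x y /=; rewrite (homD hf) (homZ hf) (homD hg) (homZ hg).
- by split => [|x y] /=; rewrite ?(hom1 hf) ?(hom1 hg) // (homM hf) (homM hg).
- by move=> x /=; rewrite (hom_star hf) (hom_star hg).
Qed.

Lemma hom_id (C : numClosedFieldType) (A : starAlgType C) : unital_star_hom (@id A).
Proof. by []. Qed.

Lemma normc_nat (R : realType) n : Normc.normc (n%:R : R[i]) = n%:R.
Proof. by rewrite -[n%:R](@rmorph_nat _ _ (real_complex R)) /= expr0n addr0 sqrtr_sqr ger0_norm. Qed.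

(** * Automatic continuity of unital *-homomorphisms *)

Section AutomaticContinuity.
Variables (R : realType) (A : cstarAlgType R).

(** Here s is 1 - sqrt(1 - y^2), found as the fixed point of s |-> (y^2 + s^2) / 2. This map
    preserves the ball of radius 1/4, where the iterates form a Cauchy sequence; commutation with y
    passes to the limit. *)
Lemma sqrt_fixpoint (y : A) : star y = y -> cnorm y <= 2^-1 ->
  exists s : A, [/\ star s = s, s * y = y * s & s + s = y * y + s * s].
Proof.
move=> ys yn; pose h : R[i] := 2^-1.
have h2 (x : A) : h *: x + h *: x = x.
  by rewrite -scalerDl /h -mulr2n -[2^-1 *+ 2]mulr_natl mulfV ?scale1r // pnatr_eq0.
have hstar : h^* = h by rewrite /h fmorphV rmorph_nat.
have hn : Normc.normc h = 2^-1.
  by rewrite /h Normc.normcV normc_nat.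
pose s := fix s n := if n is k.+1 then h *: (y * y + s k * s k) else 0 : A.
have ss n : star (s n) = s n.
  by elim: n => [|n IH]; rewrite /= ?star0 // starZ hstar starD !starM ys IH.
have sy n : s n * y = y * s n.
  elim: n => [|n IH]; first by rewrite mul0r mulr0.
  rewrite /= -scalerAl -scalerAr; congr (_ *: _).
  by rewrite mulrDl mulrDr !mulrA -IH -!mulrA -IH.
have yy : cnorm (y * y) <= 4^-1.
  by apply: le_trans (cnormM _ _) _; have := cnorm_ge0 y; nra.
have sn n : cnorm (s n) <= 4^-1.
  elim: n => [|n IH]; first by rewrite cnorm0; lra.
  rewrite /= cnormZ hn.
  have := cnormD (y * y) (s n * s n); have := cnormM (s n) (s n).
  by have := cnorm_ge0 (s n); nra.
have ds n : cnorm (s n.+1 - s n) <= 1 * 2^-1 ^+ n.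
  rewrite mul1r; elim: n => [|n IH].
    by rewrite expr0 subr0; apply: le_trans (sn _) _; lra.
  have -> : s n.+2 - s n.+1 = h *: (s n.+1 * (s n.+1 - s n) + (s n.+1 - s n) * s n).
    by rewrite [s n.+2]/= [in X in _ - X]/= -scalerBr; congr (_ *: _); ncr.
  rewrite cnormZ hn exprS ler_pM2l; last by lra.
  apply: le_trans (cnormD _ _) _.
  have := cnormM (s n.+1) (s n.+1 - s n); have := cnormM (s n.+1 - s n) (s n).
  have := sn n; have := sn n.+1; have := cnorm_ge0 (s n.+1 - s n).
  have := cnorm_ge0 (s n); have := cnorm_ge0 (s n.+1); nra.
have [l sl _] := cvA_geometric (ltac:(lra) : 0 <= 1 :> R) ds.
exists l; split.
- by apply: (@cvA_unique _ _ s _ _ _ sl); apply: cvA_ext (cvA_star sl).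
- apply: (@cvA_unique _ _ (fun n => s n * y)); first exact: cvA_mul sl (cvA_cst y).
  by apply: cvA_ext (cvA_mul (cvA_cst y) sl) => n; rewrite sy.
- have lE : l = h *: (y * y + l * l).
    apply: (@cvA_unique _ _ (fun n => s (n + 1)%N)); first exact: cvA_shift.
    apply: (@cvA_ext _ _ (fun n => h *: (y * y + s n * s n))).
      by move=> n; rewrite addn1.
    apply: cvA_scale; apply: cvA_add; first exact: cvA_cst.
    exact: cvA_mul.
  by rewrite {1 2}lE h2.
Qed.

(* A self-adjoint [y] of norm at most 1/2 is the real part of the unitary
   [y + i sqrt(1 - y^2)], and homomorphisms map unitaries to unitaries. *)
Lemma hom_sa_bound (B : cstarAlgType R) (u : A -> B) (y : A) :
  unital_star_hom u -> star y = y -> cnorm y <= 2^-1 -> cnorm (u y) <= 1.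
Proof.
move=> hu ys yn; have [s [ss sy sE]] := sqrt_fixpoint ys yn.
pose w := y + 'i *: (1 - s).
have ii : 'i * 'i = -1 :> R[i] by rewrite -expr2 sqrCi.
have ws : star w = y - 'i *: (1 - s).
  by rewrite /w starD starZ starB star1 ss ys conjCi scaleNr.
have zz : (1 - s) * (1 - s) = 1 - y * y.
  rewrite (_ : (1 - s) * (1 - s) = 1 + s * s - (s + s)); last by ncr.
  by rewrite sE; ncr.
have zy : (1 - s) * y = y * (1 - s) by rewrite mulrBl mulrBr sy mul1r mulr1.
have ww : star w * w = 1.
  rewrite ws /w mulrDr !mulrBl -!scalerAl -!scalerAr !scalerA ii zy zz scaleN1r.
  by ncr.
have uw : cnorm (u w) = 1 by apply: cnorm_unitary; rewrite -(hom_star hu) -(homM hu) ww (hom1 hu).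
have yE : y + y = w + star w by rewrite ws /w; ncr.
have := cnormD (u w) (star (u w)); rewrite cnorm_starE uw -(hom_star hu) -(homD hu) -yE.
rewrite -mulr2n -scaler_nat (homZ hu) cnormZ.
by rewrite normc_nat; lra.
Qed.

(** The sharp constant is 1, but any constant gives continuity, which is what the uniqueness of
    mediating maps requires. A self-adjoint element is rescaled to norm 1/2, and a general x is
    reached through [star x * x]. *)
Lemma hom_bound (B : cstarAlgType R) (u : A -> B) (x : A) :
  unital_star_hom u -> cnorm (u x) <= 2 * cnorm x.
Proof.
move=> hu.
have sa y : star y = y -> cnorm (u y) <= 2 * cnorm y.
  move=> ys; have [y0|yn0] := eqVneq (cnorm y) 0.
    by rewrite (cnorm0_eq0 y y0) (hom0 hu) !cnorm0 mulr0.
  have yp : 0 < cnorm y by rewrite lt0r yn0 cnorm_ge0.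
  pose c : R[i] := ((2 * cnorm y)^-1)%:C%C.
  have cn : Normc.normc c = (2 * cnorm y)^-1.
    by rewrite /c /= expr0n addr0 sqrtr_sqr ger0_norm // invr_ge0; lra.
  have cs : c^* = c by rewrite /c; apply/eqP; rewrite eq_complex /= oppr0 !eqxx.
  have := @hom_sa_bound _ u (c *: y) hu; rewrite starZ cs ys => /(_ erefl).
  rewrite (homZ hu) !cnormZ cn.
  have -> : (2 * cnorm y)^-1 * cnorm y = 2^-1 by field.
  by move=> /(_ (lexx _)); rewrite ler_pdivrMl ?mulr1 //; lra.
have := sa (star x * x); rewrite starM starK => /(_ erefl).
rewrite (homM hu) (hom_star hu) !cnorm_star.
by have := cnorm_ge0 x; have := cnorm_ge0 (u x); nra.
Qed.

Lemma hom_cvA (B : cstarAlgType R) (u : A -> B) (v : nat -> A) x :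
  unital_star_hom u -> cvA v x -> cvA (fun n => u (v n)) (u x).
Proof.
move=> hu vx; apply: cvA_le (cv0Ml 2 vx) => n.
by rewrite -(homB hu); exact: hom_bound.
Qed.

End AutomaticContinuity.

(** If a > b > 0 then (a / b)^(2^k) exceeds every constant by Bernoulli's inequality. The lemma
    removes a constant factor from norm estimates on self-adjoint elements. *)
Lemma pow_trick (R : realType) (a b c : R) : 0 <= a -> 0 <= b ->
  (forall k, a ^+ (2 ^ k) <= c * b ^+ (2 ^ k)) -> a <= b.
Proof.
move=> a0 b0 H; rewrite leNgt; apply/negP => ba.
have [b00|bn0] := eqVneq b 0.
  by have := H 0%N; rewrite expn0 !expr1 b00 mulr0; lra.
have bp : 0 < b by rewrite lt0r bn0.
pose h := a / b - 1.
have h0 : 0 < h by rewrite /h subr_gt0 ltr_pdivlMr // mul1r.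
have bern n : 1 + n%:R * h <= (1 + h) ^+ n.
  elim: n => [|n IH]; first by rewrite mul0r expr0; lra.
  rewrite exprS -addn1 natrD.
  have : 0 <= n%:R * h * h by rewrite !mulr_ge0 //; lra.
  nra.
have Hk k : (1 + h) ^+ (2 ^ k) <= c.
  by rewrite /h addrC subrK expr_div_n ler_pdivrMr ?exprn_gt0.
pose N := Num.bound `|c / h|.
have cN : c / h < N%:R.
  by apply: le_lt_trans (ler_norm _) _; exact: archi_boundP (normr_ge0 _).
have := Hk N; have := bern (2 ^ N)%N.
have : (N%:R : R) <= (2 ^ N)%:R by rewrite ler_nat ltnW // ltn_expl.
move: cN; rewrite ltr_pdivrMr // => cN; nra.
Qed.

(** * Unital *-homomorphisms out of a matrix algebra *)

Section MatrixHoms.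
Variables (R : realType) (n : nat).
Notation M := 'M[R[i]]_n.+1.
Notation normc := (@Normc.normc R).
Notation e i j := (delta_mx i j : M).

Lemma delta_mul i j k l : e i j * e k l = if j == k then e i l else 0.
Proof.
rewrite -[LHS]/(delta_mx i j *m delta_mx k l); case: eqVneq => [->|jk].
  exact: mul_delta_mx.
by rewrite mul_delta_mx_0.
Qed.

Lemma star_delta i j : star (e i j) = e j i.
Proof. by apply/matrixP => a b; rewrite !mxE rmorph_nat andbC. Qed.

Lemma sum_delta : \sum_i e i i = 1.
Proof.
apply/matrixP => a b; rewrite summxE !mxE (bigD1 a) //= !mxE eqxx big1 ?addr0 ?andTb //.
  by rewrite eq_sym.
by move=> c ca; rewrite !mxE eq_sym (negbTE ca).
Qed.

Lemma matrix_delta (x : M) : x = \sum_i \sum_j x i j *: e i j.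
Proof. exact: matrix_sum_delta. Qed.

Lemma corner (x : M) i j : e i i * x * e j j = x i j *: e i j.
Proof.
transitivity (e i i * (\sum_k \sum_l x k l *: e k l) * e j j).
  by rewrite -matrix_delta.
rewrite mulr_sumr mulr_suml (bigD1 i) //= [X in _ + X]big1 ?addr0; last first.
  move=> k ki; rewrite mulr_sumr mulr_suml big1 // => l _.
  by rewrite -scalerAr delta_mul eq_sym (negbTE ki) scaler0 mul0r.
rewrite mulr_sumr mulr_suml (bigD1 j) //= big1 ?addr0; last first.
  by move=> l lj; rewrite -scalerAr -scalerAl delta_mul eqxx delta_mul (negbTE lj) scaler0.
by rewrite -scalerAr -scalerAl !delta_mul !eqxx delta_mul eqxx.
Qed.

Variables (A : cstarAlgType R) (psi : M -> A).
Hypothesis hpsi : unital_star_hom psi.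

(** Simplicity of the matrix algebra in elementary form: each e_kk factors through e_jj, so the
    vanishing of one image would force 1 = 0. *)
Lemma hom_delta_neq0 j : psi (e j j) != 0.
Proof.
apply/eqP => ej0; have := oner_neq0 A; rewrite -(hom1 hpsi) -sum_delta.
rewrite (hom_sum hpsi) big1 ?eqxx // => k _.
have -> : e k k = e k j * e j j * e j k by rewrite !delta_mul eqxx delta_mul eqxx.
by rewrite !(homM hpsi) ej0 mulr0 mul0r.
Qed.

Lemma cnorm_delta i j : cnorm (psi (e i j)) = 1.
Proof.
have jj : cnorm (psi (e j j)) = 1.
  have := cnorm_star (psi (e j j)).
  rewrite -(hom_star hpsi) -(homM hpsi) star_delta delta_mul eqxx => /esym/eqP.
  rewrite expr2 -[X in _ == X]mulr1 -subr_eq0 -mulrBr mulf_eq0 subr_eq0.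
  by case/orP => /eqP // /cnorm0_eq0 /eqP; rewrite (negbTE (hom_delta_neq0 j)).
have := cnorm_star (psi (e i j)).
rewrite -(hom_star hpsi) -(homM hpsi) star_delta delta_mul eqxx jj => /esym/eqP.
rewrite sqrf_eq1 => /orP [/eqP //|/eqP xm].
by have := cnorm_ge0 (psi (e i j)); rewrite xm; lra.
Qed.

(** Compression by e_ii on the left and e_jj on the right isolates one entry, and these have norm 1
    under [psi]. *)
Lemma entry_le (x : M) i j : normc (x i j) <= cnorm (psi x).
Proof.
rewrite -[normc _]mulr1 -(cnorm_delta i j) -cnormZ -(homZ hpsi) -corner.
rewrite !(homM hpsi); apply: le_trans (cnormM _ _) _; rewrite cnorm_delta mulr1.
by apply: le_trans (cnormM _ _) _; rewrite cnorm_delta mul1r.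
Qed.

Lemma cnorm_entries (x : M) : cnorm (psi x) <= \sum_i \sum_j normc (x i j).
Proof.
rewrite {1}(matrix_delta x) (hom_sum hpsi).
apply: le_trans (cnorm_sum _ _ _) _; apply: ler_sum => i _.
rewrite (hom_sum hpsi); apply: le_trans (cnorm_sum _ _ _) _; apply: ler_sum => j _.
by rewrite (homZ hpsi) cnormZ cnorm_delta mulr1.
Qed.

End MatrixHoms.

(* All C*-norms on a matrix algebra agree: they are equivalent, and the C*-identity
   improves the constant to 1. *)
Lemma matrix_hom_le (R : realType) (n : nat) (A B : cstarAlgType R)
    (psi : 'M[R[i]]_n.+1 -> A) (g : 'M[R[i]]_n.+1 -> B) x :
  unital_star_hom psi -> unital_star_hom g -> cnorm (g x) <= cnorm (psi x).
Proof.
move=> hp hg.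
have equiv y : cnorm (g y) <= (n.+1 * n.+1)%:R * cnorm (psi y).
  apply: le_trans (cnorm_entries hg y) _.
  apply: le_trans (_ : _ <= \sum_(i < n.+1) \sum_(j < n.+1) cnorm (psi y)) _.
    by do 2![apply: ler_sum => ? _]; exact: entry_le.
  by rewrite sumr_const sumr_const !card_ord -mulrnA mulr_natl.
have sa y : star y = y -> cnorm (g y) <= cnorm (psi y).
  move=> ys; apply: (pow_trick (c := (n.+1 * n.+1)%:R)) => // k.
  rewrite -!cnorm_sa_pow -?(hom_star hp) -?(hom_star hg) ?ys //.
  by rewrite -(homX hp) -(homX hg); exact: equiv.
have := sa (star x * x); rewrite starM starK => /(_ erefl).
rewrite (homM hp) (homM hg) (hom_star hp) (hom_star hg) !cnorm_star.
by rewrite ler_pXn2r ?nnegrE ?cnorm_ge0.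
Qed.

Lemma matrix_hom_norm (R : realType) (n : nat) (A B : cstarAlgType R)
    (psi : 'M[R[i]]_n.+1 -> A) (g : 'M[R[i]]_n.+1 -> B) x :
  unital_star_hom psi -> unital_star_hom g -> cnorm (g x) = cnorm (psi x).
Proof. by move=> hp hg; apply/le_anti; rewrite !matrix_hom_le. Qed.

(** * Closed subalgebras *)

(** The universal property of a limit quantifies over C*-algebras, so a closed subalgebra can be
    tested against it only after being made a C*-algebra itself. *)
Record closedStar (R : realType) (A : cstarAlgType R) := ClosedStar {
  cs_pred : A -> bool;
  cs1 : cs_pred 1;
  csD : forall x y, cs_pred x -> cs_pred y -> cs_pred (x + y);
  csM : forall x y, cs_pred x -> cs_pred y -> cs_pred (x * y);
  csZ : forall (c : R[i]) x, cs_pred x -> cs_pred (c *: x);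
  cs_star : forall x, cs_pred x -> cs_pred (star x);
  cs_lim : forall u x, (forall n, cs_pred (u n)) -> cvA u x -> cs_pred x }.

Record closedSub (R : realType) (A : cstarAlgType R) (S : closedStar A) :=
  CSub { csval : A; csvalP : cs_pred S csval }.

HB.instance Definition _ R A S := [isSub for @csval R A S].
HB.instance Definition _ R A S := [Choice of @closedSub R A S by <:].

Section ClosedSub.
Variables (R : realType) (A : cstarAlgType R) (S : closedStar A).
Notation T := (closedSub S).
Implicit Types x y z : T.

Lemma cs0 : cs_pred S 0.
Proof. by rewrite -(scale0r (1 : A)); apply: csZ; exact: cs1. Qed.
Lemma csN (x : A) : cs_pred S x -> cs_pred S (- x).
Proof. by rewrite -scaleN1r; exact: csZ. Qed.

Definition cs_zero : T := CSub cs0.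
Definition cs_one : T := CSub (cs1 S).
Definition cs_add x y : T := CSub (csD (csvalP x) (csvalP y)).
Definition cs_opp x : T := CSub (csN (csvalP x)).
Definition cs_mul x y : T := CSub (csM (csvalP x) (csvalP y)).
Definition cs_scale c x : T := CSub (csZ c (csvalP x)).
Definition cs_star_op x : T := CSub (cs_star (csvalP x)).

Fact cs_addA : associative cs_add.
Proof. by move=> x y z; apply: val_inj; exact: addrA. Qed.
Fact cs_addC : commutative cs_add.
Proof. by move=> x y; apply: val_inj; exact: addrC. Qed.
Fact cs_add0 : left_id cs_zero cs_add.
Proof. by move=> x; apply: val_inj; exact: add0r. Qed.
Fact cs_addN : left_inverse cs_zero cs_opp cs_add.
Proof. by move=> x; apply: val_inj; exact: addNr. Qed.
HB.instance Definition _ := GRing.isZmodule.Build T cs_addA cs_addC cs_add0 cs_addN.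

Fact cs_mulA : associative cs_mul.
Proof. by move=> x y z; apply: val_inj; exact: mulrA. Qed.
Fact cs_mul1 : left_id cs_one cs_mul.
Proof. by move=> x; apply: val_inj; exact: mul1r. Qed.
Fact cs_mulr1 : right_id cs_one cs_mul.
Proof. by move=> x; apply: val_inj; exact: mulr1. Qed.
Fact cs_mulDl : left_distributive cs_mul cs_add.
Proof. by move=> x y z; apply: val_inj; exact: mulrDl. Qed.
Fact cs_mulDr : right_distributive cs_mul cs_add.
Proof. by move=> x y z; apply: val_inj; exact: mulrDr. Qed.
Fact cs_one_neq0 : cs_one != 0.
Proof. by apply/eqP => /(congr1 (@csval _ _ _)) /eqP; rewrite oner_eq0. Qed.
HB.instance Definition _ := GRing.Zmodule_isNzRing.Build T
  cs_mulA cs_mul1 cs_mulr1 cs_mulDl cs_mulDr cs_one_neq0.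

Fact cs_scaleA a b x : cs_scale a (cs_scale b x) = cs_scale (a * b) x.
Proof. by apply: val_inj; exact: scalerA. Qed.
Fact cs_scale1 : left_id 1 cs_scale.
Proof. by move=> x; apply: val_inj; exact: scale1r. Qed.
Fact cs_scaleDr : right_distributive cs_scale +%R.
Proof. by move=> c x y; apply: val_inj; exact: scalerDr. Qed.
Fact cs_scaleDl x : {morph cs_scale^~ x : a b / a + b}.
Proof. by move=> a b; apply: val_inj; exact: scalerDl. Qed.
HB.instance Definition _ := GRing.Zmodule_isLmodule.Build R[i] T
  cs_scaleA cs_scale1 cs_scaleDr cs_scaleDl.

Fact cs_scaleAl (a : R[i]) x y : a *: (x * y) = a *: x * y.
Proof. by apply: val_inj; exact: scalerAl. Qed.
HB.instance Definition _ := GRing.Lmodule_isLalgebra.Build R[i] T cs_scaleAl.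
Fact cs_scaleAr (a : R[i]) x y : a *: (x * y) = x * (a *: y).
Proof. by apply: val_inj; exact: scalerAr. Qed.
HB.instance Definition _ := GRing.Lalgebra_isAlgebra.Build R[i] T cs_scaleAr.

Fact cs_starD x y : cs_star_op (x + y) = cs_star_op x + cs_star_op y.
Proof. by apply: val_inj; exact: starD. Qed.
Fact cs_starZ (c : R[i]) x : cs_star_op (c *: x) = c^* *: cs_star_op x.
Proof. by apply: val_inj; exact: starZ. Qed.
Fact cs_starM x y : cs_star_op (x * y) = cs_star_op y * cs_star_op x.
Proof. by apply: val_inj; exact: starM. Qed.
Fact cs_starK x : cs_star_op (cs_star_op x) = x.
Proof. by apply: val_inj; exact: starK. Qed.
HB.instance Definition _ := Algebra_hasStar.Build R[i] T
  cs_starD cs_starZ cs_starM cs_starK.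

Definition cs_norm x : R := cnorm (csval x).
Fact cs_normD x y : cs_norm (x + y) <= cs_norm x + cs_norm y.
Proof. exact: cnormD. Qed.
Fact cs_normZ (c : R[i]) x : cs_norm (c *: x) = Normc.normc c * cs_norm x.
Proof. exact: cnormZ. Qed.
Fact cs_norm0_eq0 x : cs_norm x = 0 -> x = 0.
Proof. by move=> /cnorm0_eq0 x0; apply: val_inj. Qed.
Fact cs_normM x y : cs_norm (x * y) <= cs_norm x * cs_norm y.
Proof. exact: cnormM. Qed.
Fact cs_norm_star x : cs_norm (star x * x) = cs_norm x ^+ 2.
Proof. exact: cnorm_star. Qed.
Fact cs_complete (u : nat -> T) :
  (forall eps : R, 0 < eps -> exists N : nat, forall m n : nat,
    (N <= m)%N -> (N <= n)%N -> cs_norm (u m - u n) < eps) ->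
  exists l : T, forall eps : R, 0 < eps -> exists N : nat, forall n : nat,
    (N <= n)%N -> cs_norm (u n - l) < eps.
Proof.
move=> /(@cvA_cauchy _ _ (fun n => csval (u n))) [l ul].
have Pl : cs_pred S l by apply: cs_lim ul => n; exact: csvalP.
by exists (CSub Pl); apply/(cvAP _ _).1.
Qed.
HB.instance Definition _ := StarAlgebra_isCStar.Build R T
  cs_normD cs_normZ cs_norm0_eq0 cs_normM cs_norm_star cs_complete.

Lemma csval_hom : unital_star_hom (@csval _ _ S).
Proof. by []. Qed.

End ClosedSub.

(** * Closures and the union of the stages of a cocone *)

Section Closure.
Variables (R : realType) (A : cstarAlgType R).
Implicit Types (U : A -> Prop) (x y : A).

Definition cl U x : Prop := forall eps : R, 0 < eps -> exists2 y, U y & cnorm (x - y) < eps.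

Lemma clP U x : cl U x <-> exists2 v : nat -> A, (forall n, U (v n)) & cvA v x.
Proof.
split=> [H|[v Uv vx] eps eps0].
  have H' n : exists y, U y /\ cnorm (x - y) < 2^-1 ^+ n.
    have [|y Uy xy] := H (2^-1 ^+ n); first by apply: exprn_gt0; lra.
    by exists y.
  have [v vP] := boolp.choice H'.
  exists v => [n|]; first exact: (vP n).1.
  apply: (cvA_le _ (@cv0_half R)) => n; rewrite cnormC; exact: ltW (vP n).2.
have [n vn] := near_ex (cv0_lt vx eps0).
by exists (v n); rewrite // cnormC.
Qed.

Lemma cl_in U x : U x -> cl U x.
Proof. by move=> Ux eps eps0; exists x; rewrite // subrr cnorm0. Qed.

Lemma cl_cl U x : cl (cl U) x -> cl U x.
Proof.
move=> H eps eps0; have e2 : 0 < eps / 2 by lra.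
have [y Hy xy] := H _ e2; have [z Uz yz] := Hy _ e2.
by exists z => //; apply: le_lt_trans (cnorm_tri y _ _) _; lra.
Qed.

Lemma cl_add U x y : (forall a b, U a -> U b -> U (a + b)) -> cl U x -> cl U y -> cl U (x + y).
Proof.
move=> H /clP [v Uv vx] /clP [w Uw wy]; apply/clP.
by exists (fun n => v n + w n); [move=> n; exact: H|exact: cvA_add].
Qed.

Lemma cl_mul U x y : (forall a b, U a -> U b -> U (a * b)) -> cl U x -> cl U y -> cl U (x * y).
Proof.
move=> H /clP [v Uv vx] /clP [w Uw wy]; apply/clP.
by exists (fun n => v n * w n); [move=> n; exact: H|exact: cvA_mul].
Qed.

Lemma cl_star U x : (forall a, U a -> U (star a)) -> cl U x -> cl U (star x).
Proof.
move=> H /clP [v Uv vx]; apply/clP.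
by exists (fun n => star (v n)); [move=> n; exact: H|exact: cvA_star].
Qed.

Lemma cl_scale U (c : R[i]) x : (forall a, U a -> U (c *: a)) -> cl U x -> cl U (c *: x).
Proof.
move=> H /clP [v Uv vx]; apply/clP.
by exists (fun n => c *: v n); [move=> n; exact: H|exact: cvA_scale].
Qed.

End Closure.

Section Union.
Variables (R : realType) (D : nat -> starAlgType R[i]) (bond : forall s, D s -> D s.+1).
Variables (A : cstarAlgType R) (i : forall s, D s -> A).
Hypothesis hi : is_cocone bond i.

Definition in_stage (x : A) : Prop := exists s (y : D s), x = i y.

Lemma stage_up s k (y : D s) : exists y' : D (k + s), i y = i y'.
Proof.
elim: k => [|k [y' ->]]; first by exists y.
by exists (bond y'); case: hi => _ ->.
Qed.

Lemma stage_le s t (y : D s) : (s <= t)%N -> exists y' : D t, i y = i y'.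
Proof. by move=> st; have := stage_up (t - s) y; rewrite subnK. Qed.

Lemma stage_common (I : finType) (x : I -> A) : (forall j, in_stage (x j)) ->
  exists s (y : I -> D s), forall j, x j = i (y j).
Proof.
move=> H; have [s sP] := boolp.choice H.
exists (\max_j s j)%N.
have H' j : exists y : D (\max_j s j)%N, x j = i y.
  by have [y ->] := sP j; apply: stage_le; exact: leq_bigmax.
by have [y yP] := boolp.choice H'; exists y.
Qed.

Lemma in_stage2 x y : in_stage x -> in_stage y -> exists s (x' y' : D s), x = i x' /\ y = i y'.
Proof.
move=> Ux Uy; have [|s [z zP]] := @stage_common bool (fun b => if b then x else y).
  by case.
by exists s, (z true), (z false); split; [exact: (zP true)|exact: (zP false)].
Qed.

Lemma in_stageD x y : in_stage x -> in_stage y -> in_stage (x + y).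
Proof.
move=> Ux Uy; have [s [x' [y' [-> ->]]]] := in_stage2 Ux Uy.
by exists s, (x' + y'); case: hi => hs _; rewrite (homD (hs s)).
Qed.

Lemma in_stageM x y : in_stage x -> in_stage y -> in_stage (x * y).
Proof.
move=> Ux Uy; have [s [x' [y' [-> ->]]]] := in_stage2 Ux Uy.
by exists s, (x' * y'); case: hi => hs _; rewrite (homM (hs s)).
Qed.

Lemma in_stageZ c x : in_stage x -> in_stage (c *: x).
Proof. by move=> [s [y ->]]; exists s, (c *: y); case: hi => hs _; rewrite (homZ (hs s)). Qed.

Lemma in_stage_star x : in_stage x -> in_stage (star x).
Proof. by move=> [s [y ->]]; exists s, (star y); case: hi => hs _; rewrite (hom_star (hs s)). Qed.

Lemma in_stage_one : in_stage 1.
Proof. by exists 0%N, 1; case: hi => hs _; rewrite (hom1 (hs 0%N)). Qed.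

Definition stage_closure : closedStar A.
Proof.
pose p x := `[< cl in_stage x >].
apply: (@ClosedStar R A p).
- by apply/asboolP/cl_in; exact: in_stage_one.
- by move=> x y /asboolP Ux /asboolP Uy; apply/asboolP; apply: cl_add => //; exact: in_stageD.
- by move=> x y /asboolP Ux /asboolP Uy; apply/asboolP; apply: cl_mul => //; exact: in_stageM.
- by move=> c x /asboolP Ux; apply/asboolP; apply: cl_scale => // a; exact: in_stageZ.
- by move=> x /asboolP Ux; apply/asboolP; apply: cl_star => // a; exact: in_stage_star.
- move=> u x Hu ux; apply/asboolP; apply: cl_cl; apply/clP.
  by exists u => // n; apply/asboolP; exact: Hu.
Defined.

(* The closure [B] of the union is itself a cocone; composing the mediating map
   A -> B with the inclusion B -> A gives the identity by uniqueness. *)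
Lemma limit_dense : is_inductive_limit bond i -> forall x, cl in_stage x.
Proof.
move=> [_ lim] x; pose B := closedSub stage_closure.
have Bi s y : cs_pred stage_closure (@i s y).
  by apply/asboolP/cl_in; exists s, y.
pose g s (y : D s) : B := CSub (Bi s y).
have gc : is_cocone bond g.
  case: hi => hs ic; split => [s|s y]; last by apply: val_inj; exact: ic.
  split.
  - by move=> c y z; apply: val_inj; case: (hs s) => li _ _; exact: li.
  - by split => [|y z]; apply: val_inj; [exact: hom1 (hs s)|exact: homM].
  - by move=> y; apply: val_inj; exact: hom_star (hs s) y.
have [u [[hu ug] _]] := lim _ _ gc.
have [w [_ wuniq]] := lim _ _ hi.
have E1 := wuniq _ (conj (hom_comp hu (@csval_hom _ _ stage_closure)) (fun s y => congr1 (@csval _ _ _) (ug s y))).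
have E2 := wuniq id (conj (@hom_id _ A) (fun s y => erefl)).
have -> : x = csval (u x) by have := congr1 (@^~ x) (etrans (esym E1) E2).
by have /asboolP := csvalP (u x).
Qed.

End Union.

(** * Stability of matrix units *)

Section Adjoint.
Variable C : numClosedFieldType.

Definition adj m n (X : 'M[C]_(m, n)) : 'M[C]_(n, m) := (map_mx Num.conj X)^T.

Lemma adj_mul m n p (X : 'M_(m, n)) (Y : 'M_(n, p)) : adj (X *m Y) = adj Y *m adj X.
Proof. by rewrite /adj map_mxM trmx_mul. Qed.

Lemma adjK m n (X : 'M_(m, n)) : adj (adj X) = X.
Proof. by apply/matrixP => i j; rewrite !mxE conjCK. Qed.

Lemma adjE n (X : 'M_n.+1) : adj X = star X.
Proof. by []. Qed.

End Adjoint.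

Section FunctionalCalculus.
Variables (R : realType) (n : nat) (A : cstarAlgType R) (psi : 'M[R[i]]_n.+1 -> A).
Hypothesis hpsi : unital_star_hom psi.
Notation M := 'M[R[i]]_n.+1.
Notation nm x := (cnorm (psi x)).

Definition dg (y : 'I_n.+1 -> R) : M := diag_mx (\row_i (y i)%:C%C).

Lemma dgE y i j : dg y i j = if i == j then (y i)%:C%C else 0.
Proof. by rewrite !mxE; case: eqVneq => [->|]; rewrite ?mulr1n ?mulr0n. Qed.

Lemma dgM y z : dg y * dg z = dg (fun i => y i * z i).
Proof.
rewrite -[LHS]/(dg y *m dg z) mulmx_diag; congr diag_mx; apply/rowP => i.
by rewrite !mxE rmorphM.
Qed.

Lemma dg1 : dg (fun=> 1) = 1.
Proof. by apply/matrixP => i j; rewrite dgE mxE; case: eqVneq. Qed.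

Lemma dgB y z : dg y - dg z = dg (fun i => y i - z i).
Proof. by apply/matrixP => i j; rewrite mxE [X in _ + X]mxE !dgE; case: eqP; rewrite ?subr0 // rmorphB. Qed.

Lemma dg_star y : star (dg y) = dg y.
Proof.
apply/matrixP => i j; rewrite mxE mxE !dgE eq_sym; case: eqVneq => [->|_]; last by rewrite rmorph0.
by apply/eqP; rewrite eq_complex /= oppr0 !eqxx.
Qed.

Lemma dgX y k : dg y ^+ k = dg (fun i => y i ^+ k).
Proof.
elim: k => [|k IH]; first by rewrite expr0 -dg1.
by rewrite exprS IH dgM; congr dg; apply/funext => i; rewrite exprS.
Qed.

Lemma normc_real (x : R) : Normc.normc (x%:C%C) = `|x|.
Proof. by rewrite /= expr0n addr0 sqrtr_sqr. Qed.

(** The entry sum alone gives the bound with a factor n + 1; applied to the powers of the diagonal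
    matrix, it yields the sharp bound by [pow_trick]. *)
Lemma dg_norm y (t : R) : (forall i, `|y i| <= t) -> nm (dg y) <= t.
Proof.
move=> yt; have t0 : 0 <= t by apply: le_trans (yt ord0).
apply: (pow_trick (c := n.+1%:R)) => // k.
rewrite -cnorm_sa_pow -?(hom_star hpsi) ?dg_star // -(homX hpsi) dgX.
apply: le_trans (cnorm_entries hpsi _) _.
rewrite mulr_natl -[X in _ *+ X]card_ord -sumr_const; apply: ler_sum => i _.
rewrite (bigD1 i) //= big1 ?addr0; last first.
  by move=> j ji; rewrite dgE eq_sym (negbTE ji) Normc.normc0.
by rewrite dgE eqxx normc_real normrX lerXn2r ?nnegrE.
Qed.

Record diagonalization (H : M) := Diagonalization {
  dv : M; dx : 'I_n.+1 -> R;
  dvV : star dv * dv = 1;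
  dVv : dv * star dv = 1;
  dH : H = star dv * dg dx * dv }.

Lemma diagonalize (H : M) : star H = H -> exists D : diagonalization H, True.
Proof.
move=> Hs.
have Hh : H \is hermsymmx.
  by apply/is_hermitianmxP; rewrite expr0 scale1r -{1}Hs -map_trmx.
have /hermitian_normalmx/orthomx_spectralP HE := Hh.
have Vu := spectral_unitarymx H.
have /mxOverP xr := hermitian_spectral_diag_real Hh.
set V := spectralmx H in HE Vu; set x := spectral_diag H in HE xr.
have VsE : map_mx Num.conj V^T = star V by rewrite -map_trmx.
have VV : V * star V = 1 by rewrite -VsE; exact: (unitarymxP Vu).
have VV' : star V * V = 1 by exact: mulmx1C.
suff xE : dg (fun i => complex.Re (x 0 i)) = diag_mx x.
  have dHE : H = star V * dg (fun i => complex.Re (x 0 i)) * V.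
    by rewrite xE {1}HE invmx_unitary // VsE.
  by exists (Diagonalization VV' VV dHE).
congr diag_mx; apply/rowP => i; rewrite mxE.
exact: RRe_real (xr 0 i).
Qed.

Variables (H : M) (D : diagonalization H).

Definition fc (g : R -> R) : M := star (dv D) * dg (fun i => g (dx D i)) * dv D.

Lemma fcM g h : fc g * fc h = fc (fun x => g x * h x).
Proof.
rewrite /fc -!mulrA; congr (_ * _).
by rewrite (mulrA (dv D) (star (dv D))) dVv mul1r mulrA dgM.
Qed.

Lemma fcB g h : fc g - fc h = fc (fun x => g x - h x).
Proof. by rewrite /fc -mulrBl -mulrBr dgB. Qed.

Lemma fc1 : fc (fun=> 1) = 1.
Proof. by rewrite /fc dg1 mulr1 dvV. Qed.

Lemma fc_id : fc id = H.
Proof. by rewrite [RHS](dH D). Qed.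

Lemma fc_star g : star (fc g) = fc g.
Proof. by rewrite /fc !starM starK dg_star mulrA. Qed.

Lemma eq_fc g h : (forall i, g (dx D i) = h (dx D i)) -> fc g = fc h.
Proof. by move=> gh; rewrite /fc; do 2!congr (_ * _); congr dg; apply/funext. Qed.

Lemma nm_dv : nm (dv D) = 1.
Proof. by apply: cnorm_unitary; rewrite -(hom_star hpsi) -(homM hpsi) dvV (hom1 hpsi). Qed.

Lemma nm_dvs : nm (star (dv D)) = 1.
Proof. by rewrite (hom_star hpsi) cnorm_starE nm_dv. Qed.

Lemma nmM x y : nm (x * y) <= nm x * nm y.
Proof. by rewrite (homM hpsi) cnormM. Qed.

Lemma fc_norm g (t : R) : (forall i, `|g (dx D i)| <= t) -> nm (fc g) <= t.
Proof.
move=> gt; apply: le_trans (nmM _ _) _; rewrite nm_dv mulr1.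
apply: le_trans (nmM _ _) _; rewrite nm_dvs mul1r.
exact: dg_norm.
Qed.

(** The number g(x_i) is a diagonal entry of a unitary conjugate of [fc g]. Thus an approximate
    polynomial relation for H confines its eigenvalues. *)
Lemma fc_ge g i : `|g (dx D i)| <= nm (fc g).
Proof.
rewrite -normc_real.
have -> : (g (dx D i))%:C%C = (dv D * fc g * star (dv D)) i i.
  by rewrite /fc !mulrA dVv mul1r -mulrA dVv mulr1 dgE eqxx.
apply: le_trans (entry_le hpsi _ _ _) _.
apply: le_trans (nmM _ _) _; rewrite nm_dvs mulr1.
by apply: le_trans (nmM _ _) _; rewrite nm_dv mul1r.
Qed.

End FunctionalCalculus.

#[global] Instance ncops_mx (R : realType) n : @Ncring.Ring_ops 'M[R[i]]_n 0 1 +%R *%R (fun x y => x - y) -%R eq := {}.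
#[global] Instance ncring_mx (R : realType) n : Ncring.Ring (Ro:=ncops_mx R n) := ncring 'M[R[i]]_n.

Ltac ncrm C m := match goal with |- @eq _ ?x ?y => change (@eq 'M[C]_m x y) end; ncr.

Section Stability.
Variables (R : realType) (n : nat) (A : cstarAlgType R) (psi : 'M[R[i]]_n.+1 -> A).
Hypothesis hpsi : unital_star_hom psi.
Notation M := 'M[R[i]]_n.+1.
Notation nm x := (cnorm (psi x)).
Variables (d : nat) (delta : R) (F : 'I_d.+1 -> 'I_d.+1 -> M).
Hypothesis F2 : forall i j, nm (F i j) <= 2.
Hypothesis FM : forall i j k l, nm (F i j * F k l - (if j == k then F i l else 0)) <= delta.
Hypothesis FS : forall i j, nm (star (F i j) - F j i) <= delta.
Hypothesis F1 : nm (\sum_i F i i - 1) <= delta.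
Hypothesis dsmall : 1000 * d.+1%:R * delta <= 1.

Let delta_ge0 : 0 <= delta.
Proof. exact: le_trans (cnorm_ge0 _) F1. Qed.

Let dd : 1000 * delta <= 1.
Proof.
have d1 : 1 <= d.+1%:R :> R by rewrite ler1n.
move: dsmall delta_ge0; nra.
Qed.

Let nD (x y : M) : nm (x + y) <= nm x + nm y.
Proof. by rewrite (homD hpsi) cnormD. Qed.
Let nB (x y : M) : nm (x - y) = nm (y - x).
Proof. by rewrite !(homB hpsi) cnormC. Qed.
Let nS (x : M) : nm (star x) = nm x.
Proof. by rewrite (hom_star hpsi) cnorm_starE. Qed.
Let n1 : nm 1 = 1.
Proof. by rewrite (hom1 hpsi) cnorm1. Qed.
Let nM x y a b : nm x <= a -> nm y <= b -> nm (x * y) <= a * b.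
Proof. by move=> xa yb; apply: le_trans (nmM hpsi _ _) _; rewrite ler_pM ?cnorm_ge0. Qed.
Let nDD x y a b : nm x <= a -> nm y <= b -> nm (x + y) <= a + b.
Proof. by move=> xa yb; apply: le_trans (nD _ _) _; apply: lerD. Qed.

(** The projection is the spectral projection, for the eigenvalues above 1/2, of the self-adjoint
    part of [F ord0 ord0]. It is kept as an isometry Q from C^r because r is to become the
    multiplicity in a tensor decomposition. *)
Lemma near_projection : exists (r : nat) (Q : 'M[R[i]]_(n.+1, r)),
  adj Q *m Q = 1%:M /\ nm (F ord0 ord0 - Q *m adj Q) <= 9 * delta.
Proof.
have de0 := delta_ge0; set f := F ord0 ord0.
pose c : R[i] := 2^-1.
have cn : Normc.normc c = 2^-1 by rewrite Normc.normcV normc_nat.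
pose h : M := c *: (f + star f).
have cc (x : M) : c *: x + c *: x = x.
  by rewrite -scalerDl /c -mulr2n -[2^-1 *+ 2]mulr_natl mulfV ?scale1r // pnatr_eq0.
have hs : star h = h by rewrite /h starZ starD starK addrC; congr (_ *: _); rewrite /c fmorphV rmorph_nat.
have hf : nm (h - f) <= 2^-1 * delta.
  have -> : h - f = c *: (star f - f).
    rewrite /h scalerDr scalerBr.
    transitivity (c *: f + c *: star f - (c *: f + c *: f)); first by rewrite cc.
    by ncrm R[i] n.+1.
  by rewrite (homZ hpsi) cnormZ cn ler_pM2l ?FS //; lra.
have fh : nm (f - h) <= 2^-1 * delta by rewrite nB.
have h2 : nm h <= 2.
  rewrite (homZ hpsi) cnormZ cn (homD hpsi); have := cnormD (psi f) (psi (star f)).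
  by rewrite nS; have := F2 ord0 ord0; rewrite -/f; lra.
have hh : nm (h * h - h) <= 4 * delta.
  have -> : h * h - h = h * (h - f) + (h - f) * f + (f * f - f) + (f - h) by ncrm R[i] n.+1.
  apply: le_trans (_ : _ <= 2 * (2^-1 * delta) + (2^-1 * delta) * 2 + delta + 2^-1 * delta) _; last lra.
  apply: nDD fh; apply: nDD; last by have := FM ord0 ord0 ord0 ord0; rewrite eqxx.
  by apply: nDD; apply: nM => //; exact: F2.
have [D _] := diagonalize hs; set x := dx D.
have xx i : `|x i * x i - x i| <= 4 * delta.
  apply: le_trans (fc_ge hpsi D (fun t => t * t - t) i) _.
  by rewrite -fcB -fcM fc_id.
pose ind (t : R) : R := if 2^-1 < t then 1 else 0.
have hp : nm (h - fc D ind) <= 8 * delta.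
  (* From |t| |t - 1| <= 4 delta, where the factor not being estimated is at least 1/2. *)
  rewrite -{1}(fc_id D) fcB; apply: fc_norm => // i; rewrite -/x.
  have := xx i; rewrite ler_norml => /andP [x1 x2].
  rewrite ler_norml /ind; case: ltrP => xi; apply/andP; split; nra.
pose I := [pred i | 2^-1 < x i].
pose S : 'M[R[i]]_(n.+1, #|I|) := \matrix_(i, a) (i == enum_val a)%:R.
have SS : adj S *m S = 1%:M.
  apply/matrixP => a b; rewrite mxE [RHS]mxE (bigD1 (enum_val a)) //= big1 ?addr0.
    by rewrite !mxE eqxx rmorph1 mul1r (inj_eq enum_val_inj).
  by move=> i ia; rewrite !mxE (negbTE ia) rmorph0 mul0r.
have SS' : S *m adj S = dg (fun i => ind (x i)).
  apply/matrixP => i j; rewrite mxE dgE /ind.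
  case: (boolP (2^-1 < x i)) => xi.
    have Ii : i \in I by rewrite inE.
    rewrite (bigD1 (enum_rank_in Ii i)) //= big1 ?addr0.
      rewrite !mxE enum_rankK_in // eqxx mul1r rmorph_nat eq_sym.
      by case: eqP.
    move=> a ai; rewrite !mxE; case: eqP => [iE|_]; last by rewrite mul0r.
    by move: ai; rewrite -(inj_eq enum_val_inj) enum_rankK_in // -iE eqxx.
  rewrite big1 ?if_same // => a _; rewrite !mxE; case: eqP => [iE|_]; last by rewrite mul0r.
  by have := enum_valP a; rewrite -iE inE (negbTE xi).
exists #|I|, (star (dv D) *m S); split.
  have VV : dv D *m star (dv D) = 1%:M := dVv D.
  by rewrite adj_mul adjE starK mulmxA -(mulmxA (adj S)) VV mulmx1 SS.
have -> : star (dv D) *m S *m adj (star (dv D) *m S) = fc D ind.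
  by rewrite adj_mul adjE starK /fc -SS' -!mulmxE !mulmxA.
have -> : f - fc D ind = (f - h) + (h - fc D ind) by ncrm R[i] n.+1.
apply: le_trans (nDD fh hp) _; lra.
Qed.

(** The block of largest norm is recovered by F_0k up to (10 + d + 1) delta times that norm, which
    is less than the norm itself unless the block vanishes. This injectivity is what later turns a
    resolution of the identity into orthogonality of the isometries, without counting dimensions. *)
Lemma frame_injective r (Q : 'M[R[i]]_(n.+1, r)) (xi : 'I_d.+1 -> 'M[R[i]]_r) :
  adj Q *m Q = 1%:M -> nm (F ord0 ord0 - Q *m adj Q) <= 9 * delta ->
  \sum_j F j ord0 *m Q *m xi j = 0 -> forall j, xi j = 0.
Proof.
have de0 := delta_ge0 => QQ; set p : M := Q *m adj Q => Fp xi0.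
(* Norms are available only for square matrices of size n + 1, through [psi]; conjugation by Q
   brings the blocks to that size. *)
pose X j : M := Q *m xi j *m adj Q.
have pX j : p * X j = X j.
  by rewrite -[LHS]/(p *m X j) /p /X !mulmxA -(mulmxA Q) QQ mulmx1.
have FX : \sum_j F j ord0 * X j = 0.
  transitivity ((\sum_j F j ord0 *m Q *m xi j) *m adj Q); last by rewrite xi0 mul0mx.
  rewrite mulmx_suml; apply: eq_bigr => j _.
  by rewrite -[LHS]/(F j ord0 *m X j) /X !mulmxA.
suff X0 : forall j, X j = 0.
  move=> j; have := congr1 (fun Y => adj Q *m Y *m Q) (X0 j).
  by rewrite /X !mulmxA QQ mul1mx -mulmxA QQ mulmx1 mulmx0 mul0mx.
have [k _ kmax] := @Order.TotalTheory.arg_maxP _ _ 'I_d.+1 ord0 xpredT (fun j => nm (X j)) isT.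
have Xk : nm (X k) <= (10 * delta + d.+1%:R * delta) * nm (X k).
  have {1}-> : X k = (p - F ord0 ord0) * X k + (F ord0 ord0 - F ord0 k * F k ord0) * X k
      - \sum_(j | j != k) F ord0 k * F j ord0 * X j.
    transitivity (X k - F ord0 k * (\sum_j F j ord0 * X j)).
      by rewrite FX mulr0 subr0.
    have E : F ord0 k * (\sum_(j | j != k) F j ord0 * X j) =
        \sum_(j | j != k) F ord0 k * F j ord0 * X j.
      by rewrite mulr_sumr; apply: eq_bigr => j _; rewrite mulrA.
    rewrite (bigD1 k) //= mulrDr E -{1}(pX k).
    by ncrm R[i] n.+1.
  apply: le_trans (_ : _ <= (9 * delta) * nm (X k) + delta * nm (X k) + d.+1%:R * (delta * nm (X k))) _; last first.
    by rewrite !mulrDl; lra.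
  rewrite (homB hpsi); apply: le_trans (cnormB _ _) _; apply: lerD.
    apply: nDD; apply: nM => //; first by rewrite nB.
    by rewrite nB; have := FM ord0 k k ord0; rewrite eqxx.
  rewrite (hom_sum hpsi); apply: le_trans (cnorm_sum _ _ _) _.
  apply: le_trans (_ : \sum_(j : 'I_d.+1) delta * nm (X k) <= _); last first.
    by rewrite sumr_const card_ord mulr_natl.
  rewrite big_mkcond /=; apply: ler_sum => j _; case: eqVneq => [_|jk] /=.
    by rewrite mulr_ge0 ?cnorm_ge0.
  apply: nM; last exact: kmax.
  by have := FM ord0 k j ord0; rewrite eq_sym (negbTE jk) subr0.
have Xk0 : nm (X k) = 0.
  apply/le_anti; rewrite cnorm_ge0 andbT; move: Xk; rewrite -[X in X <= _]mul1r => Xk.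
  have small : 10 * delta + d.+1%:R * delta <= 2^-1 by move: dsmall dd; nra.
  by have := cnorm_ge0 (psi (X k)); nra.
move=> j; have Xj0 : nm (X j) = 0 by apply/le_anti; rewrite cnorm_ge0 andbT -Xk0; exact: kmax.
have psiX0 := cnorm0_eq0 _ Xj0.
apply/matrixP => a b; have := entry_le hpsi (X j) a b.
rewrite psiX0 cnorm0 [RHS]mxE => xab; apply: Normc.eq0_normc.
apply/le_anti; rewrite xab /= /Normc.normc; case: (X j a b) => u v; exact: sqrtr_ge0.
Qed.

(** With p the projection found above, the elements [F i ord0 * p * star (F j ord0)] imitate matrix
    units, and their diagonal sum S is close to 1. Multiplying each [F j ord0] by S^(-1/2) on the
    left makes that sum exactly 1. *)
Lemma near_isometries : exists (r : nat) (U : 'I_d.+1 -> 'M[R[i]]_(n.+1, r)),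
  [/\ forall i j, adj (U i) *m U j = if i == j then 1%:M else 0,
      \sum_i U i *m adj (U i) = 1 &
      forall i j, nm (F i j - U i *m adj (U j)) <= 500 * d.+1%:R * delta].
Proof.
have de0 := delta_ge0; have [r [Q [QQ Fp]]] := near_projection.
set p : M := Q *m adj Q in Fp.
have ps : star p = p by rewrite -adjE adj_mul adjK.
have pp : p * p = p by rewrite -mulmxE /p mulmxA -(mulmxA Q) QQ mulmx1.
have pn : nm p <= 1.
  have := cnorm_star (psi p); rewrite -(hom_star hpsi) -(homM hpsi) ps pp.
  by have := cnorm_ge0 (psi p); nra.
pose z i j : M := F i ord0 * p * star (F j ord0).
have Fs j : nm (star (F j ord0)) <= 2 by rewrite nS.
(* 43 = 36 + 4 + 2 + 1, one summand for each of the four terms below. *)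
have zF i j : nm (z i j - F i j) <= 43 * delta.
  set f := F ord0 ord0 in Fp.
  have -> : z i j - F i j = F i ord0 * (p - f) * star (F j ord0)
     + F i ord0 * f * (star (F j ord0) - F ord0 j)
     + (F i ord0 * f - F i ord0) * F ord0 j + (F i ord0 * F ord0 j - F i j).
    by rewrite /z; ncrm R[i] n.+1.
  apply: le_trans (_ : _ <= 2 * (9 * delta) * 2 + 2 * 2 * delta + delta * 2 + delta) _; last lra.
  apply: nDD; last by have := FM i ord0 ord0 j; rewrite eqxx.
  apply: nDD; last by apply: nM (F2 _ _); have := FM i ord0 ord0 ord0; rewrite eqxx.
  apply: nDD; first by apply: nM (Fs j); apply: nM (F2 _ _) _; rewrite nB.
  by apply: nM (FS _ _); apply: nM; exact: F2.
pose S : M := \sum_i z i i.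
have zs i j : star (z i j) = z j i by rewrite /z !starM starK ps mulrA.
have Ss : star S = S by rewrite star_sum; apply: eq_bigr => i _; rewrite zs.
(* It covers d + 1 errors of 43 delta and the defect delta of the sum of the F_ii. *)
pose eta := 44 * d.+1%:R * delta.
have d1 : 1 <= d.+1%:R :> R by rewrite ler1n.
have eta0 : 0 <= eta by rewrite /eta !mulr_ge0.
have etas : eta <= 2^-1 by rewrite /eta; move: dsmall; nra.
have S1 : nm (S - 1) <= eta.
  have -> : S - 1 = \sum_i (z i i - F i i) + (\sum_i F i i - 1) by rewrite sumrB -/S; ncrm R[i] n.+1.
  apply: le_trans (nDD (_ : _ <= d.+1%:R * (43 * delta)) F1) _; last by rewrite /eta; nra.
  rewrite (hom_sum hpsi); apply: le_trans (cnorm_sum _ _ _) _.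
  rewrite mulr_natl -[X in _ *+ X]card_ord -sumr_const; apply: ler_sum => i _.
  exact: zF.
have [D _] := diagonalize Ss; set s := dx D.
have sn i : `|s i - 1| <= eta.
  apply: le_trans (fc_ge hpsi D (fun t => t - 1) i) _.
  by rewrite -(fcB D id) fc_id fc1.
have s0 i : 2^-1 <= s i by have := sn i; rewrite ler_norml => /andP [? ?]; lra.
have q0 i : 0 < Num.sqrt (s i) by rewrite sqrtr_gt0; have := s0 i; lra.
have qq i : Num.sqrt (s i) * Num.sqrt (s i) = s i.
  by rewrite -expr2 sqr_sqrtr //; have := s0 i; lra.
pose G := fc D (fun t => (Num.sqrt t)^-1); pose G' := fc D (fun t => Num.sqrt t).
have G'G : G' * G = 1.
  rewrite fcM -(fc1 D); apply: eq_fc => i; rewrite -/s mulfV // gt_eqF //.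
have GSG : G * S * G = 1.
  rewrite -{1}(fc_id D) !fcM -(fc1 D); apply: eq_fc => i; rewrite -/s -{2}(qq i).
  by field; rewrite gt_eqF.
have Gs : star G = G by exact: fc_star.
have G1 : nm (G - 1) <= eta.
  rewrite -(fc1 D) fcB; apply: fc_norm => // i; rewrite -/s.
  have := sn i; have := qq i; have := q0 i; have := s0 i.
  set q := Num.sqrt (s i) => s0i q0i qqi sni.
  have q2 : 2^-1 <= q by rewrite leNgt; apply/negP => q2; nra.
  have -> : q^-1 - 1 = (1 - s i) * (q * (1 + q))^-1.
    by rewrite -qqi; field; apply/andP; split; rewrite gt_eqF //; lra.
  rewrite normrM (ger0_norm (_ : 0 <= (q * (1 + q))^-1)); last by rewrite invr_ge0; nra.
  rewrite distrC; apply: le_trans (_ : `|s i - 1| * 1 <= _); last by rewrite mulr1.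
  rewrite ler_wpM2l // invf_le1; last by nra.
  have : 2^-1 <= q * q by rewrite qqi.
  nra.
have G2 : nm G <= 3 / 2.
  have -> : G = (G - 1) + 1 by ncrm R[i] n.+1.
  by apply: le_trans (nD _ _) _; rewrite n1; lra.
(* The total is 10 eta + 43 delta, hence at most 483 (d + 1) delta. *)
have GzG i j : nm (F i j - G * z i j * G) <= 500 * d.+1%:R * delta.
  have zn : nm (z i j) <= 4.
    apply: le_trans (_ : _ <= 2 * 1 * 2) _; last lra.
    by apply: nM (Fs j); apply: nM (F2 _ _) pn.
  rewrite nB (_ : G * z i j * G - F i j =
    (G - 1) * z i j * G + z i j * (G - 1) + (z i j - F i j)); last by ncrm R[i] n.+1.
  apply: le_trans (_ : _ <= eta * 4 * (3 / 2) + 4 * eta + 43 * delta) _.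
    apply: nDD (zF i j); apply: nDD; last exact: nM.
    by apply: nM G2; exact: nM.
  by rewrite /eta; nra.
pose U j : 'M[R[i]]_(n.+1, r) := (G * F j ord0 : M) *m Q.
have UU' i j : U i *m adj (U j) = G * z i j * G.
  rewrite /U adj_mul adjE starM Gs mulmxA -(mulmxA (G * F i ord0)) -/p.
  change (G * F i ord0 * p * (star (F j ord0) * G) = G * (F i ord0 * p * star (F j ord0)) * G).
  by ncrm R[i] n.+1.
have Usum : \sum_i U i *m adj (U i) = 1.
  under eq_bigr => i _ do rewrite UU'.
  by rewrite -mulr_suml -mulr_sumr.
have UQ i : F i ord0 *m Q = G' *m U i.
  rewrite /U mulmxA; congr (_ *m _); change (F i ord0 = G' * (G * F i ord0)).
  by rewrite mulrA G'G mul1r.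
(* The sum over i of [U i *m adj (U i)] is 1, so the combination of the U_i with coefficients
   [adj (U i) *m U j], minus the identity for i = j, vanishes; injectivity of the frame makes each
   coefficient zero. *)
have UU i j : adj (U i) *m U j = if i == j then 1%:M else 0.
  apply/eqP; rewrite -subr_eq0; apply/eqP; move: i.
  apply: (frame_injective QQ Fp); transitivity (G' *m (\sum_i U i *m (adj (U i) *m U j - (if i == j then 1%:M else 0)))).
    by rewrite mulmx_sumr; apply: eq_bigr => i _; rewrite UQ mulmxA.
  rewrite (_ : \sum_i _ = 0) ?mulmx0 //.
  under eq_bigr => i _ do rewrite mulmxBr mulmxA.
  rewrite sumrB -mulmx_suml Usum mul1mx (bigD1 j) //= eqxx mulmx1 big1 ?addr0 ?subrr //.
  by move=> i /negbTE ->; rewrite mulmx0.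
by exists r, U; split => // i j; rewrite UU'.
Qed.

(** The isometries identify C^(n+1) with C^(d+1) (x) C^r, and E is the standard system in these
    coordinates. That E spans is seen by inserting the resolution of the identity on both sides of
    Y. *)
Lemma near_matrix_units : exists (r : nat) (E : 'I_d.+1 * 'I_r -> 'I_d.+1 * 'I_r -> M),
  [/\ forall a b c e, E a b * E c e = if b == c then E a e else 0,
      forall a b, star (E a b) = E b a,
      \sum_a E a a = 1,
      forall Y : M, exists c, Y = \sum_a \sum_b c a b *: E a b &
      forall i j, nm (F i j - \sum_a E (i, a) (j, a)) <= 500 * d.+1%:R * delta].
Proof.
have [r [U [UU U1 FU]]] := near_isometries.
pose E (a b : 'I_d.+1 * 'I_r) : M := U a.1 *m delta_mx a.2 b.2 *m adj (U b.1).
have sumE i j : \sum_a E (i, a) (j, a) = U i *m adj (U j).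
  rewrite /E /= -mulmx_suml -mulmx_sumr -[in RHS](mulmx1 (U i)).
  congr (_ *m _ *m _); apply/matrixP => a b.
  rewrite summxE mxE (bigD1 a) //= big1 ?addr0; first by rewrite mxE eqxx eq_sym.
  by move=> c ca; rewrite mxE eq_sym (negbTE ca).
exists r, E; split.
- move=> a b c e; rewrite -[LHS]/(E a b *m E c e) /E.
  rewrite -(mulmxA _ (adj (U b.1))) (mulmxA (adj (U b.1))) (mulmxA (adj (U b.1))) UU.
  have -> : (b == c) = (b.1 == c.1) && (b.2 == c.2) by case: b c => [? ?] [? ?].
  case: (b.1 == c.1); last by rewrite !mul0mx mulmx0.
  rewrite mul1mx !mulmxA -(mulmxA (U a.1) (delta_mx _ b.2) (delta_mx c.2 _)) mul_delta_mx_cond.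
  by case: (b.2 == c.2); rewrite ?mulr1n // mulr0n mulmx0 mul0mx.
- move=> a b; rewrite -adjE /E !adj_mul adjK mulmxA; congr (_ *m _ *m _).
  by apply/matrixP => u v; rewrite !mxE rmorph_nat andbC.
- rewrite -U1 -(pair_bigA _ (fun i a => E (i, a) (i, a))) /=.
  by apply: eq_bigr => i _; rewrite sumE.
- move=> Y; pose c (a b : 'I_d.+1 * 'I_r) := (adj (U a.1) *m Y *m U b.1) a.2 b.2.
  exists c; rewrite -(pair_bigA _ (fun i a => \sum_b c (i, a) b *: E (i, a) b)) /=.
  transitivity (\sum_i \sum_j U i *m (adj (U i) *m Y *m U j) *m adj (U j)).
    transitivity ((\sum_i U i *m adj (U i)) *m Y *m (\sum_j U j *m adj (U j))).
      by rewrite U1 mul1mx mulmx1.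
    rewrite mulmx_suml mulmx_suml; apply: eq_bigr => i _.
    by rewrite mulmx_sumr; apply: eq_bigr => j _; rewrite !mulmxA.
  apply: eq_bigr => i _.
  transitivity (\sum_j \sum_a \sum_b c (i, a) (j, b) *: E (i, a) (j, b)).
    apply: eq_bigr => j _.
    rewrite {1}(matrix_sum_delta (adj (U i) *m Y *m U j)) mulmx_sumr mulmx_suml.
    apply: eq_bigr => a _; rewrite mulmx_sumr mulmx_suml; apply: eq_bigr => b _.
    by rewrite -scalemxAr -scalemxAl.
  rewrite exchange_big /=; apply: eq_bigr => a _.
  by rewrite (pair_bigA _ (fun j b => c (i, a) (j, b) *: E (i, a) (j, b))) /=;
    apply: eq_bigr => -[].
- by move=> i j; rewrite sumE.
Qed.

End Stability.

(** * Limits of approximate chains of matrix algebras *)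

Lemma sum_mul_ord (V : nmodType) (p q : nat) (F : nat -> V) :
  \sum_(u < p * q) F u = \sum_(i < p) \sum_(a < q) F (i * q + a)%N.
Proof.
elim: p => [|p IH]; first by rewrite mul0n !big_ord0.
rewrite big_ord_recr /= -IH mulSnr -!(big_mkord xpredT F).
rewrite (@big_cat_nat _ _ _ (p * q)) ?leq_addr //=; congr (_ + _).
rewrite -{1}[(p * q)%N]add0n big_addn addKn big_mkord.
by apply: eq_bigr => a _; rewrite addnC.
Qed.

Section Bond.
Variables (R : realType) (D D' m : nat).
Hypothesis DD : D'.+1 = (D.+1 * m.+1)%N.

(** This is x (x) 1, with the pair (i, a) numbered i (m + 1) + a. *)
Definition bondmx (x : 'M[R[i]]_D.+1) : 'M[R[i]]_D'.+1 :=
  \matrix_(u, v) if (u %% m.+1 == v %% m.+1)%N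
                 then x (inord (u %/ m.+1)) (inord (v %/ m.+1)) else 0.

Lemma sum_bond (V : nmodType) (F : nat -> V) :
  \sum_(u < D'.+1) F u = \sum_(i < D.+1) \sum_(a < m.+1) F (i * m.+1 + a)%N.
Proof. by rewrite DD sum_mul_ord. Qed.

Lemma bond_div (i : 'I_D.+1) (a : 'I_m.+1) : inord ((i * m.+1 + a) %/ m.+1) = i :> 'I_D.+1.
Proof. by rewrite divnMDl // divn_small // addn0 inord_val. Qed.

Lemma bond_mod (i : 'I_D.+1) (a : 'I_m.+1) : ((i * m.+1 + a) %% m.+1)%N = a.
Proof. by rewrite modnMDl modn_small. Qed.

(** The entries as a function of natural numbers, the form in which sums over the numbered pairs can
    be reindexed. *)
Definition bondf (x : 'M[R[i]]_D.+1) (u v : nat) : R[i] :=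
  if (u %% m.+1 == v %% m.+1)%N then x (inord (u %/ m.+1)) (inord (v %/ m.+1)) else 0.

Lemma sum_bondf (V : lmodType R[i]) x (F : nat -> nat -> V) :
  \sum_(u < D'.+1) \sum_(v < D'.+1) bondmx x u v *: F u v =
  \sum_(i < D.+1) \sum_(j < D.+1) x i j *: \sum_(a < m.+1) F (i * m.+1 + a)%N (j * m.+1 + a)%N.
Proof.
transitivity (\sum_(u < D'.+1) \sum_(v < D'.+1) bondf x u v *: F u v).
  by apply: eq_bigr => u _; apply: eq_bigr => v _; rewrite mxE.
rewrite (sum_bond (fun u => \sum_(v < D'.+1) bondf x u v *: F u v)).
apply: eq_bigr => i _.
transitivity (\sum_(a < m.+1) \sum_(j < D.+1) x i j *: F (i * m.+1 + a)%N (j * m.+1 + a)%N).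
  apply: eq_bigr => a _; rewrite (sum_bond (fun v => bondf x _ v *: F _ v)).
  apply: eq_bigr => j _; rewrite (bigD1 a) //= big1 ?addr0.
    by rewrite /bondf !bond_div !bond_mod eqxx.
  move=> b ba; rewrite /bondf !bond_div !bond_mod ifN ?scale0r //.
  by rewrite eq_sym.
by rewrite exchange_big; apply: eq_bigr => j _; rewrite scaler_sumr.
Qed.

Lemma bond_hom : unital_star_hom bondmx.
Proof.
split.
- move=> c x y; apply/matrixP => u v; rewrite !mxE.
  by case: ifP => _; rewrite ?mulr0 ?addr0.
- split.
    apply/matrixP => u v; rewrite !mxE.
    have lt w : (w < D'.+1 -> w %/ m.+1 < D.+1)%N by rewrite DD ltn_divLR.
    have [uv|uv] := eqVneq u v; first by rewrite uv !eqxx.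
    case: ifP => // /eqP muv; case: eqP => // /(congr1 val) /=.
    rewrite !inordK ?lt // => duv; case/eqP: uv; apply: val_inj.
    by rewrite /= (divn_eq u m.+1) muv duv -divn_eq.
  move=> x y; apply/matrixP => u v; rewrite mxE [RHS]mxE.
  transitivity (\sum_(w < D'.+1) bondf x u w * bondf y w v); last first.
    by apply: eq_bigr => w _; rewrite !mxE.
  rewrite (sum_bond (fun w => bondf x u w * bondf y w v)).
  have um : (u %% m.+1 < m.+1)%N by rewrite ltn_mod.
  transitivity (\sum_(i < D.+1) bondf x u (i * m.+1 + Ordinal um)%N * bondf y (i * m.+1 + Ordinal um)%N v); last first.
    apply: eq_bigr => i _; rewrite [RHS](bigD1 (Ordinal um)) //= big1 ?addr0 // => b bu.
    rewrite {1}/bondf bond_mod ifN ?mul0r // eq_sym.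
    by apply: contra bu => /eqP bE; apply/eqP/val_inj.
  case: ifP => uv.
    rewrite mxE; apply: eq_bigr => i _.
    by rewrite /bondf !bond_div !bond_mod /= uv eqxx.
  by rewrite big1 // => i _; rewrite /bondf !bond_mod /= uv mulr0.
- move=> x; apply/matrixP => u v; rewrite !mxE eq_sym.
  by case: ifP => _; rewrite ?mxE // rmorph0.
Qed.

Definition sumnorm p (x : 'M[R[i]]_p) : R := \sum_i \sum_j Normc.normc (x i j).

Lemma sumnorm_bond x : sumnorm (bondmx x) = m.+1%:R * sumnorm x.
Proof.
rewrite /sumnorm.
transitivity (\sum_(u < D'.+1) \sum_(v < D'.+1) Normc.normc (bondf x u v)).
  by apply: eq_bigr => u _; apply: eq_bigr => v _; rewrite mxE.
rewrite (sum_bond (fun u => \sum_(v < D'.+1) Normc.normc (bondf x u v))) mulr_sumr.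
apply: eq_bigr => i _.
transitivity (\sum_(a < m.+1) \sum_(j < D.+1) Normc.normc (x i j)); last first.
  by rewrite sumr_const card_ord mulr_natl.
apply: eq_bigr => a _; rewrite (sum_bond (fun v => Normc.normc (bondf x _ v))).
apply: eq_bigr => j _; rewrite (bigD1 a) //= big1 ?addr0.
  by rewrite /bondf !bond_div !bond_mod eqxx.
move=> b ba; rewrite /bondf !bond_div !bond_mod ifN ?Normc.normc0 //.
by rewrite eq_sym.
Qed.

End Bond.

Section LinearCombination.
Variables (R : realType) (A : cstarAlgType R) (p : nat) (f : nat -> nat -> A).
Notation M := 'M[R[i]]_p.
Notation normc := (@Normc.normc R).

Definition comb (x : M) : A := \sum_(i < p) \sum_(j < p) x i j *: f i j.

Lemma comb_linear c x y : comb (c *: x + y) = c *: comb x + comb y.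
Proof.
rewrite /comb scaler_sumr -big_split; apply: eq_bigr => i _.
rewrite scaler_sumr -big_split; apply: eq_bigr => j _.
by rewrite !mxE scalerDl scalerA.
Qed.

Lemma comb_diff (g : nat -> nat -> A) x (t : R) :
  (forall i j, (i < p)%N -> (j < p)%N -> cnorm (f i j - g i j) <= t) ->
  cnorm (comb x - \sum_(i < p) \sum_(j < p) x i j *: g i j) <= t * sumnorm x.
Proof.
move=> fg; rewrite /comb -sumrB mulr_sumr.
apply: le_trans (cnorm_sum _ _ _) _; apply: ler_sum => i _.
rewrite -sumrB mulr_sumr; apply: le_trans (cnorm_sum _ _ _) _; apply: ler_sum => j _.
rewrite -scalerBr cnormZ mulrC ler_wpM2r ?fg //.
by rewrite /Normc.normc; case: (x i j) => u v; exact: sqrtr_ge0.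
Qed.

End LinearCombination.

Section Approximate.
Variables (R : realType) (A : cstarAlgType R) (p : nat) (f : nat -> nat -> A) (t : R).
Notation M := 'M[R[i]]_p.+1.
Notation phi := (comb (p := p.+1) f).
Hypothesis fM : forall i j k l, (i <= p)%N -> (j <= p)%N -> (k <= p)%N -> (l <= p)%N ->
  cnorm (f i j * f k l - (if j == k then f i l else 0)) <= t.
Hypothesis fS : forall i j, (i <= p)%N -> (j <= p)%N -> cnorm (star (f i j) - f j i) <= t.
Hypothesis f1 : cnorm (\sum_(i < p.+1) f i i - 1) <= t.

Lemma normc_ge0 (z : R[i]) : 0 <= Normc.normc z.
Proof. by rewrite /Normc.normc; case: z => u v; exact: sqrtr_ge0. Qed.

Lemma comb_one : cnorm (phi 1 - 1) <= t.
Proof.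
rewrite (_ : phi 1 = \sum_(i < p.+1) f i i) //.
apply: eq_bigr => i _; rewrite (bigD1 i) //= big1 ?addr0.
  by rewrite mxE eqxx scale1r.
by move=> j ji; rewrite mxE eq_sym (negbTE ji) scale0r.
Qed.

Lemma comb_star (x : M) : cnorm (phi (star x) - star (phi x)) <= t * sumnorm x.
Proof.
have -> : phi (star x) - star (phi x) =
    \sum_(i < p.+1) \sum_(j < p.+1) (x i j)^* *: (f j i - star (f i j)).
  rewrite /comb star_sum exchange_big -sumrB; apply: eq_bigr => i _.
  rewrite star_sum -sumrB; apply: eq_bigr => j _.
  by rewrite starZ scalerBr !mxE.
rewrite /sumnorm mulr_sumr; apply: le_trans (cnorm_sum _ _ _) _; apply: ler_sum => i _.
rewrite mulr_sumr; apply: le_trans (cnorm_sum _ _ _) _; apply: ler_sum => j _.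
have -> : Normc.normc (x i j) = Normc.normc ((x i j)^*).
  by case: (x i j) => u v /=; rewrite sqrrN.
rewrite cnormZ mulrC ler_wpM2r ?normc_ge0 // cnormC; apply: fS; rewrite -ltnS //.
Qed.

Lemma comb_mul (x y : M) :
  cnorm (phi (x * y) - phi x * phi y) <= t * (sumnorm x * sumnorm y).
Proof.
have E1 : phi x * phi y = \sum_i \sum_j \sum_k \sum_l
    (x i j * y k l) *: (f i j * f k l).
  rewrite /comb mulr_suml; apply: eq_bigr => i _; rewrite mulr_suml; apply: eq_bigr => j _.
  rewrite mulr_sumr; apply: eq_bigr => k _; rewrite mulr_sumr; apply: eq_bigr => l _.
  by rewrite -scalerAl -scalerAr scalerA.
have E2 : phi (x * y) = \sum_(i < p.+1) \sum_(j < p.+1) \sum_(k < p.+1) \sum_(l < p.+1)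
    (x i j * y k l) *: (if j == k :> nat then f i l else 0).
  rewrite /comb; apply: eq_bigr => i _.
  transitivity (\sum_(j < p.+1) \sum_(l < p.+1) (x i j * y j l) *: f i l).
    rewrite exchange_big; apply: eq_bigr => l _; rewrite mxE scaler_suml.
    by apply: eq_bigr => j _.
  apply: eq_bigr => j _; rewrite [RHS](bigD1 j) //= [X in _ = _ + X]big1 ?addr0.
    by apply: eq_bigr => l _; rewrite eqxx.
  move=> k kj; rewrite big1 // => l _; case: eqP => [jk|_]; last by rewrite scaler0.
  by case/eqP: kj; apply: val_inj.
rewrite E1 E2 -sumrB /sumnorm mulr_suml mulr_sumr.
apply: le_trans (cnorm_sum _ _ _) _; apply: ler_sum => i _.
rewrite -sumrB mulr_suml mulr_sumr.
apply: le_trans (cnorm_sum _ _ _) _; apply: ler_sum => j _.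
rewrite -sumrB mulr_sumr mulr_sumr.
apply: le_trans (cnorm_sum _ _ _) _; apply: ler_sum => k _.
rewrite -sumrB mulr_sumr mulr_sumr.
apply: le_trans (cnorm_sum _ _ _) _; apply: ler_sum => l _.
rewrite -scalerBr cnormZ Normc.normcM mulrC ler_wpM2r ?mulr_ge0 ?normc_ge0 //.
by rewrite cnormC; apply: fM; rewrite -ltnS.
Qed.

End Approximate.

Section Chain.
Variables (R : realType) (A : cstarAlgType R) (D m k : nat -> nat) (f : nat -> nat -> nat -> A).
Hypothesis DD : forall s, (D s.+1).+1 = ((D s).+1 * (m s).+1)%N.
Hypothesis kk : forall s, (k s < k s.+1)%N.
Notation eps s := (2^-1 ^+ k s : R).
Notation dim s := ((D s).+1%:R : R).
Notation tol s := (eps s / (dim s * dim s)).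
Hypothesis fM : forall s i j u v, (i <= D s)%N -> (j <= D s)%N -> (u <= D s)%N -> (v <= D s)%N ->
  cnorm (f s i j * f s u v - (if j == u then f s i v else 0)) <= tol s.
Hypothesis fS : forall s i j, (i <= D s)%N -> (j <= D s)%N -> cnorm (star (f s i j) - f s j i) <= tol s.
Hypothesis f1 : forall s, cnorm (\sum_(i < (D s).+1) f s i i - 1) <= tol s.
Hypothesis ff : forall s i j, (i <= D s)%N -> (j <= D s)%N ->
  cnorm (f s i j - \sum_(a < (m s).+1) f s.+1 (i * (m s).+1 + a)%N (j * (m s).+1 + a)%N)
    <= eps s / dim s.

Notation Mx s := 'M[R[i]]_((D s).+1).
Definition cbond s : Mx s -> Mx s.+1 := @bondmx R (D s) (D s.+1) (m s).
Definition cphi s : Mx s -> A := comb (p := (D s).+1) (f s).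
Lemma cbond_hom s : unital_star_hom (@cbond s).
Proof. exact: bond_hom (DD s). Qed.

(** Normalised by the dimension, the entry sum is invariant under the connecting maps. The
    tolerances are chosen for it: dividing by dim^2 bounds the defect of products by eps tau(x)
    tau(y), and dividing by dim bounds the change from one stage to the next by eps tau(x), which is
    summable along the chain. *)
Definition tau s (x : Mx s) : R := sumnorm x / dim s.

(** The element is moved up j stages before the approximate homomorphism is applied, so the defects
    of [cPhi j] are those of stage s + j. *)
Fixpoint cPhi j s : Mx s -> A :=
  if j is j'.+1 then fun x => cPhi j' (cbond x) else @cphi s.

Let half0 n : 0 < 2^-1 ^+ n :> R.
Proof. by apply: exprn_gt0; lra. Qed.

Let dim0 s : 0 < dim s. Proof. by rewrite ltr0n. Qed.
Let dim1 s : 1 <= dim s. Proof. by rewrite ler1n. Qed.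

Lemma sumnorm_ge0 p (x : 'M[R[i]]_p) : 0 <= sumnorm x.
Proof. by apply: sumr_ge0 => i _; apply: sumr_ge0 => j _; exact: normc_ge0. Qed.

Lemma tau_ge0 s (x : Mx s) : 0 <= tau x.
Proof. by rewrite divr_ge0 ?sumnorm_ge0 // ltW. Qed.

Lemma tau_bond s (x : Mx s) : tau (cbond x) = tau x.
Proof.
rewrite /tau /cbond (sumnorm_bond (DD s)) DD natrM [(_ * _ : R) in X in _ / X]mulrC.
by rewrite -mulf_div divff ?mul1r // pnatr_eq0.
Qed.

Lemma k_add s j : (k s + j <= k (s + j))%N.
Proof. by elim: j => [|j IH]; rewrite ?addn0 // !addnS; apply: leq_ltn_trans IH (kk _). Qed.

Lemma eps_add s j : eps (s + j) <= eps s * 2^-1 ^+ j.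
Proof.
rewrite -exprD -(subnKC (k_add s j)) exprD.
apply: ler_piMr; first exact: ltW.
by apply: exprn_ile1; lra.
Qed.

Lemma cphi_step s (x : Mx s) : cnorm (cphi (cbond x) - cphi x) <= eps s * tau x.
Proof.
rewrite cnormC /cphi [X in _ - X]/comb /cbond sum_bondf //.
pose g i j := \sum_(a < (m s).+1) f s.+1 (i * (m s).+1 + a)%N (j * (m s).+1 + a)%N.
apply: le_trans (@comb_diff _ _ _ (f s) g x (eps s / dim s) _) _.
  by move=> i j; rewrite !ltnS; exact: ff.
by rewrite /tau mulrA mulrAC.
Qed.

Lemma cPhi_step j s (x : Mx s) : cnorm (cPhi j.+1 x - cPhi j x) <= eps s * tau x * 2^-1 ^+ j.
Proof.
apply: le_trans (_ : _ <= eps (s + j) * tau x) _; last first.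
  by have := ler_wpM2r (tau_ge0 x) (eps_add s j); rewrite mulrAC.
elim: j s x => [|j IH] s x; first by rewrite addn0; exact: cphi_step.
by have := IH s.+1 (cbond x); rewrite tau_bond addSnnS.
Qed.

Lemma cPhi_linear j s (c : R[i]) (x y : Mx s) : cPhi j (c *: x + y) = c *: cPhi j x + cPhi j y.
Proof.
elim: j s x y => [|j IH] s x y /=; first exact: comb_linear.
by case: (cbond_hom s) => -> _ _; rewrite IH.
Qed.

Lemma cPhi_mul j s (x y : Mx s) :
  cnorm (cPhi j (x * y) - cPhi j x * cPhi j y) <= tau x * tau y * eps (s + j).
Proof.
elim: j s x y => [|j IH] s x y /=.
  rewrite addn0; apply: le_trans (comb_mul (fM (s := s)) _ _) _.
  rewrite /tau le_eqVlt; apply/orP; left; apply/eqP.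
  move: (sumnorm x) (sumnorm y) (dim s) (dim0 s) => a b d d0; field.
  by rewrite gt_eqF.
rewrite -addSnnS (homM (cbond_hom s)).
by have := IH s.+1 (cbond x) (cbond y); rewrite !tau_bond.
Qed.

Lemma tol_le s : tol s <= eps s / dim s.
Proof.
apply: ler_wpM2l; first exact: ltW.
rewrite lef_pV2 ?posrE ?mulr_gt0 //.
by apply: ler_peMr; [exact: ltW|].
Qed.

Lemma cPhi_star j s (x : Mx s) :
  cnorm (cPhi j (star x) - star (cPhi j x)) <= tau x * eps (s + j).
Proof.
elim: j s x => [|j IH] s x /=.
  rewrite addn0; apply: le_trans (comb_star (fS (s := s)) _) _.
  apply: le_trans (_ : _ <= eps s / dim s * sumnorm x) _.
    by apply: ler_wpM2r; [exact: sumnorm_ge0|exact: tol_le].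
  by rewrite /tau mulrC mulrA mulrAC.
rewrite -addSnnS (hom_star (cbond_hom s)).
by have := IH s.+1 (cbond x); rewrite !tau_bond.
Qed.

Lemma cPhi_one j s : cnorm (cPhi j (1 : Mx s) - 1) <= eps (s + j).
Proof.
elim: j s => [|j IH] s /=.
  rewrite addn0; apply: le_trans (comb_one (f1 s)) _; apply: le_trans (tol_le s) _.
  by apply: ler_piMr; [exact: ltW|rewrite invf_le1].
by rewrite -addSnnS (hom1 (cbond_hom s)).
Qed.

Lemma eps_cv0 s : cv0 (fun j => eps (s + j)).
Proof.
apply: cv0_le (cv0Ml (eps s) (@cv0_half R)) => j.
by rewrite ltW // eps_add.
Qed.

(* The exact homomorphisms of the stages are the limits of the approximate ones
   precomposed with the connecting maps. *)
Lemma chain_limit : exists psi : forall s, Mx s -> A,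
  [/\ forall s, unital_star_hom (psi s),
      forall s x, psi s.+1 (cbond x) = psi s x &
      forall s x, cnorm (cphi x - psi s x) <= 2 * (eps s * tau x)].
Proof.
have H s (x : Mx s) : exists y, cvA (fun j => cPhi j x) y /\ cnorm (cphi x - y) <= 2 * (eps s * tau x).
  have c0 : 0 <= eps s * tau x by apply: mulr_ge0; [exact: ltW|exact: tau_ge0].
  have [y ly yP] := cvA_geometric c0 (fun j => cPhi_step j x).
  by exists y; split => //; have := yP 0%N; rewrite expr0 mulr1.
pose psi s (x : Mx s) : A := projT1 (cid (H s x)).
have psiP s (x : Mx s) : cvA (fun j => cPhi j x) (psi s x) by case: (projT2 (cid (H s x))).
have psiN s (x : Mx s) : cnorm (cphi x - psi s x) <= 2 * (eps s * tau x) by case: (projT2 (cid (H s x))).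
exists psi; split => // [s|s x]; last first.
  by apply: (cvA_unique (psiP s.+1 (cbond x))); have := cvA_shift 1 (psiP s x); apply: cvA_ext => j; rewrite addn1.
split.
- move=> c x y; apply: (cvA_unique (psiP s (c *: x + y))).
  apply: cvA_ext (cvA_add (cvA_scale c (psiP s x)) (psiP s y)) => j.
  by rewrite cPhi_linear.
- split.
    apply: (cvA_unique (psiP s 1)); apply: (cvA_le _ (eps_cv0 s)) => j; exact: cPhi_one.
  move=> x y; apply: (cvA_unique (psiP s (x * y))).
  apply: (cvA_close (cvA_mul (psiP s x) (psiP s y))).
  apply: cv0_le (cv0Ml (tau x * tau y) (eps_cv0 s)) => j.
  by rewrite cnorm_ge0 cPhi_mul.
- move=> x; apply: (cvA_unique (psiP s (star x))).
  apply: (cvA_close (cvA_star (psiP s x))).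
  apply: cv0_le (cv0Ml (tau x) (eps_cv0 s)) => j.
  by rewrite cnorm_ge0 cPhi_star.
Qed.

End Chain.

(** * The universal property of a dense chain *)

Section UniversalProperty.
Variables (R : realType) (m : nat -> nat).
Notation Mx s := 'M[R[i]]_((m s).+1).
Variables (bond : forall s, Mx s -> Mx s.+1) (A : cstarAlgType R) (psi : forall s, Mx s -> A).
Hypothesis hpsi : is_cocone (D := fun s => Mx s) bond psi.
Hypothesis dense : forall x, cl (in_stage (D := fun s => Mx s) psi) x.

Section Mediating.
Variables (B : cstarAlgType R) (g : forall s, Mx s -> B).
Hypothesis hg : is_cocone (D := fun s => Mx s) bond g.

(** The mediating map is the closure of the relation between [psi y] and [g y]. Density and
    completeness make it total; it is single-valued because [psi] and [g] induce the same norm on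
    every stage. *)
Definition graph (x : A) (b : B) : Prop :=
  forall eps : R, 0 < eps -> exists s (y : Mx s), cnorm (x - psi y) < eps /\ cnorm (b - g y) < eps.

Lemma cocone_norm s (y : Mx s) : cnorm (g y) = cnorm (psi y).
Proof. by case: hpsi hg => hp _ [hg' _]; exact: (matrix_hom_norm y (hp s) (hg' s)). Qed.

Lemma stage2 s t (y : Mx s) (z : Mx t) : exists r (y' z' : Mx r),
  [/\ psi y = psi y', psi z = psi z', g y = g y' & g z = g z'].
Proof.
have up s' (x : Mx s') j : exists x' : Mx (j + s'), psi x = psi x' /\ g x = g x'.
  elim: j => [|j [x' [-> ->]]]; first by exists x.
  by exists (bond x'); case: hpsi hg => _ -> [_ ->].
have [y' [-> ->]] := up s y t; have [z' [-> ->]] := up t z s.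
by move: z'; rewrite addnC => z'; exists (t + s)%N, y', z'.
Qed.

Lemma graphP x b : graph x b <-> exists v : nat -> {s : nat & Mx s},
  cvA (fun n => psi (projT2 (v n))) x /\ cvA (fun n => g (projT2 (v n))) b.
Proof.
split=> [H|[v [vx vb]] eps eps0].
  have H' n : exists p : {s : nat & Mx s},
      cnorm (x - psi (projT2 p)) < 2^-1 ^+ n /\ cnorm (b - g (projT2 p)) < 2^-1 ^+ n.
    have [|s [y yP]] := H (2^-1 ^+ n); first by apply: exprn_gt0; lra.
    by exists (existT _ s y).
  have [v vP] := boolp.choice H'; exists v; split;
    by apply: (cvA_le _ (@cv0_half R)) => n; rewrite cnormC; case: (vP n) => /ltW ? /ltW.
have [n [n1 n2]] := near_ex (filterI (cv0_lt vx eps0) (cv0_lt vb eps0)).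
by exists (projT1 (v n)), (projT2 (v n)); split; rewrite cnormC.
Qed.

Lemma graph_stage s (y : Mx s) : graph (psi y) (g y).
Proof. by move=> eps eps0; exists s, y; rewrite !subrr !cnorm0. Qed.

Lemma graph_total x : exists b, graph x b.
Proof.
have [v Uv vx] := (clP _ _).1 (dense x).
have H n : exists p : {s : nat & Mx s}, v n = psi (projT2 p).
  by have [s [y ->]] := Uv n; exists (existT _ s y).
have [w wP] := boolp.choice H.
have wx : cvA (fun n => psi (projT2 (w n))) x by apply: cvA_ext vx.
have [b wb] : exists b, cvA (fun n => g (projT2 (w n))) b.
  apply: cvA_cauchy => eps eps0.
  have [N NP] := (cvAP _ _).1 wx (eps / 2) ltac:(lra).
  exists N => p q Np Nq.
  have [r [y [z [E1 E2 E3 E4]]]] := stage2 (projT2 (w p)) (projT2 (w q)).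
  case: hpsi hg => hp _ [hg' _].
  rewrite E3 E4 -(homB (hg' r)) cocone_norm (homB (hp r)) -E1 -E2.
  apply: le_lt_trans (cnorm_tri x _ _) _.
  by have := NP p Np; have := NP q Nq; rewrite (cnormC x); lra.
by exists b; apply/graphP; exists w.
Qed.

Lemma graph_fun x b b' : graph x b -> graph x b' -> b = b'.
Proof.
move=> xb xb'; apply/eqP; rewrite -subr_eq0; apply/eqP/cnorm0_eq0/le_anti.
rewrite cnorm_ge0 andbT; apply/ler_addgt0Pl => eps eps0; rewrite addr0.
have e4 : 0 < eps / 4 by lra.
have [s [y [xy by_]]] := xb _ e4; have [t [z [xz bz]]] := xb' _ e4.
have [r [y' [z' [E1 E2 E3 E4]]]] := stage2 y z.
have : cnorm (g y - g z) = cnorm (psi y - psi z).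
  case: hpsi hg => hp _ [hg' _].
  by rewrite E3 E4 -(homB (hg' r)) cocone_norm (homB (hp r)) -E1 -E2.
have := cnorm_tri x (psi y) (psi z); rewrite (cnormC (psi y) x).
have := cnorm_tri (g y) b b'; have := cnorm_tri (g z) (g y) b'.
rewrite (cnormC (g z) b'); lra.
Qed.

Lemma graph_lin (c : R[i]) x y b d : graph x b -> graph y d -> graph (c *: x + y) (c *: b + d).
Proof.
move=> /graphP [v [vx vb]] /graphP [w [wy wd]]; apply/graphP.
have H n : exists p : {s : nat & Mx s},
    psi (projT2 p) = c *: psi (projT2 (v n)) + psi (projT2 (w n)) /\
    g (projT2 p) = c *: g (projT2 (v n)) + g (projT2 (w n)).
  have [r [y' [z' [-> -> -> ->]]]] := stage2 (projT2 (v n)) (projT2 (w n)).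
  case: hpsi hg => hp _ [hg' _].
  by exists (existT _ r (c *: y' + z')); rewrite /= (homD (hp r)) (homZ (hp r)) (homD (hg' r)) (homZ (hg' r)).
have [u uP] := boolp.choice H; exists u; split.
  by apply: cvA_ext (cvA_add (cvA_scale c vx) wy) => n; case: (uP n) => ->.
by apply: cvA_ext (cvA_add (cvA_scale c vb) wd) => n; case: (uP n) => _ ->.
Qed.

Lemma graph_mul x y b d : graph x b -> graph y d -> graph (x * y) (b * d).
Proof.
move=> /graphP [v [vx vb]] /graphP [w [wy wd]]; apply/graphP.
have H n : exists p : {s : nat & Mx s},
    psi (projT2 p) = psi (projT2 (v n)) * psi (projT2 (w n)) /\
    g (projT2 p) = g (projT2 (v n)) * g (projT2 (w n)).
  have [r [y' [z' [-> -> -> ->]]]] := stage2 (projT2 (v n)) (projT2 (w n)).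
  case: hpsi hg => hp _ [hg' _].
  by exists (existT _ r (y' * z')); rewrite /= (homM (hp r)) (homM (hg' r)).
have [u uP] := boolp.choice H; exists u; split.
  by apply: cvA_ext (cvA_mul vx wy) => n; case: (uP n) => ->.
by apply: cvA_ext (cvA_mul vb wd) => n; case: (uP n) => _ ->.
Qed.

Lemma graph_star x b : graph x b -> graph (star x) (star b).
Proof.
move=> /graphP [v [vx vb]]; apply/graphP; case: hpsi hg => hp _ [hg' _].
exists (fun n => existT _ (projT1 (v n)) (star (projT2 (v n)))); split.
  by apply: cvA_ext (cvA_star vx) => n /=; rewrite (hom_star (hp _)).
by apply: cvA_ext (cvA_star vb) => n /=; rewrite (hom_star (hg' _)).
Qed.

(** Uniqueness comes from automatic continuity: two such maps agree on the dense union of the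
    stages. *)
Lemma mediating : exists! u : A -> B, unital_star_hom u /\ forall s (y : Mx s), u (psi y) = g y.
Proof.
have [u uP] := boolp.choice graph_total.
have uE x b : graph x b -> u x = b by exact: graph_fun.
have ug s (y : Mx s) : u (psi y) = g y by apply: uE; exact: graph_stage.
case: (hpsi) (hg) => hp _ [hg' _].
have hu : unital_star_hom u.
  split.
  - by move=> c x y; apply: uE; exact: graph_lin.
  - split; last by move=> x y; apply: uE; exact: graph_mul.
    by have := ug 0%N 1; rewrite (hom1 (hp 0%N)) (hom1 (hg' 0%N)).
  - by move=> x; apply: uE; exact: graph_star.
exists u; split => // w [hw wg]; apply/funext => x.
have [v Uv vx] := (clP _ _).1 (dense x).
apply: (cvA_unique (hom_cvA hu vx)); apply: cvA_ext (hom_cvA hw vx) => n.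
by have [s [y ->]] := Uv n; rewrite ug wg.
Qed.

End Mediating.

Lemma dense_cocone_UHF : (forall s, unital_star_hom (@bond s)) -> UHF A.
Proof.
move=> hb; exists m, bond, psi; split => //; split => // B g hg.
exact: mediating.
Qed.

End UniversalProperty.

(** * Local approximation by matrix algebras *)

Definition fe (f i j : nat) : nat := nthc f (pairn i j).
Definition cval (c l i j : nat) : nat := nthc c (pairn l (pairn i j)).
Definition rinv (n : nat) : nat := ratc 1 0 n.-1.
(** Let delta be the value, 2^-k / (1000 (d+1)^2). Then 1000 (d+1) delta <= 1, as the stability
    lemma requires, its error 500 (d+1) delta is half the value of [reps d k], and delta is below
    the product tolerance 2^-k / (d+1)^2 of a chain. *)
Definition rdelta (d k : nat) : nat := rinv (1000 * d.+1 * d.+1 * 2 ^ k).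
Definition reps (d k : nat) : nat := rinv (d.+1 * 2 ^ k).
Definition rhalf (k : nat) : nat := rinv (2 ^ k).
Definition bounded_coef (b c : nat) : bool :=
  (rle (p1 c) (ratc b 0 0) && rle (ratc 0 b 0) (p1 c)) &&
  (rle (p2 c) (ratc b 0 0) && rle (ratc 0 b 0) (p2 c)).

(* With B(q, r) standing for |q| < r, [valid] says that the elements coded by f(i, j), for
   i, j <= d, satisfy the relations of matrix units of size d + 1 up to 2^-k / (1000 (d+1)^2).
   In [extension] the system f' has size (d + 1)(m + 1), each f(i, j) is close to the image
   of e_ij (x) 1, and the first k + 1 special points are close to the combinations of f' with
   coefficients c; the bound b on these coefficients makes the defect of f' negligible in
   such combinations. *)
Section Conditions.
Variable B : nat -> nat -> Prop.

Definition valid (d k f : nat) : Prop :=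
  ((forall i, (i < d.+1)%N -> forall j, (j < d.+1)%N -> B (fe f i j) (ratc 2 0 0)) /\
   (forall i, (i < d.+1)%N -> forall j, (j < d.+1)%N ->
    forall u, (u < d.+1)%N -> forall v, (v < d.+1)%N ->
      B (csub (cmul (fe f i j) (fe f u v)) (if (j == u)%N then fe f i v else 0)) (rdelta d k))) /\
  ((forall i, (i < d.+1)%N -> forall j, (j < d.+1)%N ->
      B (csub (cstar (fe f i j)) (fe f j i)) (rdelta d k)) /\
   B (csub (csum d.+1 (fun i => fe f i i)) (cconst cfone)) (rdelta d k)).

Definition newdim (d m : nat) : nat := (m + d * m.+1)%N.

Definition extension (d k f m k' f' c b : nat) : Prop :=
  ((k < k')%N /\ valid (newdim d m) k' f') /\
  ((forall i, (i < d.+1)%N -> forall j, (j < d.+1)%N ->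
     B (csub (fe f i j) (csum m.+1 (fun a => fe f' (i * m.+1 + a) (j * m.+1 + a)))) (reps d k)) /\
   (forall l, (l < k.+1)%N ->
     B (csub (cletter l.*2) (csum (newdim d m).+1 (fun u => csum (newdim d m).+1 (fun v =>
          cmul (cconst (cval c l u v)) (fe f' u v))))) (rhalf k))) /\
  ((forall l, (l < k.+1)%N -> forall u, (u < (newdim d m).+1)%N ->
      forall v, (v < (newdim d m).+1)%N -> bounded_coef b (cval c l u v)) /\
   (2 * b * (newdim d m).+1 * 2 ^ k <= 2 ^ k')%N).

(** Asking for an infinite chain of systems would quantify over functions. Demanding an extension of
    every valid system quantifies over numbers only, with a single alternation, and choice recovers
    the chain from it. *)
Definition extendable : Prop := forall d k f, valid d k f ->
  exists m k' f' c b, extension d k f m k' f' c b.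
End Conditions.

Lemma newdimS d m : (newdim d m).+1 = (d.+1 * m.+1)%N.
Proof. by rewrite /newdim; lia. Qed.

Section Values.
Variable R : realType.

Definition rval (r : nat) : R := ratr (nrat r).

Lemma rval_inv n : (0 < n)%N -> rval (rinv n) = n%:R^-1.
Proof.
move=> n0; rewrite /rval /rinv nrat_ratc prednK // subr0 mul1r.
by rewrite fmorphV rmorph_nat.
Qed.

Lemma rval_nat n : rval (ratc n 0 0) = n%:R.
Proof. by rewrite /rval nrat_ratc subr0 divr1 rmorph_nat. Qed.

Lemma rval_natN n : rval (ratc 0 n 0) = - n%:R.
Proof. by rewrite /rval nrat_ratc sub0r divr1 rmorphN rmorph_nat. Qed.

Lemma rval_half k : rval (rhalf k) = 2^-1 ^+ k.
Proof. by rewrite rval_inv ?expn_gt0 // natrX exprVn. Qed.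

Lemma rval_eps d k : rval (reps d k) = 2^-1 ^+ k / d.+1%:R.
Proof. by rewrite rval_inv ?muln_gt0 ?expn_gt0 // natrM natrX invfM exprVn mulrC. Qed.

Lemma rval_delta d k : rval (rdelta d k) = 2^-1 ^+ k / (1000 * d.+1%:R * d.+1%:R).
Proof.
by rewrite rval_inv ?muln_gt0 ?expn_gt0 // 3!natrM natrX invfM exprVn mulrC.
Qed.

Lemma rval_lt m n : (rval m < rval n) = rlt m n.
Proof. by rewrite rltE ltr_rat. Qed.

Lemma rval_le m n : (rval m <= rval n) = rle m n.
Proof. by rewrite rleE ler_rat. Qed.

Lemma rval_between (x y : R) : x < y -> exists r, x < rval r < y.
Proof.
move=> xy; have [q] := rat_in_itvoo xy.
rewrite in_itv /= => qxy; have [r rE] := nrat_surj q.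
by exists r; rewrite /rval rE.
Qed.

Lemma ccoef_rval c : ccoef R c = (rval (p1 c) +i* rval (p2 c))%C.
Proof. exact: ccoefE. Qed.

Lemma normc_le_sum (x y : R) : Normc.normc (x +i* y)%C <= `|x| + `|y|.
Proof.
rewrite /Normc.normc -(ler_pXn2r (_ : 0 < 2)%N) ?nnegrE ?sqrtr_ge0 ?addr_ge0 //.
rewrite sqr_sqrtr ?addr_ge0 ?sqr_ge0 //.
rewrite -(real_normK (num_real x)) -(real_normK (num_real y)).
have := normr_ge0 x; have := normr_ge0 y; nra.
Qed.

Lemma normc_ge_re (x y : R) : `|x| <= Normc.normc (x +i* y)%C.
Proof.
by rewrite /Normc.normc -sqrtr_sqr ler_sqrt ?addr_ge0 ?sqr_ge0 // lerDl sqr_ge0.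
Qed.

Lemma normc_ge_im (x y : R) : `|y| <= Normc.normc (x +i* y)%C.
Proof.
by rewrite /Normc.normc -sqrtr_sqr ler_sqrt ?addr_ge0 ?sqr_ge0 // lerDr sqr_ge0.
Qed.

Lemma bounded_coefP b c : bounded_coef b c -> Normc.normc (ccoef R c) <= 2 * b%:R.
Proof.
rewrite /bounded_coef -!rval_le !rval_nat !rval_natN => /andP [/andP [h1 h2] /andP [h3 h4]].
rewrite ccoef_rval; apply: le_trans (normc_le_sum _ _) _.
have : `|rval (p1 c)| <= b%:R by rewrite ler_norml h1 h2.
have : `|rval (p2 c)| <= b%:R by rewrite ler_norml h3 h4.
by lra.
Qed.

Lemma bounded_coef_norm b c : Normc.normc (ccoef R c) <= b%:R -> bounded_coef b c.
Proof.
rewrite ccoef_rval => H.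
have := le_trans (normc_ge_re _ _) H; have := le_trans (normc_ge_im _ _) H.
rewrite /bounded_coef -!rval_le !rval_nat !rval_natN !ler_norml.
by move=> /andP [-> ->] /andP [-> ->].
Qed.

Lemma approx_coef (z : R[i]) (eps : R) : 0 < eps -> exists c, Normc.normc (ccoef R c - z) < eps.
Proof.
case: z => x y eps0.
have [r r1] : exists r, x < rval r < x + eps / 2 by apply: rval_between; lra.
have [s s1] : exists s, y < rval s < y + eps / 2 by apply: rval_between; lra.
exists (pairn r s); rewrite ccoef_rval !pairnE.
apply: le_lt_trans (normc_le_sum _ _) _.
move: r1 s1 => /andP [? ?] /andP [? ?].
by rewrite !ger0_norm; lra.
Qed.

End Values.

Section Density.
Variables (R : realType) (A : cstarAlgType R) (a : nat -> A).
Notation gp := (generated_point a).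

Definition generated (x : A) : Prop := exists q, x = gp q.

Lemma gp_special l : gp (cletter l.*2) = a l.
Proof. by rewrite gp_letter /lval /eval_letter /= odd_double doubleK. Qed.

Lemma gp_dense : is_presentation a -> forall x, cl generated x.
Proof.
move=> pres.
have sub y : in_star_subalgebra a y -> cl generated y.
  elim=> {y} [n||x y _ Hx _ Hy|c x _ Hx|x y _ Hx _ Hy|x _ Hx].
  - by apply: cl_in; exists (cletter n.*2); rewrite gp_special.
  - by apply: cl_in; exists (cconst cfone); rewrite gp_const ccoef_one scale1r.
  - by apply: cl_add => // u v [p ->] [q ->]; exists (cadd p q); rewrite gp_add.
  - have [v Uv vx] := (clP _ _).1 Hx.
    have H n : exists d, Normc.normc (ccoef R d - c) < 2^-1 ^+ n.
      by apply: approx_coef; apply: exprn_gt0; lra.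
    have [d dP] := boolp.choice H.
    have dc : cvA (fun n => ccoef R (d n) *: (1 : A)) (c *: 1).
      apply: (cvA_le _ (@cv0_half R)) => n.
      by rewrite -scalerBl cnormZ cnorm1 mulr1 ltW.
    apply/clP; exists (fun n => ccoef R (d n) *: 1 * v n) => [n|].
      have [q ->] := Uv n; exists (cmul (cconst (d n)) q).
      by rewrite gp_mul gp_const.
    by rewrite -[c *: x](mul1r) -scalerAr scalerAl; exact: cvA_mul.
  - by apply: cl_mul => // u v [p ->] [q ->]; exists (cmul p q); rewrite gp_mul.
  - by apply: cl_star => // u [p ->]; exists (cstar p); rewrite gp_star.
move=> x; apply: cl_cl => eps eps0.
by have [y Sy xy] := pres x eps eps0; exists y => //; exact: sub.
Qed.

End Density.

(** * Extendability implies UHF *)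

Section ExtendableUHF.
Variables (R : realType) (A : cstarAlgType R) (a : nat -> A) (B : nat -> nat -> Prop).
Notation gp := (generated_point a).
Hypothesis BN : forall q r, B q r <-> cnorm (gp q) < rval R r.
Hypothesis pres : is_presentation a.
Hypothesis ext : extendable B.

Let G (f i j : nat) : A := gp (fe f i j).

Lemma delta_tol d k : rval R (rdelta d k) <= 2^-1 ^+ k / (d.+1%:R * d.+1%:R).
Proof.
rewrite rval_delta; apply: ler_wpM2l; first by apply: exprn_ge0; lra.
have d0 : 0 < d.+1%:R * d.+1%:R :> R by rewrite mulr_gt0 ?ltr0n.
rewrite -mulrA lef_pV2 ?posrE //; last by rewrite mulr_gt0 // ltr0n.
by rewrite ler_peMl ?ler1n // ltW.
Qed.

(** The chain starts from the system of size one consisting of the unit. *)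
Lemma start_valid : exists f, valid B 0 0 f.
Proof.
have [f0 E] : exists f0, fe f0 0 0 = cconst cfone.
  by exists (enc (mkseq (fun=> cconst cfone) 1)); rewrite /fe nthc_mkseq.
exists f0.
have g1 : gp (cconst cfone) = 1 by rewrite gp_const ccoef_one scale1r.
have d0 : 0 < rval R (rdelta 0 0) by rewrite rval_delta mulr_gt0 ?exprn_gt0 ?invr_gt0 //; lra.
do 2!split.
- move=> i; rewrite ltnS leqn0 => /eqP -> j; rewrite ltnS leqn0 => /eqP ->.
  by rewrite E; apply/BN; rewrite g1 cnorm1 rval_nat ltr1n.
- move=> i; rewrite ltnS leqn0 => /eqP -> j; rewrite ltnS leqn0 => /eqP ->.
  move=> u; rewrite ltnS leqn0 => /eqP -> v; rewrite ltnS leqn0 => /eqP ->.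
  by rewrite eqxx E; apply/BN; rewrite gp_sub gp_mul g1 mulr1 subrr cnorm0.
- move=> i; rewrite ltnS leqn0 => /eqP -> j; rewrite ltnS leqn0 => /eqP ->.
  by rewrite E; apply/BN; rewrite gp_sub gp_star g1 star1 subrr cnorm0.
- by apply/BN; rewrite gp_sub gp_sum big_ord1 E g1 subrr cnorm0.
Qed.

Theorem extendable_UHF : UHF A.
Proof.
pose St := (nat * nat * nat)%type.
pose V (s : St) := valid B s.1.1 s.1.2 s.2.
(* Choice needs a successor for every state; the zero tuple serves the invalid ones, which the chain
   never meets. *)
have H (s : St) : exists x : nat * nat * nat * nat * nat, V s ->
    extension B s.1.1 s.1.2 s.2 x.1.1.1.1 x.1.1.1.2 x.1.1.2 x.1.2 x.2.
  have [Vs|nV] := pselect (V s); last by exists (0, 0, 0, 0, 0)%N.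
  by have [m [k' [f' [c [b E]]]]] := ext Vs; exists (m, k', f', c, b).
have [nxt nxtP] := boolp.choice H.
have [f0 Vf0] := start_valid.
pose st := fix st n : St := if n is n'.+1 then
   (newdim (st n').1.1 (nxt (st n')).1.1.1.1, (nxt (st n')).1.1.1.2, (nxt (st n')).1.1.2)
   else (0, 0, f0)%N.
have Vst n : V (st n).
  by elim: n => [//|n IH]; have [[_ ?] _] := nxtP _ IH.
have Est n := nxtP _ (Vst n).
pose D n := (st n).1.1; pose k n := (st n).1.2; pose m n := (nxt (st n)).1.1.1.1.
pose f n := G (st n).2.
have DD s : (D s.+1).+1 = ((D s).+1 * (m s).+1)%N by exact: newdimS.
have kk s : (k s < k s.+1)%N by case: (Est s) => -[].
have dt s x : x < rval R (rdelta (D s) (k s)) -> x <= 2^-1 ^+ k s / ((D s).+1%:R * (D s).+1%:R).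
  by move=> xd; apply: le_trans (ltW xd) _; exact: delta_tol.
have fM s i j u v : (i <= D s)%N -> (j <= D s)%N -> (u <= D s)%N -> (v <= D s)%N ->
    cnorm (f s i j * f s u v - (if j == u then f s i v else 0)) <= 2^-1 ^+ k s / ((D s).+1%:R * (D s).+1%:R).
  move=> iD jD uD vD; apply: dt; case: (Vst s) => -[_ /(_ i iD j jD u uD v vD) /BN].
  by rewrite gp_sub gp_mul; case: (j == u); rewrite ?gp0.
have fS s i j : (i <= D s)%N -> (j <= D s)%N ->
    cnorm (star (f s i j) - f s j i) <= 2^-1 ^+ k s / ((D s).+1%:R * (D s).+1%:R).
  move=> iD jD; apply: dt; case: (Vst s) => _ [/(_ i iD j jD) /BN].
  by rewrite gp_sub gp_star.
have f1 s : cnorm (\sum_(i < (D s).+1) f s i i - 1) <= 2^-1 ^+ k s / ((D s).+1%:R * (D s).+1%:R).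
  apply: dt; case: (Vst s) => _ [_ /BN].
  by rewrite gp_sub gp_sum gp_const ccoef_one scale1r.
have ff s i j : (i <= D s)%N -> (j <= D s)%N ->
    cnorm (f s i j - \sum_(a < (m s).+1) f s.+1 (i * (m s).+1 + a)%N (j * (m s).+1 + a)%N)
    <= 2^-1 ^+ k s / (D s).+1%:R.
  move=> iD jD; rewrite -rval_eps; apply: ltW.
  case: (Est s) => _ [[/(_ i iD j jD) /BN]].
  by rewrite gp_sub gp_sum.
have [psi [hpsi psib psiN]] := chain_limit DD kk fM fS f1 ff.
have hb s : unital_star_hom (@cbond R D m s) by exact: cbond_hom DD s.
have coc : is_cocone (D := fun s => 'M[R[i]]_((D s).+1)) (@cbond R D m) psi by split.
apply: (dense_cocone_UHF coc) => // x.
have kn n : (n <= k n)%N.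
  by elim: n => // n IH; apply: leq_ltn_trans IH (kk n).
have Xl l : cl (in_stage (D := fun s => 'M[R[i]]_((D s).+1)) psi) (a l).
  move=> eps eps0.
  (* One 2^-n pays for the combination of approximate units that is close to [a l], two more for
     replacing these units by the exact ones of stage n + 1. *)
  have [n [ln n_eps]] : exists n, (l <= n)%N /\ 3 * 2^-1 ^+ n < eps.
    apply: near_ex; apply: filterI; first exact: near_ge.
    exact: cv0_lt (cv0Ml 3 (@cv0_half R)) eps0.
  case: (Est n) => _ [[_ /(_ l) Hl] [Hb Hk]].
  have lk : (l < (k n).+1)%N by rewrite ltnS; apply: leq_trans ln (kn n).
  set c := (nxt (st n)).1.2 in Hl Hb; set b := (nxt (st n)).2 in Hb Hk.
  pose y : 'M[R[i]]_((D n.+1).+1) := \matrix_(u, v) ccoef R (cval c l u v).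
  exists (psi n.+1 y); first by exists n.+1, y.
  have h0 : 0 < 2^-1 :> R by lra.
  have kle : 2^-1 ^+ k n <= 2^-1 ^+ n :> R by apply: ler_wiXn2l => //; lra.
  have d1 : cnorm (a l - cphi f y) < 2^-1 ^+ n.
    apply: lt_le_trans kle; rewrite -rval_half; move: (Hl lk) => /BN.
    rewrite gp_sub gp_special gp_sum; congr (cnorm (_ - _) < _).
    apply: eq_bigr => u _; rewrite gp_sum; apply: eq_bigr => v _.
    by rewrite gp_mul gp_const -scalerAl mul1r mxE.
  have d2 : cnorm (cphi f y - psi n.+1 y) <= 2 * 2^-1 ^+ n.
    apply: le_trans (psiN _ _) _; rewrite ler_pM2l //; apply: le_trans kle.
    (* Coefficients of modulus at most 2b give tau(y) <= 2bD, with D the size of the system. The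
       condition on k' in [extension] was made for this: it brings 2^-k' tau(y) below 2^-k. *)
    have sy : sumnorm y <= (D n.+1).+1%:R * ((D n.+1).+1%:R * (2 * b%:R)).
      rewrite /sumnorm -[X in _ <= X%:R * _]card_ord mulr_natl -sumr_const; apply: ler_sum => u _.
      rewrite -[X in _ <= X%:R * _]card_ord mulr_natl -sumr_const; apply: ler_sum => v _.
      by rewrite mxE; apply: bounded_coefP; apply: Hb.
    have ty : tau y <= (D n.+1).+1%:R * (2 * b%:R).
      by rewrite /tau ler_pdivrMr ?ltr0n // mulrC.
    apply: le_trans (ler_wpM2l (exprn_ge0 _ (ltW h0)) ty) _.
    rewrite !exprVn mulrC ler_pdivrMr ?exprn_gt0 // ler_pdivlMl ?exprn_gt0 //.
    rewrite mulrC -!natrX -!natrM ler_nat.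
    by apply: leq_trans Hk; rewrite -/(D n.+1) -/(k n); apply: eq_leq; rewrite [((D n.+1).+1 * _)%N]mulnC.
  apply: le_lt_trans (cnorm_tri (cphi f y) _ _) _; lra.
apply: cl_cl => eps eps0; have [y Sy xy] := pres x eps0; exists y => //.
elim: Sy => {xy y x} [n||x y _ Hx _ Hy|c x _ Hx|x y _ Hx _ Hy|x _ Hx].
- exact: Xl.
- by apply: cl_in; exact: in_stage_one coc.
- exact: cl_add (in_stageD coc) Hx Hy.
- by apply: cl_scale Hx => u; exact: in_stageZ coc c u.
- exact: cl_mul (in_stageM coc) Hx Hy.
- by apply: cl_star Hx => u; exact: in_stage_star coc u.
Qed.

End ExtendableUHF.

Lemma code_fun2 (g : nat -> nat -> nat) K :
  exists f, forall i j, (i < K)%N -> (j < K)%N -> fe f i j = g i j.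
Proof.
pose N := (\max_(i < K) \max_(j < K) pairn i j).+1.
exists (enc (mkseq (fun x => g (p1 x) (p2 x)) N)) => i j iK jK.
rewrite /fe nthc_mkseq ?pairnE // ltnS.
apply: leq_trans (leq_bigmax (F := fun i : 'I_K => \max_(j < K) pairn i j) (Ordinal iK)).
exact: (leq_bigmax (F := fun j : 'I_K => pairn i j) (Ordinal jK)).
Qed.

Lemma code_fun3 (g : nat -> nat -> nat -> nat) L K :
  exists c, forall l i j, (l < L)%N -> (i < K)%N -> (j < K)%N -> cval c l i j = g l i j.
Proof.
pose N := (\max_(l < L) \max_(i < K) \max_(j < K) pairn l (pairn i j)).+1.
exists (enc (mkseq (fun x => g (p1 x) (p1 (p2 x)) (p2 (p2 x))) N)) => l i j lL iK jK.
rewrite /cval nthc_mkseq ?pairnE // ltnS.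
apply: leq_trans (leq_bigmax (F := fun l : 'I_L => \max_(i < K) \max_(j < K) pairn l (pairn i j)) (Ordinal lL)).
apply: leq_trans (leq_bigmax (F := fun i : 'I_K => \max_(j < K) pairn l (pairn i j)) (Ordinal iK)).
exact: (leq_bigmax (F := fun j : 'I_K => pairn l (pairn i j)) (Ordinal jK)).
Qed.

Section PairIndex.
Variables d r : nat.

Definition ix (u : nat) : 'I_d.+1 * 'I_r.+1 := (inord (u %/ r.+1), inord (u %% r.+1)).

Lemma ixE (i : 'I_d.+1) (b : 'I_r.+1) : ix (i * r.+1 + b) = (i, b).
Proof. by rewrite /ix bond_div bond_mod inord_val. Qed.

Lemma ix_eq u v : (u < (newdim d r).+1)%N -> (v < (newdim d r).+1)%N -> (ix u == ix v) = (u == v).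
Proof.
rewrite newdimS => uD vD; apply/eqP/eqP => [[]|-> //].
move=> /(congr1 val) /=; rewrite !inordK ?ltn_divLR // => du.
move=> /(congr1 val) /=; rewrite !inordK ?ltn_mod // => mu.
by rewrite (divn_eq u r.+1) du mu -divn_eq.
Qed.

Lemma sum_ix (V : nmodType) (F : 'I_d.+1 * 'I_r.+1 -> V) :
  \sum_(u < (newdim d r).+1) F (ix u) = \sum_b F b.
Proof.
rewrite newdimS (sum_mul_ord _ _ (fun u => F (ix u))).
rewrite [RHS](eq_bigr (fun b => F (b.1, b.2))); last by case.
rewrite -(pair_bigA _ (fun i b => F (i, b))) /=.
by apply: eq_bigr => i _; apply: eq_bigr => b _; rewrite ixE.
Qed.

End PairIndex.

(** * UHF implies extendability *)

Section UHFExtendable.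
Variables (R : realType) (A : cstarAlgType R) (a : nat -> A) (B : nat -> nat -> Prop).
Notation gp := (generated_point a).
Hypothesis BN : forall q r, B q r <-> cnorm (gp q) < rval R r.
Hypothesis pres : is_presentation a.
Hypothesis uhf : UHF A.

Lemma near_forall (I : finType) (P : I -> nat -> Prop) :
  (forall i, \forall n \near \oo, P i n) -> \forall n \near \oo, forall i, P i n.
Proof. by move=> H; apply: filter_forall. Qed.

(* By density the approximate units move into a stage, where [near_matrix_units] applies. *)
Lemma exact_matrix_units d k f : valid B d k f -> exists r
    (e : nat -> nat -> A) (c : nat -> nat -> nat -> R[i]),
  let D := (newdim d r).+1 in
  [/\ forall i j u v, (i < D)%N -> (j < D)%N -> (u < D)%N -> (v < D)%N ->
        e i j * e u v = if j == u then e i v else 0,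
      forall i j, star (e i j) = e j i,
      \sum_(i < D) e i i = 1,
      forall i j, (i < d.+1)%N -> (j < d.+1)%N ->
        cnorm (gp (fe f i j) - \sum_(b < r.+1) e (i * r.+1 + b)%N (j * r.+1 + b)%N) < rval R (reps d k) &
      forall l, (l < k.+1)%N ->
        cnorm (a l - \sum_(u < D) \sum_(v < D) c l u v *: e u v) < rval R (rhalf k)].
Proof.
case: uhf => m [bond [i [hb [coc lim]]]] [[V1 V2] [V3 V4]].
have dense := limit_dense coc (conj coc lim).
pose I := ('I_d.+1 * 'I_d.+1 + 'I_k.+1)%type.
pose z (j : I) : A := match j with inl p => gp (fe f p.1 p.2) | inr l => a l end.
have H j : exists v, (forall n, in_stage (D := fun s => 'M[R[i]]_((m s).+1)) i (v n)) /\ cvA v (z j).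
  by have [v Uv vz] := (clP _ _).1 (dense (z j)); exists v.
have [w wP] := boolp.choice H.
have wz j : cvA (w j) (z j) := (wP j).2.
have lt_ord n (p : 'I_n) : (p < n)%N by [].
have eps0 : 0 < rval R (reps d k) by rewrite rval_eps divr_gt0 ?exprn_gt0 ?ltr0n //; lra.
have half0 : 0 < rval R (rhalf k) by rewrite rval_half exprn_gt0 //; lra.
have [n [[[N1 N2] [N3 N4]] [N5 N6]]] : exists n,
   (((forall p : 'I_d.+1 * 'I_d.+1, cnorm (w (inl p) n) < 2) /\
     (forall p : ('I_d.+1 * 'I_d.+1) * ('I_d.+1 * 'I_d.+1),
        cnorm (w (inl (p.1.1, p.1.2)) n * w (inl (p.2.1, p.2.2)) n -
           if p.1.2 == p.2.1 then w (inl (p.1.1, p.2.2)) n else 0) < rval R (rdelta d k))) /\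
    ((forall p : 'I_d.+1 * 'I_d.+1, cnorm (star (w (inl (p.1, p.2)) n) - w (inl (p.2, p.1)) n) < rval R (rdelta d k)) /\
     cnorm (\sum_(p < d.+1) w (inl (p, p)) n - 1) < rval R (rdelta d k))) /\
   ((forall p : 'I_d.+1 * 'I_d.+1, cnorm (w (inl p) n - z (inl p)) < rval R (reps d k) / 4) /\
    (forall l : 'I_k.+1, cnorm (w (inr l) n - z (inr l)) < rval R (rhalf k))).
  apply: near_ex; apply: filterI; apply: filterI; try apply: filterI.
  - apply: near_forall => p; apply: cvA_norm_lt (wz (inl p)) _.
    by rewrite -(rval_nat R); apply/BN/V1.
  - apply: near_forall => p.
    apply: (@cvA_norm_lt _ _ (fun n => w (inl (p.1.1, p.1.2)) n * w (inl (p.2.1, p.2.2)) n -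
       if p.1.2 == p.2.1 then w (inl (p.1.1, p.2.2)) n else 0)
       (z (inl (p.1.1, p.1.2)) * z (inl (p.2.1, p.2.2)) - if p.1.2 == p.2.1 then z (inl (p.1.1, p.2.2)) else 0)).
      apply: cvA_sub; first by apply: cvA_mul.
      by case: eqP => // _; exact: cvA_cst.
    move: (V2 _ (lt_ord _ p.1.1) _ (lt_ord _ p.1.2) _ (lt_ord _ p.2.1) _ (lt_ord _ p.2.2)) => /BN.
    by rewrite gp_sub gp_mul -[(p.1.2 == p.2.1 :> nat)]/(p.1.2 == p.2.1); case: eqP; rewrite ?gp0.
  - apply: near_forall => p.
    apply: cvA_norm_lt (cvA_sub (cvA_star (wz (inl (p.1, p.2)))) (wz (inl (p.2, p.1)))) _.
    by move: (V3 _ (lt_ord _ p.1) _ (lt_ord _ p.2)) => /BN; rewrite gp_sub gp_star.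
  - apply: cvA_norm_lt (cvA_sub (cvA_sum _ (fun p : 'I_d.+1 => wz (inl (p, p)))) (cvA_cst 1)) _.
    by move: V4 => /BN; rewrite gp_sub gp_sum gp_const ccoef_one scale1r.
  - by apply: near_forall => p; apply: cv0_lt (wz (inl p)) _; lra.
  - by apply: near_forall => l; apply: cv0_lt (wz (inr l)) half0.
have Hs : forall j, in_stage (D := fun s => 'M[R[i]]_((m s).+1)) i (w j n) by move=> j; exact: (wP j).1.
have [s [y yP]] := stage_common coc Hs.
have hs : unital_star_hom (i s) by case: coc => H0 _; exact: H0.
pose F (p q : 'I_d.+1) : 'M[R[i]]_((m s).+1) := y (inl (p, q)).
have E1 p q : cnorm (i s (F p q)) <= 2 by rewrite -yP ltW.
have E2 p q u v : cnorm (i s (F p q * F u v - if q == u then F p v else 0)) <= rval R (rdelta d k).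
  rewrite (homB hs) (homM hs) -!yP; have := ltW (N2 ((p, q), (u, v))).
  by rewrite /=; case: eqP => _; rewrite ?(hom0 hs) ?yP.
have E3 p q : cnorm (i s (star (F p q) - F q p)) <= rval R (rdelta d k).
  by rewrite (homB hs) (hom_star hs) -!yP; exact: ltW (N3 (p, q)).
have E4 : cnorm (i s (\sum_p F p p - 1)) <= rval R (rdelta d k).
  rewrite (homB hs) (hom1 hs) (hom_sum hs); apply: ltW; apply: le_lt_trans N4.
  by rewrite le_eqVlt; apply/orP; left; apply/eqP; congr (cnorm (_ - _)); apply: eq_bigr => p _; rewrite yP.
have d1 : 1 <= d.+1%:R :> R by rewrite ler1n.
have half1 : 2^-1 ^+ k <= 1 :> R by apply: exprn_ile1; lra.
have d0 : d.+1%:R != 0 :> R by rewrite pnatr_eq0.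
have small : 1000 * d.+1%:R * rval R (rdelta d k) <= 1.
  rewrite rval_delta.
  have -> : 1000 * d.+1%:R * (2^-1 ^+ k / (1000 * d.+1%:R * d.+1%:R)) = 2^-1 ^+ k / d.+1%:R :> R.
    by move: (2^-1 ^+ k) (d.+1%:R) d0 => u v v0; field.
  by rewrite ler_pdivrMr ?mul1r; lra.
have [r [E [EM ES E1' Espan EF]]] := near_matrix_units hs E1 E2 E3 E4 small.
(* Multiplicity zero would leave an empty sum equal to 1; from here on the multiplicity is r + 1. *)
case: r E EM ES E1' Espan EF => [|r] E EM ES E1' Espan EF.
  have := oner_neq0 ('M[R[i]]_((m s).+1) : nzRingType); rewrite -E1' big1 ?eqxx //.
  by move=> [? []].
pose e u v := i s (E (ix d r u) (ix d r v)).
have [c cP] := boolp.choice (fun l : 'I_k.+1 => Espan (y (inr l))).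
exists r, e, (fun l u v => c (inord l) (ix d r u) (ix d r v)); split.
- move=> p q u v pD qD uD vD; rewrite /e -(homM hs) EM ix_eq //.
  by case: eqP => // _; rewrite (hom0 hs).
- by move=> p q; rewrite /e -(hom_star hs) ES.
- by rewrite -(hom1 hs) -E1' (hom_sum hs) -(sum_ix (fun b => i s (E b b))).
- move=> p q pD qD.
  have -> : \sum_(b < r.+1) e (p * r.+1 + b)%N (q * r.+1 + b)%N =
      i s (\sum_b E (Ordinal pD, b) (Ordinal qD, b)).
    rewrite (hom_sum hs); apply: eq_bigr => b _.
    by rewrite /e (ixE (Ordinal pD)) (ixE (Ordinal qD)).
  apply: le_lt_trans (cnorm_tri (i s (F (Ordinal pD) (Ordinal qD))) _ _) _.
  have := N5 (Ordinal pD, Ordinal qD); rewrite yP cnormC /= => Hz.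
  have := EF (Ordinal pD) (Ordinal qD); rewrite (homB hs).
  (* Half of the tolerance goes to the exact units and a quarter to the move into the stage
     ([N5]). *)
  have -> : 500 * d.+1%:R * rval R (rdelta d k) = rval R (reps d k) / 2.
    by rewrite rval_delta rval_eps; move: (2^-1 ^+ k) (d.+1%:R) d0 => u v v0; field.
  by move: Hz; rewrite /F; lra.
- move=> l lk.
  have -> : \sum_(u < (newdim d r).+1) \sum_(v < (newdim d r).+1)
      c (inord l) (ix d r u) (ix d r v) *: e u v = i s (y (inr (inord l))).
    rewrite [in RHS]cP (hom_sum hs) -(sum_ix (fun u => i s (\sum_b c (inord l) u b *: E u b))).
    apply: eq_bigr => u _; rewrite (hom_sum hs).
    rewrite -(sum_ix (fun v => i s (c (inord l) _ v *: E _ v))).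
    by apply: eq_bigr => v _; rewrite (homZ hs).
  by have := N6 (inord l); rewrite yP cnormC /= inordK.
Qed.

Lemma projection_norm_le (x : A) : star x = x -> x * x = x -> cnorm x <= 1.
Proof.
by move=> xs xx; have := cnorm_star x; rewrite xs xx; have := cnorm_ge0 x; nra.
Qed.

(** The exact units and coefficients are limits of generated points and of rational coefficients,
    and all norm conditions are strict, so they hold far enough along the sequences. The order of
    choices matters: b bounds the approximating coefficients for all n, k' depends on b, and n is
    chosen last, for the tolerance at k'. *)
Theorem UHF_extendable : extendable B.
Proof.
move=> d k f Vf; have [r [e [c []]]] := exact_matrix_units Vf.
set D := (newdim d r).+1 => eM eS e1 ef ec.
(* Exact units have norm at most 1, which leaves room below the bound 2 demanded of their
   approximations. *)
have e_norm u v : (u < D)%N -> (v < D)%N -> cnorm (e u v) < 2.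
  move=> uD vD; have vv : cnorm (e v v) <= 1.
    by apply: projection_norm_le; rewrite ?eS ?eM // eqxx.
  have := cnorm_star (e u v); rewrite eS eM // eqxx.
  by have := cnorm_ge0 (e u v); nra.
have Hq p : exists v, (forall n, generated a (v n)) /\ cvA v (e p.1 p.2).
  by have [v ? ?] := (clP _ _).1 (gp_dense pres (e p.1 p.2)); exists v.
have [w wP] := boolp.choice Hq.
have Hg pn : exists q, w pn.1 pn.2 = gp q by exact: (wP pn.1).1.
have [g0 g0P] := boolp.choice Hg.
pose g u v n := g0 ((u, v), n).
have ge u v : cvA (fun n => gp (g u v n)) (e u v).
  by apply: cvA_ext (wP (u, v)).2 => n; rewrite (g0P ((u, v), n)).
have Hc x : exists z, Normc.normc (ccoef R z - c x.1.1.1 x.1.1.2 x.1.2) < 2^-1 ^+ x.2.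
  by apply: approx_coef; apply: exprn_gt0; lra.
have [h0 h0P] := boolp.choice Hc.
pose h l u v n := h0 (l, u, v, n).
have hc l u v n : Normc.normc (ccoef R (h l u v n) - c l u v) < 2^-1 ^+ n := h0P (l, u, v, n).
have [b bP] : exists b : nat, forall l u v n, (l < k.+1)%N -> (u < D)%N -> (v < D)%N ->
    bounded_coef b (h l u v n).
  pose S := \sum_(l < k.+1) \sum_(u < D) \sum_(v < D) Normc.normc (c l u v).
  have S0 : 0 <= S by do 3![apply: sumr_ge0 => ? _]; exact: normc_ge0.
  (* Each approximant is within 1 of its coefficient, and S dominates the moduli of all
     coefficients. *)
  exists (Num.bound (S + 1)) => l u v n lk uD vD.
  apply: (@bounded_coef_norm R); apply: ltW.
  apply: le_lt_trans (_ : S + 1 < _); last by apply: archi_boundP; lra.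
  have cS : Normc.normc (c l u v) <= S.
    rewrite /S (bigD1 (Ordinal lk)) //= (bigD1 (Ordinal uD)) //= (bigD1 (Ordinal vD)) //=.
    rewrite -!addrA lerDl !addr_ge0 //; do ?[apply: sumr_ge0 => ? _]; exact: normc_ge0.
  have := hc l u v n; have : 2^-1 ^+ n <= 1 :> R by apply: exprn_ile1; lra.
  have := le_normcD (ccoef R (h l u v n) - c l u v) (c l u v); rewrite subrK.
  lra.
(* The summand 2bD is absorbed by x <= 2^x, and k + 1 makes k' larger than k. *)
pose k' := (2 * b * D + k.+1)%N.
have dl0 : 0 < rval R (rdelta (newdim d r) k').
  rewrite rval_delta divr_gt0 ?exprn_gt0 //; first lra.
  by rewrite !mulr_gt0 // ?ltr0n.
have [n [[[N1 N2] [N3 N4]] [N5 N6]]] : exists n,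
   (((forall p : 'I_D * 'I_D, cnorm (gp (g p.1 p.2 n)) < 2) /\
     (forall p : ('I_D * 'I_D) * ('I_D * 'I_D),
        cnorm (gp (g p.1.1 p.1.2 n) * gp (g p.2.1 p.2.2 n) -
           (if p.1.2 == p.2.1 :> nat then gp (g p.1.1 p.2.2 n) else 0)) < rval R (rdelta (newdim d r) k'))) /\
    ((forall p : 'I_D * 'I_D, cnorm (star (gp (g p.1 p.2 n)) - gp (g p.2 p.1 n)) < rval R (rdelta (newdim d r) k')) /\
     cnorm (\sum_(p < D) gp (g p p n) - 1) < rval R (rdelta (newdim d r) k'))) /\
   ((forall p : 'I_d.+1 * 'I_d.+1, cnorm (gp (fe f p.1 p.2) -
        \sum_(x < r.+1) gp (g (p.1 * r.+1 + x)%N (p.2 * r.+1 + x)%N n)) < rval R (reps d k)) /\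
    (forall l : 'I_k.+1, cnorm (a l -
        \sum_(u < D) \sum_(v < D) ccoef R (h l u v n) *: gp (g u v n)) < rval R (rhalf k))).
  apply: near_ex; apply: filterI; apply: filterI; try apply: filterI.
  - by apply: near_forall => p; apply: cvA_norm_lt (ge p.1 p.2) _; exact: e_norm.
  - apply: near_forall => p.
    apply: (@cvA_norm_lt _ _ _ (e p.1.1 p.1.2 * e p.2.1 p.2.2 - if p.1.2 == p.2.1 :> nat then e p.1.1 p.2.2 else 0)).
      apply: cvA_sub; first exact: cvA_mul.
      by case: eqP => // _; exact: cvA_cst.
    by rewrite eM // subrr cnorm0.
  - apply: near_forall => p.
    apply: cvA_norm_lt (cvA_sub (cvA_star (ge p.1 p.2)) (ge p.2 p.1)) _.
    by rewrite eS subrr cnorm0.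
  - apply: cvA_norm_lt (cvA_sub (cvA_sum _ (fun p : 'I_D => ge p p)) (cvA_cst 1)) _.
    by rewrite e1 subrr cnorm0.
  - apply: near_forall => p.
    apply: cvA_norm_lt (cvA_sub (cvA_cst _) (cvA_sum _ (fun x : 'I_r.+1 => ge (p.1 * r.+1 + x)%N (p.2 * r.+1 + x)%N))) _.
    exact: ef.
  - apply: near_forall => l.
    have hcv u v : cvA (fun n => ccoef R (h l u v n) *: (1 : A)) (c l u v *: 1).
      apply: (cvA_le _ (@cv0_half R)) => n.
      by rewrite -scalerBl cnormZ cnorm1 mulr1 ltW.
    have hg u v : cvA (fun n => ccoef R (h l u v n) *: gp (g u v n)) (c l u v *: e u v).
      have := cvA_mul (hcv u v) (ge u v); rewrite -scalerAl mul1r; apply: cvA_ext => n.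
      by rewrite -scalerAl mul1r.
    apply: cvA_norm_lt (cvA_sub (cvA_cst _) (cvA_sum _ (fun u : 'I_D => cvA_sum _ (fun v : 'I_D => hg u v)))) _.
    exact: ec.
have [f' f'P] := code_fun2 (fun u v => g u v n) D.
have [cc ccP] := code_fun3 (fun l u v => h l u v n) k.+1 D.
exists r, k', f', cc, b; split; [split|split; split]; rewrite -/D.
- by rewrite /k' leq_addl.
- split; split; rewrite -/D.
  + by move=> u uD v vD; rewrite f'P //; apply/BN; rewrite rval_nat; exact: (N1 (Ordinal uD, Ordinal vD)).
  + move=> u uD v vD x xD t tD; rewrite !f'P //; apply/BN; rewrite gp_sub gp_mul.
    have := N2 ((Ordinal uD, Ordinal vD), (Ordinal xD, Ordinal tD)) => /=.
    by case: eqP; rewrite ?gp0.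
  + move=> u uD v vD; rewrite !f'P //; apply/BN; rewrite gp_sub gp_star.
    exact: (N3 (Ordinal uD, Ordinal vD)).
  + apply/BN; rewrite gp_sub gp_sum gp_const ccoef_one scale1r.
    by under eq_bigr => p _ do rewrite f'P //.
- move=> p pD q qD; apply/BN; rewrite gp_sub gp_sum.
  have lt x (y : 'I_r.+1) : (x < d.+1)%N -> (x * r.+1 + y < D)%N.
    move=> xd; rewrite /D newdimS; apply: leq_trans (_ : x.+1 * r.+1 <= _)%N.
      by rewrite mulSn addnC -addSn leq_add2r.
    by rewrite leq_mul2r xd orbT.
  under eq_bigr => x _ do rewrite f'P ?lt //.
  exact: (N5 (Ordinal pD, Ordinal qD)).
- move=> l lk; apply/BN; rewrite gp_sub gp_special gp_sum.
  have := N6 (Ordinal lk); congr (cnorm (_ - _) < _); apply: eq_bigr => u _.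
  rewrite gp_sum; apply: eq_bigr => v _.
  by rewrite gp_mul gp_const -scalerAl mul1r f'P // ccP.
- by move=> l lk u uD v vD; rewrite ccP //; exact: bP.
- rewrite /k' expnD; apply: leq_mul; first exact: ltnW (ltn_expl _ _).
  by rewrite leq_exp2l.
Qed.

End UHFExtendable.

(** * Completion of a C*-seminorm on codes *)

(** The norm of a difference serves as a pseudometric on codes. Fields such as [nu_addL] let the
    operations pass to Cauchy sequences and their classes, the [eq_] fields supply the algebra laws
    there, and the last four tie a code to the polynomial that it spells. *)
Record precstar (R : realType) := Precstar {
  nu :> nat -> R;
  nu_ge0 : forall p, 0 <= nu p;
  nu_sym : forall p q, nu (csub p q) <= nu (csub q p);
  nu_tri : forall p q r, nu (csub p r) <= nu (csub p q) + nu (csub q r);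
  nu_le : forall p q, nu p <= nu (csub p q) + nu q;
  nu_sub0 : forall p, nu (csub p (cconst 0)) <= nu p;
  nu_addL : forall p q p' q', nu (csub (cadd p q) (cadd p' q')) <= nu (csub p p') + nu (csub q q');
  nu_mulL : forall p p' q, nu (csub (cmul p q) (cmul p' q)) <= nu (csub p p') * nu q;
  nu_mulR : forall p q q', nu (csub (cmul p q) (cmul p q')) <= nu p * nu (csub q q');
  nu_starL : forall p q, nu (csub (cstar p) (cstar q)) <= nu (csub p q);
  nu_constL : forall c d, nu (csub (cconst c) (cconst d)) <= Normc.normc (ccoef R c - ccoef R d);
  nu_add : forall p q, nu (cadd p q) <= nu p + nu q;
  nu_mul : forall p q, nu (cmul p q) <= nu p * nu q;
  nu_star : forall p, nu p * nu p <= nu (cmul (cstar p) p);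
  nu_const : forall c, nu (cconst c) <= Normc.normc (ccoef R c);
  nu_one : 1 <= nu (cconst cfone);
  eq_addA : forall p q r, nu (csub (cadd p (cadd q r)) (cadd (cadd p q) r)) = 0;
  eq_addC : forall p q, nu (csub (cadd p q) (cadd q p)) = 0;
  eq_add0 : forall p, nu (csub (cadd (cconst 0) p) p) = 0;
  eq_addN : forall p, nu (csub (cadd (cmul (cconst cfm1) p) p) (cconst 0)) = 0;
  eq_mulA : forall p q r, nu (csub (cmul p (cmul q r)) (cmul (cmul p q) r)) = 0;
  eq_mul1 : forall p, nu (csub (cmul (cconst cfone) p) p) = 0;
  eq_mulDl : forall p q r, nu (csub (cmul (cadd p q) r) (cadd (cmul p r) (cmul q r))) = 0;
  eq_mulDr : forall p q r, nu (csub (cmul p (cadd q r)) (cadd (cmul p q) (cmul p r))) = 0;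
  eq_constD : forall c d, nu (csub (cconst (cfadd c d)) (cadd (cconst c) (cconst d))) = 0;
  eq_constM : forall c d, nu (csub (cconst (cfmul c d)) (cmul (cconst c) (cconst d))) = 0;
  eq_constC : forall c p, nu (csub (cmul (cconst c) p) (cmul p (cconst c))) = 0;
  eq_starD : forall p q, nu (csub (cstar (cadd p q)) (cadd (cstar p) (cstar q))) = 0;
  eq_starM : forall p q, nu (csub (cstar (cmul p q)) (cmul (cstar q) (cstar p))) = 0;
  eq_starK : forall p, nu (csub (cstar (cstar p)) p) = 0;
  eq_starconst : forall c, nu (csub (cstar (cconst c)) (cconst (cfconj c))) = 0;
  eq_consc : forall t q, nu (csub (consc t q) (cadd (consc t 0) q)) = 0;
  eq_nil : nu (csub 0 (cconst 0)) = 0;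
  eq_term : forall c l w, nu (csub (cterm c (consc l w)) (cmul (cletter l) (cterm c w))) = 0;
  eq_letter : forall l, nu (csub (cletter (flipl l)) (cstar (cletter l))) = 0 }.

Lemma real_cauchy (R : realType) (e : nat -> R) :
  (forall eps, 0 < eps -> exists K, forall m n, (K <= m)%N -> (K <= n)%N -> `|e m - e n| < eps) ->
  exists l : R, (e @ \oo --> l)%classic.
Proof.
move=> H; suff C : cauchy ((e @ \oo)%classic : set_system R).
  by exists (lim (e @ \oo)); apply/(@cauchy_cvgP R).
apply: cauchy_exP => eps eps0; have [K KP] := H eps eps0.
exists (e K); exists K => // n Kn /=.
by rewrite /ball /= distrC; apply: KP.
Qed.

Lemma cv_close (R : realType) (e f : nat -> R) (l : R) :
  (e @ \oo --> l)%classic -> cv0 (fun n => `|f n - e n|) -> (f @ \oo --> l)%classic.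
Proof.
move=> el ef; apply/cvgrPdistC_lt => eps eps0; have e2 : 0 < eps / 2 by lra.
apply: filterS (filterI ((cvgrPdistC_lt _ _).1 el _ e2) (cv0_lt ef e2)) => n [h1 h2].
have := ler_distD (e n) (f n) l; lra.
Qed.

Lemma cv_le (R : realType) (e f : nat -> R) (l m : R) :
  (e @ \oo --> l)%classic -> (f @ \oo --> m)%classic -> (forall n, e n <= f n) -> l <= m.
Proof.
move=> el fm ef; apply/ler_addgt0Pl => eps eps0; have e2 : 0 < eps / 2 by lra.
have [n [h1 h2]] := near_ex (filterI ((cvgrPdistC_lt _ _).1 el _ e2) ((cvgrPdistC_lt _ _).1 fm _ e2)).
by have := ef n; move: h1 h2; rewrite !ltr_norml => /andP [? ?] /andP [? ?]; lra.
Qed.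

Lemma cv_unique (R : realType) (e : nat -> R) (l m : R) :
  (e @ \oo --> l)%classic -> (e @ \oo --> m)%classic -> l = m.
Proof. by move=> el em; apply/le_anti; rewrite (cv_le el em) ?(cv_le em el). Qed.

Section Completion.
Variables (R : realType) (N : precstar R).
Notation "p ~- q" := (N (csub p q)) (at level 50).
Implicit Types (p q r : nat) (e : nat -> R).
Notation normc := (@Normc.normc R).

Let N0 p : 0 <= N p := nu_ge0 N p.

Definition cauchy_seq (u : nat -> nat) : Prop :=
  forall eps : R, 0 < eps -> exists K, forall m n, (K <= m)%N -> (K <= n)%N -> u m ~- u n < eps.

(** The code of 0 + p is at distance zero from p, in both directions by symmetry. *)
Lemma N_refl p : p ~- p = 0.
Proof.
apply/le_anti; rewrite N0 andbT; apply: le_trans (nu_tri N p (cadd (cconst 0) p) p) _.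
by rewrite (eq_add0 N p) addr0 -(eq_add0 N p); exact: nu_sym.
Qed.

Lemma N_sym p q : p ~- q = q ~- p.
Proof. by apply/le_anti; rewrite !nu_sym. Qed.

Lemma N_dist p q : `|N p - N q| <= p ~- q.
Proof.
have := nu_le N p q; have := nu_le N q p; rewrite (N_sym q p) ler_norml => h1 h2.
by apply/andP; split; lra.
Qed.

Record cseq := CSeq { sq :> nat -> nat; sqP : cauchy_seq sq }.
Implicit Types u v w : cseq.

Definition equ u v : Prop := cv0 (fun n => u n ~- v n).

Lemma equ_refl u : equ u u.
Proof. by apply: cv0_le (@cv00 R) => n; rewrite N_refl lexx. Qed.

Lemma equ_sym u v : equ u v -> equ v u.
Proof. by apply: cv0_le => n; rewrite N0 N_sym lexx. Qed.

Lemma equ_trans u v w : equ u v -> equ v w -> equ u w.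
Proof. by move=> uv vw; apply: cv0_le (cv0D uv vw) => n; rewrite N0 nu_tri. Qed.

(** Taking classes of Cauchy sequences of codes divides out the null elements and completes in one
    step. A class is a predicate, so equality of classes is extensional. *)
Definition compl := {X : cseq -> Prop | exists u, X = equ u}.

Definition pi u : compl := exist _ (equ u) (ex_intro _ u erefl).
Definition repr (x : compl) : cseq := projT1 (cid (projT2 x)).

Lemma compl_eq (x y : compl) : projT1 x = projT1 y -> x = y.
Proof. by case: x y => [X hX] [Y hY] /= XY; case: _ / XY in hY *; congr exist; exact: Prop_irrelevance. Qed.

Lemma piK x : pi (repr x) = x.
Proof. by apply: compl_eq; rewrite /repr /=; case: cid => u /= ->. Qed.

Lemma pi_eq u v : equ u v -> pi u = pi v.
Proof.
move=> uv; apply: compl_eq; apply/funext => w /=; apply/propext; split.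
  exact: equ_trans (equ_sym uv).
exact: equ_trans.
Qed.

Lemma equ_pi u v : pi u = pi v -> equ u v.
Proof.
by move=> E; have := congr1 (fun X : compl => projT1 X v) E => /= ->; exact: equ_refl.
Qed.

Lemma repr_pi u : equ (repr (pi u)) u.
Proof. by apply: equ_pi; rewrite piK. Qed.

Lemma pi_ind (P : compl -> Prop) : (forall u, P (pi u)) -> forall x, P x.
Proof. by move=> H x; rewrite -(piK x). Qed.

Lemma pi_eq0 u v : (forall n, u n ~- v n = 0) -> pi u = pi v.
Proof. by move=> uv; apply: pi_eq; apply: cv0_le (@cv00 R) => n; rewrite uv lexx. Qed.

Lemma cauchy_bounded u : exists M, 0 <= M /\ forall n, N (u n) <= M.
Proof.
have [K KP] := sqP u ltr01.
have fin j : exists M, forall n, (n < j)%N -> N (u n) <= M.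
  elim: j => [|j [M MP]]; first by exists 0.
  exists (Num.max M (N (u j))) => n; rewrite ltnS leq_eqVlt => /orP [/eqP ->|/MP nM].
    by rewrite le_max lexx orbT.
  by rewrite le_max nM.
have [M MP] := fin K; exists (Num.max M (1 + N (u K))); split.
  by rewrite le_max; apply/orP; right; have := N0 (u K); lra.
move=> n; rewrite le_max; case: (ltnP n K) => [/MP -> //|Kn].
by apply/orP; right; have := nu_le N (u n) (u K); have := KP n K Kn (leqnn K); lra.
Qed.

Lemma cauchy_add u v : cauchy_seq (fun n => cadd (u n) (v n)).
Proof.
move=> eps eps0; have e2 : 0 < eps / 2 by lra.
have [K KP] := sqP u e2; have [L LP] := sqP v e2.
exists (maxn K L) => m n; rewrite !geq_max => /andP [Km Lm] /andP [Kn Ln].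
apply: le_lt_trans (nu_addL N _ _ _ _) _.
by have := KP _ _ Km Kn; have := LP _ _ Lm Ln; lra.
Qed.
Definition sadd u v := CSeq (cauchy_add u v).

Lemma N_mul p p' q q' : cmul p q ~- cmul p' q' <= (p ~- p') * N q + N p' * (q ~- q').
Proof.
apply: le_trans (nu_tri N _ (cmul p' q) _) _.
by apply: lerD; [exact: nu_mulL|exact: nu_mulR].
Qed.

Lemma cauchy_mul u v : cauchy_seq (fun n => cmul (u n) (v n)).
Proof.
move=> eps eps0.
have [M [M0 MP]] := cauchy_bounded u; have [L [L0 LP]] := cauchy_bounded v.
have e1 : 0 < eps / (2 * (L + 1)) by rewrite divr_gt0 //; lra.
have e2 : 0 < eps / (2 * (M + 1)) by rewrite divr_gt0 //; lra.
have [K KP] := sqP u e1; have [J JP] := sqP v e2.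
exists (maxn K J) => m n; rewrite !geq_max => /andP [Km Jm] /andP [Kn Jn].
apply: le_lt_trans (N_mul _ _ _ _) _.
have := KP _ _ Km Kn; rewrite ltr_pdivlMr; last by lra.
have := JP _ _ Jm Jn; rewrite ltr_pdivlMr; last by lra.
have := N0 (csub (u m) (u n)); have := N0 (csub (v m) (v n)).
have := MP n; have := LP m; have := N0 (v m); have := N0 (u n); nra.
Qed.
Definition smul u v := CSeq (cauchy_mul u v).

Lemma cauchy_star u : cauchy_seq (fun n => cstar (u n)).
Proof.
move=> eps eps0; have [K KP] := sqP u eps0; exists K => m n Km Kn.
by apply: le_lt_trans (nu_starL N _ _) _; exact: KP.
Qed.
Definition sstar u := CSeq (cauchy_star u).

Lemma cauchy_emb p : cauchy_seq (fun=> p).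
Proof. by move=> eps eps0; exists 0%N => m n _ _; rewrite N_refl. Qed.
Definition semb p := CSeq (cauchy_emb p).
Definition emb p : compl := pi (semb p).

Definition cadd_op x y : compl := pi (sadd (repr x) (repr y)).
Definition cmul_op x y : compl := pi (smul (repr x) (repr y)).
Definition cstar_op x : compl := pi (sstar (repr x)).
Definition copp_op x : compl := cmul_op (emb (cconst cfm1)) x.

Lemma add_pi u v : cadd_op (pi u) (pi v) = pi (sadd u v).
Proof.
apply: pi_eq; apply: cv0_le (cv0D (repr_pi u) (repr_pi v)) => n.
by rewrite N0 nu_addL.
Qed.

Lemma mul_pi u v : cmul_op (pi u) (pi v) = pi (smul u v).
Proof.
apply: pi_eq.
have [M [M0 MP]] := cauchy_bounded u; have [L [L0 LP]] := cauchy_bounded (repr (pi v)).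
apply: cv0_le (cv0D (cv0Ml L (repr_pi u)) (cv0Ml M (repr_pi v))) => n.
rewrite N0 /=; apply: le_trans (N_mul _ _ _ _) _.
by apply: lerD; [rewrite mulrC|]; apply: ler_wpM2r.
Qed.

Lemma star_pi u : cstar_op (pi u) = pi (sstar u).
Proof. by apply: pi_eq; apply: cv0_le (repr_pi u) => n; rewrite N0 nu_starL. Qed.

HB.instance Definition _ := gen_eqMixin compl.
HB.instance Definition _ := gen_choiceMixin compl.

Fact compl_addA : associative cadd_op.
Proof.
elim/pi_ind => u; elim/pi_ind => v; elim/pi_ind => w.
by rewrite !add_pi; apply: pi_eq0 => n; exact: eq_addA.
Qed.
Fact compl_addC : commutative cadd_op.
Proof.
elim/pi_ind => u; elim/pi_ind => v.
by rewrite !add_pi; apply: pi_eq0 => n; exact: eq_addC.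
Qed.
Fact compl_add0 : left_id (emb (cconst 0)) cadd_op.
Proof. by elim/pi_ind => u; rewrite !add_pi; apply: pi_eq0 => n; exact: eq_add0. Qed.
Fact compl_addN : left_inverse (emb (cconst 0)) copp_op cadd_op.
Proof.
elim/pi_ind => u; rewrite /copp_op mul_pi add_pi.
by apply: pi_eq0 => n; exact: eq_addN.
Qed.
HB.instance Definition _ := GRing.isZmodule.Build compl
  compl_addA compl_addC compl_add0 compl_addN.

Fact compl_mulA : associative cmul_op.
Proof.
elim/pi_ind => u; elim/pi_ind => v; elim/pi_ind => w.
by rewrite !mul_pi; apply: pi_eq0 => n; exact: eq_mulA.
Qed.
Fact compl_mul1 : left_id (emb (cconst cfone)) cmul_op.
Proof. by elim/pi_ind => u; rewrite !mul_pi; apply: pi_eq0 => n; exact: eq_mul1. Qed.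
Fact compl_mulr1 : right_id (emb (cconst cfone)) cmul_op.
Proof.
elim/pi_ind => u; rewrite -[RHS]compl_mul1 !mul_pi.
by apply: pi_eq0 => n; rewrite N_sym; exact: eq_constC.
Qed.
Fact compl_mulDl : left_distributive cmul_op cadd_op.
Proof.
elim/pi_ind => u; elim/pi_ind => v; elim/pi_ind => w.
by rewrite !(add_pi, mul_pi); apply: pi_eq0 => n; exact: eq_mulDl.
Qed.
Fact compl_mulDr : right_distributive cmul_op cadd_op.
Proof.
elim/pi_ind => u; elim/pi_ind => v; elim/pi_ind => w.
by rewrite !(add_pi, mul_pi); apply: pi_eq0 => n; exact: eq_mulDr.
Qed.

Lemma cv_nu u : exists l : R, ((fun n => N (u n)) @ \oo --> l)%classic.
Proof.
apply: real_cauchy => eps eps0; have [K KP] := sqP u eps0.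
by exists K => m n Km Kn; apply: le_lt_trans (N_dist _ _) (KP _ _ Km Kn).
Qed.

Definition cnorm_op (x : compl) : R := projT1 (cid (cv_nu (repr x))).

Lemma cnorm_op_cv u : ((fun n => N (u n)) @ \oo --> cnorm_op (pi u))%classic.
Proof.
rewrite /cnorm_op; case: cid => l /= Hl.
apply: cv_close Hl _; apply: cv0_le (repr_pi u) => n.
by rewrite normr_ge0 /= N_sym N_dist.
Qed.

Arguments cnorm_op_cv : clear implicits.

Lemma cnorm_op_eq u (l : R) : ((fun n => N (u n)) @ \oo --> l)%classic -> cnorm_op (pi u) = l.
Proof. exact: cv_unique (cnorm_op_cv u). Qed.

Lemma cnorm_emb p : cnorm_op (emb p) = N p.
Proof. by apply: cnorm_op_eq; apply: (cvg_cst (N p)). Qed.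

Fact compl_one_neq0 : emb (cconst cfone) != 0.
Proof.
apply/eqP => H.
have E : N (cconst cfone) = N (cconst 0).
  by rewrite -[LHS]cnorm_emb -[RHS]cnorm_emb H.
have h1 := nu_one N; rewrite E in h1.
have h2 := nu_const N 0; rewrite ccoef0 Normc.normc0 in h2.
by have := le_trans h1 h2; rewrite ler10.
Qed.
HB.instance Definition _ := GRing.Zmodule_isNzRing.Build compl
  compl_mulA compl_mul1 compl_mulr1 compl_mulDl compl_mulDr compl_one_neq0.

Definition approx (z : R[i]) (n : nat) : nat :=
  projT1 (cid (approx_coef z (exprn_gt0 n (ltac:(lra) : 0 < 2^-1 :> R)))).

Lemma approxP z n : normc (ccoef R (approx z n) - z) < 2^-1 ^+ n.
Proof. by rewrite /approx; case: cid. Qed.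

Definition cvc (c : nat -> nat) (z : R[i]) : Prop := cv0 (fun n => normc (ccoef R (c n) - z)).

Lemma cvc_approx z : cvc (approx z) z.
Proof.
by apply: cv0_le (@cv0_half R) => n; rewrite normc_ge0 ltW // approxP.
Qed.

Lemma normc_dist (x y z : R[i]) : normc (x - y) <= normc (x - z) + normc (y - z).
Proof.
have := le_normcD (x - z) (z - y); rewrite subrKA.
by rewrite -(opprB y z) normcN.
Qed.

Lemma normc_norm_dist (x y : R[i]) : `|normc x - normc y| <= normc (x - y).
Proof.
have D (v w : R[i]) : normc (v + w) <= normc v + normc w by exact: le_normcD.
have S (v w : R[i]) : normc (v - w) = normc (w - v) by rewrite -(normcN (w - v)) opprB.
have := D (x - y) y; have := D (y - x) x; rewrite !subrK (S y x) => h1 h2.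
by rewrite ler_norml; apply/andP; split; lra.
Qed.

Lemma cauchy_const c z : cvc c z -> cauchy_seq (fun n => cconst (c n)).
Proof.
move=> cz eps eps0; have e2 : 0 < eps / 2 by lra.
have [K KP] := (cv0P (fun n => normc_ge0 (ccoef R (c n) - z))).1 cz _ e2.
exists K => m n Km Kn; apply: le_lt_trans (nu_constL N _ _) _.
by apply: le_lt_trans (normc_dist _ _ z) _; have := KP m Km; have := KP n Kn; lra.
Qed.
Definition sconst c z (cz : cvc c z) := CSeq (cauchy_const cz).
(** Codes have coefficients in Q(i) only; a complex scalar enters as the limit of rational constants
    and then acts by multiplication. *)
Definition iota (z : R[i]) : compl := pi (sconst (cvc_approx z)).

Lemma iotaE c z (cz : cvc c z) : iota z = pi (sconst cz).
Proof.
apply: pi_eq; apply: cv0_le (cv0D (cvc_approx z) cz) => n.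
rewrite N0 /=; apply: le_trans (nu_constL N _ _) _; exact: normc_dist.
Qed.

Lemma iota_emb c : iota (ccoef R c) = emb (cconst c).
Proof.
have cc : cvc (fun=> c) (ccoef R c).
  by apply: cv0_le (@cv00 R) => n; rewrite subrr Normc.normc0 lexx.
by rewrite (iotaE cc); apply: pi_eq0 => n; exact: N_refl.
Qed.

Lemma cvc_add c d x y : cvc c x -> cvc d y -> cvc (fun n => cfadd (c n) (d n)) (x + y).
Proof.
move=> cx dy; apply: cv0_le (cv0D cx dy) => n.
by rewrite normc_ge0 ccoef_add opprD addrACA le_normcD.
Qed.

Lemma cvc_mul c d x y : cvc c x -> cvc d y -> cvc (fun n => cfmul (c n) (d n)) (x * y).
Proof.
move=> cx dy; apply: cv0_le (cv0D (cv0D (cv0M cx dy) (cv0Ml (normc x) dy)) (cv0Ml (normc y) cx)) => n.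
rewrite normc_ge0 ccoef_mul.
have -> : ccoef R (c n) * ccoef R (d n) - x * y =
  (ccoef R (c n) - x) * (ccoef R (d n) - y) + x * (ccoef R (d n) - y) + y * (ccoef R (c n) - x) by ring.
apply: le_trans (le_normcD _ _) _; rewrite -!Normc.normcM lerD2r.
exact: le_normcD.
Qed.

Lemma cvc_conj c x : cvc c x -> cvc (fun n => cfconj (c n)) (x^*).
Proof.
move=> cx; apply: cv0_le cx => n; rewrite normc_ge0 ccoef_conj -rmorphB.
by case: (ccoef R (c n) - x) => a b /=; rewrite sqrrN lexx.
Qed.

Lemma iotaD x y : iota (x + y) = iota x + iota y.
Proof.
rewrite (iotaE (cvc_add (cvc_approx x) (cvc_approx y))) -[RHS]/(cadd_op _ _) add_pi.
by apply: pi_eq0 => n; exact: eq_constD.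
Qed.

Lemma iotaM x y : iota (x * y) = iota x * iota y.
Proof.
rewrite (iotaE (cvc_mul (cvc_approx x) (cvc_approx y))) -[RHS]/(cmul_op _ _) mul_pi.
by apply: pi_eq0 => n; exact: eq_constM.
Qed.

Lemma iota1 : iota 1 = 1.
Proof. by rewrite -(ccoef_one R) iota_emb. Qed.

Lemma iotaC z (x : compl) : iota z * x = x * iota z.
Proof.
elim/pi_ind: x => u; rewrite -[LHS]/(cmul_op _ _) -[RHS]/(cmul_op _ _) !mul_pi.
by apply: pi_eq0 => n; exact: eq_constC.
Qed.

Definition cscale_op (z : R[i]) (x : compl) : compl := iota z * x.

Fact compl_scaleA a b x : cscale_op a (cscale_op b x) = cscale_op (a * b) x.
Proof. by rewrite /cscale_op iotaM mulrA. Qed.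
Fact compl_scale1 : left_id 1 cscale_op.
Proof. by move=> x; rewrite /cscale_op iota1 mul1r. Qed.
Fact compl_scaleDr : right_distributive cscale_op +%R.
Proof. by move=> c x y; rewrite /cscale_op mulrDr. Qed.
Fact compl_scaleDl x : {morph cscale_op^~ x : a b / a + b}.
Proof. by move=> a b; rewrite /cscale_op iotaD mulrDl. Qed.
HB.instance Definition _ := GRing.Zmodule_isLmodule.Build R[i] compl
  compl_scaleA compl_scale1 compl_scaleDr compl_scaleDl.

Fact compl_scaleAl (a : R[i]) (x y : compl) : a *: (x * y) = a *: x * y.
Proof. exact: mulrA. Qed.
HB.instance Definition _ := GRing.Lmodule_isLalgebra.Build R[i] compl compl_scaleAl.
Fact compl_scaleAr (a : R[i]) (x y : compl) : a *: (x * y) = x * (a *: y).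
Proof. by rewrite -[LHS]/(iota a * (x * y)) -[RHS]/(x * (iota a * y)) !mulrA iotaC. Qed.
HB.instance Definition _ := GRing.Lalgebra_isAlgebra.Build R[i] compl compl_scaleAr.

Fact compl_starD (x y : compl) : cstar_op (x + y) = cstar_op x + cstar_op y.
Proof.
elim/pi_ind: x => u; elim/pi_ind: y => v.
rewrite -[pi u + pi v]/(cadd_op _ _) -[RHS]/(cadd_op _ _) add_pi !star_pi add_pi.
by apply: pi_eq0 => n; exact: eq_starD.
Qed.
Fact compl_starM (x y : compl) : cstar_op (x * y) = cstar_op y * cstar_op x.
Proof.
elim/pi_ind: x => u; elim/pi_ind: y => v.
rewrite -[pi u * pi v]/(cmul_op _ _) -[RHS]/(cmul_op _ _) mul_pi !star_pi mul_pi.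
by apply: pi_eq0 => n; exact: eq_starM.
Qed.
Fact compl_starK (x : compl) : cstar_op (cstar_op x) = x.
Proof. by elim/pi_ind: x => u; rewrite !star_pi; apply: pi_eq0 => n; exact: eq_starK. Qed.
Lemma star_iota z : cstar_op (iota z) = iota (z^*).
Proof.
rewrite (iotaE (cvc_conj (cvc_approx z))) star_pi.
by apply: pi_eq0 => n; exact: eq_starconst.
Qed.
Fact compl_starZ (c : R[i]) (x : compl) : cstar_op (c *: x) = c^* *: cstar_op x.
Proof.
rewrite -[c *: x]/(iota c * x) compl_starM star_iota.
by rewrite -iotaC.
Qed.
HB.instance Definition _ := Algebra_hasStar.Build R[i] compl
  compl_starD compl_starZ compl_starM compl_starK.

Lemma cnorm_op_ge0 (x : compl) : 0 <= cnorm_op x.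
Proof. by elim/pi_ind: x => u; apply: (@cv_le _ (fun=> 0) _ _ _ (cvg_cst _) (cnorm_op_cv u)). Qed.

Fact compl_normD (x y : compl) : cnorm_op (x + y) <= cnorm_op x + cnorm_op y.
Proof.
elim/pi_ind: x => u; elim/pi_ind: y => v; rewrite -[pi u + pi v]/(cadd_op _ _) add_pi.
apply: cv_le (cnorm_op_cv _) (cvgD (cnorm_op_cv u) (cnorm_op_cv v)) _ => n.
exact: nu_add.
Qed.
Fact compl_normM (x y : compl) : cnorm_op (x * y) <= cnorm_op x * cnorm_op y.
Proof.
elim/pi_ind: x => u; elim/pi_ind: y => v; rewrite -[pi u * pi v]/(cmul_op _ _) mul_pi.
apply: cv_le (cnorm_op_cv _) (cvgM (cnorm_op_cv u) (cnorm_op_cv v)) _ => n.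
exact: nu_mul.
Qed.
Lemma cnorm_iota z : cnorm_op (iota z) <= normc z.
Proof.
have H : ((fun n => normc (ccoef R (approx z n))) @ \oo --> normc z)%classic.
  apply: cv_close (cvg_cst _) _; apply: cv0_le (cvc_approx z) => n.
  by rewrite normr_ge0 normc_norm_dist.
apply: cv_le (cnorm_op_cv _) H _ => n; exact: nu_const.
Qed.
Fact compl_normZ (c : R[i]) (x : compl) : cnorm_op (c *: x) = normc c * cnorm_op x.
Proof.
have le z y : cnorm_op (z *: y) <= normc z * cnorm_op y.
  apply: le_trans (compl_normM _ _) _; apply: ler_wpM2r; first exact: cnorm_op_ge0.
  exact: cnorm_iota.
apply/le_anti; rewrite le /=.
have [->|c0] := eqVneq c 0; first by rewrite Normc.normc0 mul0r cnorm_op_ge0.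
(* The reverse inequality is the one just proved, for the inverse scalar. *)
have := le c^-1 (c *: x); rewrite scalerA mulVf // scale1r Normc.normcV.
have cp : 0 < normc c.
  by rewrite lt0r normc_ge0 andbT; apply: contra c0 => /eqP/Normc.eq0_normc ->.
by rewrite ler_pdivlMl.
Qed.
Fact compl_norm0_eq0 (x : compl) : cnorm_op x = 0 -> x = 0.
Proof.
elim/pi_ind: x => u u0; apply: pi_eq.
have := cnorm_op_cv u; rewrite u0 => H.
by apply: cv0_le H => n; rewrite N0 /= nu_sub0.
Qed.
(** By [nu_star] the squared norm of y is at most the norm of [star y * y], hence at most the
    product of the norms of [star y] and y. Cancelling one factor, for y and for [star y], shows
    that [star] is isometric, and submultiplicativity gives the other inequality. *)
Fact compl_norm_star (x : compl) : cnorm_op (star x * x) = cnorm_op x ^+ 2.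
Proof.
have ge y : cnorm_op y * cnorm_op y <= cnorm_op (star y * y).
  elim/pi_ind: y => u; rewrite -[star (pi u) * pi u]/(cmul_op (cstar_op _) _) star_pi mul_pi.
  apply: cv_le (cvgM (cnorm_op_cv u) (cnorm_op_cv u)) (cnorm_op_cv _) _ => n.
  exact: nu_star.
have sle y : cnorm_op y <= cnorm_op (star y).
  have [->|y0] := eqVneq (cnorm_op y) 0; first exact: cnorm_op_ge0.
  have yp : 0 < cnorm_op y by rewrite lt0r y0 cnorm_op_ge0.
  by rewrite -(ler_pM2r yp); apply: le_trans (ge y) (compl_normM _ _).
apply/le_anti; rewrite expr2 ge andbT; apply: le_trans (compl_normM _ _) _.
apply: ler_wpM2r; first exact: cnorm_op_ge0.
by have := sle (star x); rewrite starK.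
Qed.

Lemma cnorm_opN (x : compl) : cnorm_op (- x) = cnorm_op x.
Proof. by rewrite -scaleN1r compl_normZ normcN1 mul1r. Qed.

Lemma cnorm_op_sym (x y : compl) : cnorm_op (x - y) = cnorm_op (y - x).
Proof. by rewrite -(cnorm_opN (y - x)) opprB. Qed.

Lemma cnorm_op_tri (y x z : compl) : cnorm_op (x - z) <= cnorm_op (x - y) + cnorm_op (y - z).
Proof. by rewrite -[x - z](subrKA y); exact: compl_normD. Qed.

Lemma sub_pi u v : pi u - pi v = pi (sadd u (smul (semb (cconst cfm1)) v)).
Proof. by rewrite -[LHS]/(cadd_op _ (cmul_op _ _)) mul_pi add_pi. Qed.

Lemma cnorm_op_near u v t : (\forall n \near \oo, u n ~- v n <= t) -> cnorm_op (pi u - pi v) <= t.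
Proof.
move=> H; rewrite sub_pi leNgt; apply/negP => lt.
have := cvgr_gt _ (cnorm_op_cv (sadd u (smul (semb (cconst cfm1)) v))) _ lt.
move=> /(_ _) H'; have [n [h1 h2]] := near_ex (filterI H H').
by move: h2; rewrite ltNge h1.
Qed.

(** Diagonal argument: x_k is within 2^-k of the class of a single code w_k, and the sequence w is
    Cauchy and represents the limit. *)
Fact compl_complete (x : nat -> compl) :
  (forall eps : R, 0 < eps -> exists K : nat, forall m n : nat,
    (K <= m)%N -> (K <= n)%N -> cnorm_op (x m - x n) < eps) ->
  exists l : compl, forall eps : R, 0 < eps -> exists K : nat, forall n : nat,
    (K <= n)%N -> cnorm_op (x n - l) < eps.
Proof.
move=> xC.
have H k : exists p, cnorm_op (x k - emb p) <= 2^-1 ^+ k.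
  have h0 : 0 < 2^-1 ^+ k :> R by apply: exprn_gt0; lra.
  have [K KP] := sqP (repr (x k)) h0.
  exists (repr (x k) K); rewrite -{1}(piK (x k)); apply: cnorm_op_near.
  by exists K => // n Kn; apply: ltW; exact: KP.
have [w wP] := boolp.choice H.
have half eps : 0 < eps -> exists K, forall n, (K <= n)%N -> 2^-1 ^+ n < eps :> R.
  by apply: (cv0P _).1 (@cv0_half R) _ => n; apply: exprn_ge0; lra.
have wE m n : w m ~- w n = cnorm_op (emb (w m) - emb (w n)).
  rewrite sub_pi -[LHS]/(N (cadd (w m) (cmul (cconst cfm1) (w n)))).
  move: (cconst cfm1) => c0; apply/esym/cnorm_op_eq.
  by apply: (cvg_cst (N (cadd (w m) (cmul c0 (w n))))).
have wC : cauchy_seq w.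
  move=> eps eps0; have e3 : 0 < eps / 3 by lra.
  have [K KP] := xC _ e3; have [L LP] := half _ e3.
  exists (maxn K L) => m n; rewrite !geq_max => /andP [Km Lm] /andP [Kn Ln].
  rewrite wE; apply: le_lt_trans (cnorm_op_tri (x m) _ _) _.
  rewrite cnorm_op_sym; apply: le_lt_trans (lerD (wP m) (cnorm_op_tri (x n) _ _)) _.
  apply: le_lt_trans (lerD (lexx _) (lerD (ltW (KP _ _ Km Kn)) (wP n))) _.
  by move: (LP _ Lm) (LP _ Ln); move: (2^-1 ^+ m) (2^-1 ^+ n) => s t; lra.
exists (pi (CSeq wC)) => eps eps0; have e3 : 0 < eps / 3 by lra.
have [K KP] := wC _ e3; have [L LP] := half _ e3.
exists (maxn K L) => n; rewrite geq_max => /andP [Kn Ln].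
apply: le_lt_trans (cnorm_op_tri (emb (w n)) _ _) _.
have : cnorm_op (emb (w n) - pi (CSeq wC)) <= eps / 3.
  by apply: cnorm_op_near; exists K => // m Km; apply: ltW; exact: KP.
move=> H1; apply: le_lt_trans (lerD (wP n) H1) _.
by move: (LP _ Ln); move: (2^-1 ^+ n) => t; lra.
Qed.
HB.instance Definition _ := StarAlgebra_isCStar.Build R compl
  compl_normD compl_normZ compl_norm0_eq0 compl_normM compl_norm_star compl_complete.

Definition gen_seq (n : nat) : compl := emb (cletter n.*2).

Lemma emb_eq p q : p ~- q = 0 -> emb p = emb q.
Proof. by move=> pq; apply: pi_eq0. Qed.

Lemma emb_add p q : emb (cadd p q) = emb p + emb q.
Proof. by rewrite -[RHS]/(cadd_op _ _) add_pi; apply: pi_eq0 => n; exact: N_refl. Qed.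

Lemma emb_mul p q : emb (cmul p q) = emb p * emb q.
Proof. by rewrite -[RHS]/(cmul_op _ _) mul_pi; apply: pi_eq0 => n; exact: N_refl. Qed.

Lemma emb_star p : emb (cstar p) = star (emb p).
Proof. by rewrite -[RHS]/(cstar_op _) star_pi; apply: pi_eq0 => n; exact: N_refl. Qed.

Lemma emb_letter l : emb (cletter l) = lval gen_seq l.
Proof.
rewrite /lval /eval_letter /= /gen_seq.
have flip m : emb (cletter (flipl m)) = star (emb (cletter m)).
  by rewrite -emb_star; apply: emb_eq; exact: eq_letter.
case: (boolP (odd l)) => lo; last by rewrite even_halfK.
by rewrite -flip /flipl odd_double; congr (emb (cletter _)); lia.
Qed.

Lemma emb_term c (w : nat) : emb (cterm c w) = ccoef R c *: wval gen_seq w.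
Proof.
rewrite /wval -{1}(CodeSeq.decodeK w); elim: (dec w) => [|l s IH].
  by rewrite big_nil -[_ *: 1]/(iota _ * 1) mulr1 iota_emb cconst.unlock.
rewrite big_cons scalerAr -IH -emb_letter -emb_mul.
by rewrite -[enc (l :: s)]/(consc l (enc s)); apply: emb_eq; exact: eq_term.
Qed.

(** This is the purpose of the word fields of [precstar]: they reduce the class of a code to the
    classes of its letters and constants, and so identify it with the value of the polynomial at the
    generators. *)
Lemma emb_gp q : emb q = generated_point gen_seq q.
Proof.
rewrite gpE -{1}(CodeSeq.decodeK q); elim: (dec q) => [|t s IH].
  by rewrite big_nil; apply: emb_eq; exact: eq_nil.
rewrite big_cons -IH -[enc (t :: s)]/(consc t (enc s)).
rewrite (emb_eq (eq_consc N t (enc s))) emb_add; congr (_ + _).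
by rewrite -{1}(pairn_p t) emb_term.
Qed.

Lemma gen_norm q : cnorm (generated_point gen_seq q) = N q.
Proof. by rewrite -emb_gp -cnorm_emb. Qed.

Lemma gen_presentation : is_presentation gen_seq.
Proof.
move=> x eps eps0.
have sub q : in_star_subalgebra gen_seq (generated_point gen_seq q).
  have sub0 : in_star_subalgebra gen_seq 0.
    by rewrite -(scale0r (1 : compl)); apply: in_scale; exact: in_one.
  rewrite gpE; elim: (dec q) => [|t s IH]; first by rewrite big_nil.
  rewrite big_cons; apply: in_add IH; apply: in_scale; rewrite /wval.
  elim: (dec (p2 t)) => [|l r IHr]; first by rewrite big_nil; exact: in_one.
  rewrite big_cons; apply: in_mul IHr; rewrite /lval /eval_letter.
  by case: (decode_letter l) => j [] /=; [apply: in_star|]; exact: in_special.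
elim/pi_ind: x => u; have e2 : 0 < eps / 2 by lra.
have [K KP] := sqP u e2.
exists (generated_point gen_seq (u K)); first exact: sub.
rewrite -emb_gp; apply: le_lt_trans (_ : _ <= eps / 2) _; last by lra.
by apply: cnorm_op_near; exists K => // n Kn; apply: ltW; exact: KP.
Qed.

End Completion.

(** * The seminorm axioms as [Pi02] conditions *)

Section Clauses.
Variable B : nat -> nat -> Prop.

(* With [B q r] standing for N(q) < r, these express N(t) <= N(t1), N(t) <= N(t1) + N(t2),
   N(t) <= N(t1) N(t2), N(t) = 0, N(t)^2 <= N(t1) and N(t) <= |c|. *)
Definition le1 (t t1 : nat) : Prop := forall r, B t1 r -> B t r.
Definition le2 (t t1 t2 : nat) : Prop := forall r1 r2, B t1 r1 /\ B t2 r2 -> B t (radd r1 r2).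
Definition leM (t t1 t2 : nat) : Prop := forall r1 r2, B t1 r1 /\ B t2 r2 -> B t (rmul r1 r2).
Definition eqZ (t : nat) : Prop := forall r, rlt 0 r -> B t r.
Definition leS (t t1 : nat) : Prop := forall r, rlt 0 r /\ B t1 (rmul r r) -> B t r.
Definition leC (t c : nat) : Prop := forall r,
  rlt 0 r /\ rlt (radd (rmul (p1 c) (p1 c)) (rmul (p2 c) (p2 c))) (rmul r r) -> B t r.

(** Lower bounds cannot be enumerated from an upper cut. The first two clauses, N >= 0 and N(1) >=
    1, therefore say that every strict upper bound is positive, respectively greater than 1. *)
Definition metric_axioms : Prop :=
  (((forall q r, B q r -> rlt 0 r) /\ (forall r, B (cconst cfone) r -> rlt (ratc 1 0 0) r)) /\
   ((forall p q, le1 (csub p q) (csub q p)) /\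
    (forall p q r, le2 (csub p r) (csub p q) (csub q r)))) /\
  (((forall p q, le2 p (csub p q) q) /\ (forall p, le1 (csub p (cconst 0)) p)) /\
   ((forall p q p' q', le2 (csub (cadd p q) (cadd p' q')) (csub p p') (csub q q')) /\
    (forall p p' q, leM (csub (cmul p q) (cmul p' q)) (csub p p') q))).

Definition norm_axioms : Prop :=
  (((forall p q q', leM (csub (cmul p q) (cmul p q')) p (csub q q')) /\
    (forall p q, le1 (csub (cstar p) (cstar q)) (csub p q))) /\
   ((forall c d, leC (csub (cconst c) (cconst d)) (cfadd c (cfmul cfm1 d))) /\
    (forall p q, le2 (cadd p q) p q))) /\
  (((forall p q, leM (cmul p q) p q) /\ (forall p, leS p (cmul (cstar p) p))) /\
   (forall c, leC (cconst c) c)).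

Definition ring_axioms : Prop :=
  (((forall p q r, eqZ (csub (cadd p (cadd q r)) (cadd (cadd p q) r))) /\
    (forall p q, eqZ (csub (cadd p q) (cadd q p)))) /\
   ((forall p, eqZ (csub (cadd (cconst 0) p) p)) /\
    (forall p, eqZ (csub (cadd (cmul (cconst cfm1) p) p) (cconst 0))))) /\
  (((forall p q r, eqZ (csub (cmul p (cmul q r)) (cmul (cmul p q) r))) /\
    (forall p, eqZ (csub (cmul (cconst cfone) p) p))) /\
   ((forall p q r, eqZ (csub (cmul (cadd p q) r) (cadd (cmul p r) (cmul q r)))) /\
    (forall p q r, eqZ (csub (cmul p (cadd q r)) (cadd (cmul p q) (cmul p r)))))).

Definition star_axioms : Prop :=
  (((forall c d, eqZ (csub (cconst (cfadd c d)) (cadd (cconst c) (cconst d)))) /\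
    (forall c d, eqZ (csub (cconst (cfmul c d)) (cmul (cconst c) (cconst d))))) /\
   ((forall c p, eqZ (csub (cmul (cconst c) p) (cmul p (cconst c)))) /\
    (forall p q, eqZ (csub (cstar (cadd p q)) (cadd (cstar p) (cstar q)))))) /\
  (((forall p q, eqZ (csub (cstar (cmul p q)) (cmul (cstar q) (cstar p)))) /\
    (forall p, eqZ (csub (cstar (cstar p)) p))) /\
   (forall c, eqZ (csub (cstar (cconst c)) (cconst (cfconj c))))).

Definition word_axioms : Prop :=
  ((forall t q, eqZ (csub (consc t q) (cadd (consc t 0) q))) /\ eqZ (csub 0 (cconst 0))) /\
  ((forall c l w, eqZ (csub (cterm c (consc l w)) (cmul (cletter l) (cterm c w)))) /\
   (forall l, eqZ (csub (cletter (flipl l)) (cstar (cletter l))))).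

Definition structure_axioms : Prop :=
  ((metric_axioms /\ norm_axioms) /\ (ring_axioms /\ star_axioms)) /\ word_axioms.

Variables (R : realType) (N : nat -> R).
Hypothesis N0 : forall q, 0 <= N q.
Hypothesis BN : forall q r, B q r <-> N q < rval R r.

Lemma rval0 : rval R 0 = 0.
Proof. by rewrite /rval nrat0 rmorph0. Qed.

Lemma rval_add r s : rval R (radd r s) = rval R r + rval R s.
Proof. by rewrite /rval nrat_radd rmorphD. Qed.

Lemma rval_mul r s : rval R (rmul r s) = rval R r * rval R s.
Proof. by rewrite /rval nrat_rmul rmorphM. Qed.

Lemma rval_gt0 r : rlt 0 r = (0 < rval R r).
Proof. by rewrite -(rval_lt R) rval0. Qed.

Lemma rval_above (x y : R) : (forall r, x < rval R r -> y < rval R r) -> y <= x.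
Proof.
move=> H; rewrite leNgt; apply/negP => xy.
have [r /andP [xr ry]] := rval_between xy.
by have := H r xr; rewrite ltNge ltW.
Qed.

Lemma le1P t t1 : le1 t t1 <-> N t <= N t1.
Proof.
split=> [H|H r /BN Hr]; last by apply/BN; exact: le_lt_trans Hr.
by apply: rval_above => r /BN /H /BN.
Qed.

Lemma le2P t t1 t2 : le2 t t1 t2 <-> N t <= N t1 + N t2.
Proof.
split=> [H|H r1 r2 [/BN h1 /BN h2]]; last by apply/BN; rewrite rval_add; lra.
apply: rval_above => r Hr.
have [r1 /andP [a1 a2]] : exists r1, N t1 < rval R r1 < rval R r - N t2 by apply: rval_between; lra.
have [r2 /andP [b1 b2]] : exists r2, N t2 < rval R r2 < rval R r - rval R r1 by apply: rval_between; lra.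
have /BN := H r1 r2 (conj ((BN _ _).2 a1) ((BN _ _).2 b1)); rewrite rval_add; lra.
Qed.

Lemma leMP t t1 t2 : leM t t1 t2 <-> N t <= N t1 * N t2.
Proof.
split=> [H|H r1 r2 [/BN h1 /BN h2]]; last first.
  by apply/BN; rewrite rval_mul; have := N0 t1; have := N0 t2; nra.
apply/ler_addgt0Pr => eps eps0.
(* The choice of x ensures x <= 1 and x s <= eps, and then (N t1 + x)(N t2 + x) <= N t1 N t2 + x
   s. *)
pose s := N t1 + N t2 + 1.
have s1 : 1 <= s by rewrite /s; have := N0 t1; have := N0 t2; lra.
pose x := eps / (s * (1 + eps)).
have se : 0 < s * (1 + eps) by rewrite mulr_gt0 //; lra.
have x0 : 0 < x by rewrite divr_gt0.
have xs : x * (s * (1 + eps)) = eps by rewrite /x divfK // gt_eqF.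
have [r1 /andP [a1 a2]] : exists r1, N t1 < rval R r1 < N t1 + x by apply: rval_between; lra.
have [r2 /andP [b1 b2]] : exists r2, N t2 < rval R r2 < N t2 + x by apply: rval_between; lra.
have /BN := H r1 r2 (conj ((BN _ _).2 a1) ((BN _ _).2 b1)); rewrite rval_mul => Ht.
have x1 : x <= 1 by rewrite /x ler_pdivrMr // mul1r; nra.
have h1 : rval R r1 * rval R r2 <= (N t1 + x) * (N t2 + x).
  by apply: ler_pM; try apply: ltW => //; [exact: le_lt_trans a1|exact: le_lt_trans b1].
have h2 : (N t1 + x) * (N t2 + x) <= N t1 * N t2 + x * s.
  by rewrite /s; have := N0 t1; have := N0 t2; nra.
have h3 : x * s <= eps by rewrite -[X in _ <= X]xs; nra.
by lra.
Qed.

Lemma eqZP t : eqZ t <-> N t = 0.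
Proof.
split=> [H|H r]; last by rewrite rval_gt0 => r0; apply/BN; rewrite H.
apply/le_anti; rewrite N0 andbT; apply: rval_above => r r0.
by apply/BN/H; rewrite rval_gt0.
Qed.

Lemma leSP t t1 : leS t t1 <-> N t * N t <= N t1.
Proof.
split=> [H|H r []]; last first.
  by rewrite rval_gt0 => r0 /BN; rewrite rval_mul => Hr; apply/BN; have := N0 t; nra.
rewrite leNgt; apply/negP => lt.
have sq0 : Num.sqrt (N t1) < N t.
  by rewrite -(ltr_pXn2r (_ : 0 < 2)%N) ?nnegrE ?sqrtr_ge0 // sqr_sqrtr // expr2.
have [r /andP [r1 r2]] := rval_between sq0.
have r0 : 0 < rval R r by apply: le_lt_trans r1; exact: sqrtr_ge0.
have : B t r.
  apply: H; rewrite rval_gt0; split => //; apply/BN; rewrite rval_mul.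
  have := sqr_sqrtr (N0 t1); have := sqrtr_ge0 (N t1); rewrite expr2; nra.
by move=> /BN; lra.
Qed.

(** For positive r, comparing |c| with r amounts to comparing squares, which are rational, so the
    premise of [leC] is decidable. *)
Lemma leCP t c : leC t c <-> N t <= Normc.normc (ccoef R c).
Proof.
rewrite /leC; have E r : rlt 0 r /\ rlt (radd (rmul (p1 c) (p1 c)) (rmul (p2 c) (p2 c))) (rmul r r) <->
    Normc.normc (ccoef R c) < rval R r.
  rewrite rval_gt0 -(rval_lt R) rval_add !rval_mul ccoef_rval /Normc.normc -!expr2.
  set S := _ + _; have S0 : 0 <= S by rewrite addr_ge0 ?sqr_ge0.
  split=> [[r0 Sr]|Sr].
    by rewrite -(ltr_pXn2r (_ : 0 < 2)%N) ?nnegrE ?sqrtr_ge0 ?sqr_sqrtr // ltW.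
  have r0 : 0 < rval R r by apply: le_lt_trans Sr; exact: sqrtr_ge0.
  by split => //; rewrite -(sqr_sqrtr S0) ltr_pXn2r ?nnegrE ?sqrtr_ge0 // ltW.
split=> [H|H r /E Hr]; last by apply/BN; exact: le_lt_trans Hr.
by apply: rval_above => r /E /H /BN.
Qed.

Lemma structure_precstar : structure_axioms -> exists P : precstar R, nu P = N.
Proof.
move=> [[[M S] [Ra St]] W].
case: M => [[[_ M2] [M3 M4]] [[M5 M6] [M7 M8]]].
case: S => [[[S1 S2] [S3 S4]] [[S5 S6] S7]].
case: Ra => [[[R1 R2] [R3 R4]] [[R5 R6] [R7 R8]]].
case: St => [[[T1 T2] [T3 T4]] [[T5 T6] T7]].
case: W => [[W1 W2] [W3 W4]].
have N1 : 1 <= N (cconst cfone).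
  apply: rval_above => r /BN /M2; rewrite -(rval_lt R) rval_nat.
  by [].
have constL c d : N (csub (cconst c) (cconst d)) <= Normc.normc (ccoef R c - ccoef R d).
  by have /leCP := S3 c d; rewrite ccoef_add ccoef_mul ccoef_m1 mulN1r.
by exists {| nu := N; nu_ge0 := N0;
  nu_sym := fun p q => (le1P _ _).1 (M3 p q);
  nu_tri := fun p q r => (le2P _ _ _).1 (M4 p q r);
  nu_le := fun p q => (le2P _ _ _).1 (M5 p q);
  nu_sub0 := fun p => (le1P _ _).1 (M6 p);
  nu_addL := fun p q p' q' => (le2P _ _ _).1 (M7 p q p' q');
  nu_mulL := fun p p' q => (leMP _ _ _).1 (M8 p p' q);
  nu_mulR := fun p q q' => (leMP _ _ _).1 (S1 p q q');
  nu_starL := fun p q => (le1P _ _).1 (S2 p q);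
  nu_constL := constL;
  nu_add := fun p q => (le2P _ _ _).1 (S4 p q);
  nu_mul := fun p q => (leMP _ _ _).1 (S5 p q);
  nu_star := fun p => (leSP _ _).1 (S6 p);
  nu_const := fun c => (leCP _ _).1 (S7 c);
  nu_one := N1;
  eq_addA := fun p q r => (eqZP _).1 (R1 p q r);
  eq_addC := fun p q => (eqZP _).1 (R2 p q);
  eq_add0 := fun p => (eqZP _).1 (R3 p);
  eq_addN := fun p => (eqZP _).1 (R4 p);
  eq_mulA := fun p q r => (eqZP _).1 (R5 p q r);
  eq_mul1 := fun p => (eqZP _).1 (R6 p);
  eq_mulDl := fun p q r => (eqZP _).1 (R7 p q r);
  eq_mulDr := fun p q r => (eqZP _).1 (R8 p q r);
  eq_constD := fun c d => (eqZP _).1 (T1 c d);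
  eq_constM := fun c d => (eqZP _).1 (T2 c d);
  eq_constC := fun c p => (eqZP _).1 (T3 c p);
  eq_starD := fun p q => (eqZP _).1 (T4 p q);
  eq_starM := fun p q => (eqZP _).1 (T5 p q);
  eq_starK := fun p => (eqZP _).1 (T6 p);
  eq_starconst := fun c => (eqZP _).1 (T7 c);
  eq_consc := fun t q => (eqZP _).1 (W1 t q);
  eq_nil := (eqZP _).1 W2;
  eq_term := fun c l w => (eqZP _).1 (W3 c l w);
  eq_letter := fun l => (eqZP _).1 (W4 l) |}.
Qed.

End Clauses.

(** * The axioms hold in every presented algebra *)

Section Soundness.
Variables (R : realType) (A : cstarAlgType R) (a : nat -> A) (B : nat -> nat -> Prop).
Notation gp := (generated_point a).
Hypothesis BN : forall q r, B q r <-> cnorm (gp q) < rval R r.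

Let N q := cnorm (gp q).
Let N0 q : 0 <= N q. Proof. exact: cnorm_ge0. Qed.

Lemma eqZ_sub p q : gp p = gp q -> eqZ B (csub p q).
Proof. by move=> pq; apply/(eqZP N0 BN); rewrite /N gp_sub pq subrr cnorm0. Qed.

Lemma le1_sound t t1 : cnorm (gp t) <= cnorm (gp t1) -> le1 B t t1.
Proof. by move=> H; apply/(le1P BN). Qed.
Lemma le2_sound t t1 t2 : cnorm (gp t) <= cnorm (gp t1) + cnorm (gp t2) -> le2 B t t1 t2.
Proof. by move=> H; apply/(le2P BN). Qed.
Lemma leM_sound t t1 t2 : cnorm (gp t) <= cnorm (gp t1) * cnorm (gp t2) -> leM B t t1 t2.
Proof. by move=> H; apply/(leMP N0 BN). Qed.
Lemma leC_sound t c : cnorm (gp t) <= Normc.normc (ccoef R c) -> leC B t c.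
Proof. by move=> H; apply/(leCP BN). Qed.

Lemma metric_sound : metric_axioms B.
Proof.
split; split; split.
- by move=> q r /BN H; rewrite (rval_gt0 R); exact: le_lt_trans (cnorm_ge0 _) H.
- by move=> r /BN; rewrite gp_const ccoef_one scale1r cnorm1 -(rval_lt R) rval_nat.
- by move=> p q; apply: le1_sound; rewrite !gp_sub cnormC.
- move=> p q r; apply: le2_sound; rewrite !gp_sub. exact: cnorm_tri.
- by move=> p q; apply: le2_sound; rewrite gp_sub; exact: cnorm_le.
- by move=> p; apply: le1_sound; rewrite gp_sub gp_const ccoef0 scale0r subr0.
- move=> p q p' q'; apply: le2_sound; rewrite !gp_sub !gp_add opprD addrACA.
  exact: cnormD.
- by move=> p p' q; apply: leM_sound; rewrite !gp_sub !gp_mul -mulrBl; exact: cnormM.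
Qed.

Lemma norm_sound : norm_axioms B.
Proof.
split; split; try split.
- by move=> p q q'; apply: leM_sound; rewrite !gp_sub !gp_mul -mulrBr; exact: cnormM.
- by move=> p q; apply: le1_sound; rewrite !gp_sub !gp_star -starB cnorm_starE.
- move=> c d; apply: leC_sound; rewrite gp_sub !gp_const -scalerBl cnormZ cnorm1 mulr1.
  by rewrite ccoef_add ccoef_mul ccoef_m1 mulN1r.
- by move=> p q; apply: le2_sound; rewrite gp_add; exact: cnormD.
- by move=> p q; apply: leM_sound; rewrite gp_mul; exact: cnormM.
- by move=> p; apply/(leSP N0 BN); rewrite /N gp_mul gp_star cnorm_star expr2.
- by move=> c; apply: leC_sound; rewrite gp_const cnormZ cnorm1 mulr1.
Qed.

Lemma ring_sound : ring_axioms B.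
Proof.
split; split; split.
- by move=> p q r; apply: eqZ_sub; rewrite !gp_add addrA.
- by move=> p q; apply: eqZ_sub; rewrite !gp_add addrC.
- by move=> p; apply: eqZ_sub; rewrite gp_add gp_const ccoef0 scale0r add0r.
- move=> p; apply: eqZ_sub.
  by rewrite gp_add gp_mul !gp_const ccoef_m1 ccoef0 scaleN1r scale0r mulN1r addNr.
- by move=> p q r; apply: eqZ_sub; rewrite !gp_mul mulrA.
- by move=> p; apply: eqZ_sub; rewrite gp_mul gp_const ccoef_one scale1r mul1r.
- by move=> p q r; apply: eqZ_sub; rewrite !(gp_mul, gp_add) mulrDl.
- by move=> p q r; apply: eqZ_sub; rewrite !(gp_mul, gp_add) mulrDr.
Qed.

Lemma star_sound : star_axioms B.
Proof.
split; split; try split.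
- by move=> c d; apply: eqZ_sub; rewrite gp_add !gp_const ccoef_add scalerDl.
- by move=> c d; apply: eqZ_sub; rewrite gp_mul !gp_const ccoef_mul -scalerAl mul1r scalerA.
- by move=> c p; apply: eqZ_sub; rewrite !gp_mul !gp_const -scalerAl -scalerAr mul1r mulr1.
- by move=> p q; apply: eqZ_sub; rewrite gp_add !gp_star gp_add starD.
- by move=> p q; apply: eqZ_sub; rewrite gp_mul !gp_star gp_mul starM.
- by move=> p; apply: eqZ_sub; rewrite !gp_star starK.
- by move=> c; apply: eqZ_sub; rewrite gp_star !gp_const ccoef_conj starZ star1.
Qed.

Lemma word_sound : word_axioms B.
Proof.
split; split.
- by move=> t q; apply: eqZ_sub; rewrite gp_add !gp_consc gp0 addr0.
- by apply: eqZ_sub; rewrite gp0 gp_const ccoef0 scale0r.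
- move=> c l w; apply: eqZ_sub; rewrite gp_mul !gp_term ccoef_one scale1r -scalerAr.
  by rewrite /wval !dec_consc big_cons big_seq1.
- by move=> l; apply: eqZ_sub; rewrite gp_star !gp_letter lval_flip.
Qed.

Lemma structure_sound : structure_axioms B.
Proof.
split; last exact: word_sound.
by split; split; [exact: metric_sound|exact: norm_sound|exact: ring_sound|exact: star_sound].
Qed.

End Soundness.

(** * The upper bound *)

Lemma recf_fe f i j : recf f -> recf i -> recf j -> recf (fun x => fe (f x) (i x) (j x)).
Proof. by move=> *; rewrite /fe; cmp. Qed.
Lemma recf_cval c l i j : recf c -> recf l -> recf i -> recf j ->
  recf (fun x => cval (c x) (l x) (i x) (j x)).
Proof. by move=> *; rewrite /cval; cmp. Qed.
Lemma recf_rinv n : recf n -> recf (fun x => rinv (n x)).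
Proof. by move=> *; rewrite /rinv; cmp. Qed.
#[global] Hint Resolve recf_fe recf_cval recf_rinv : recfdb.
Lemma recf_rdelta d k : recf d -> recf k -> recf (fun x => rdelta (d x) (k x)).
Proof. by move=> cd ck; rewrite /rdelta; move: 1000%N => c; cmp. Qed.
Lemma recf_reps d k : recf d -> recf k -> recf (fun x => reps (d x) (k x)).
Proof. by move=> *; rewrite /reps; cmp. Qed.
Lemma recf_rhalf k : recf k -> recf (fun x => rhalf (k x)).
Proof. by move=> *; rewrite /rhalf; cmp. Qed.
Lemma recf_newdim d m : recf d -> recf m -> recf (fun x => newdim (d x) (m x)).
Proof. by move=> *; rewrite /newdim; cmp. Qed.
Lemma recf_bounded_coef b c : recf b -> recf c -> recf (fun x => nat_of_bool (bounded_coef (b x) (c x))).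
Proof. by move=> *; rewrite /bounded_coef; cmp. Qed.
#[global] Hint Resolve recf_rdelta recf_reps recf_rhalf recf_newdim recf_bounded_coef : recfdb.

Section UpperBound.
Variable B : nat -> nat -> nat -> Prop.
Hypothesis reB : forall e q r, recf e -> recf q -> recf r -> re (fun z => B (e z) (q z) (r z)).

Hint Resolve reB : redb.

Lemma pi2_le1 e t t1 : recf e -> recf t -> recf t1 -> pi2 (fun x => le1 (B (e x)) (t x) (t1 x)).
Proof. by move=> *; rewrite /le1; rec. Qed.
Lemma pi2_le2 e t t1 t2 : recf e -> recf t -> recf t1 -> recf t2 ->
  pi2 (fun x => le2 (B (e x)) (t x) (t1 x) (t2 x)).
Proof. by move=> *; rewrite /le2; rec. Qed.
Lemma pi2_leM e t t1 t2 : recf e -> recf t -> recf t1 -> recf t2 ->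
  pi2 (fun x => leM (B (e x)) (t x) (t1 x) (t2 x)).
Proof. by move=> *; rewrite /leM; rec. Qed.
Lemma pi2_eqZ e t : recf e -> recf t -> pi2 (fun x => eqZ (B (e x)) (t x)).
Proof. by move=> *; rewrite /eqZ; rec. Qed.
Lemma pi2_leS e t t1 : recf e -> recf t -> recf t1 -> pi2 (fun x => leS (B (e x)) (t x) (t1 x)).
Proof. by move=> *; rewrite /leS; rec. Qed.
Lemma pi2_leC e t c : recf e -> recf t -> recf c -> pi2 (fun x => leC (B (e x)) (t x) (c x)).
Proof. by move=> *; rewrite /leC; rec. Qed.
Hint Resolve pi2_le1 pi2_le2 pi2_leM pi2_eqZ pi2_leS pi2_leC : redb.

Lemma pi2_structure : pi2 (fun e => structure_axioms (B e)).
Proof.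
rewrite /structure_axioms /metric_axioms /norm_axioms /ring_axioms /star_axioms /word_axioms.
move: (cconst cfm1) (cconst cfone) (cconst 0) (cfm1) => c1 c2 c3 c4.
do !apply: pi2_and; rec.
Qed.

Lemma re_valid e d k f : recf e -> recf d -> recf k -> recf f ->
  re (fun x => valid (B (e x)) (d x) (k x) (f x)).
Proof. by move=> ce cd ck cf; rewrite /valid; move: (cconst cfone) => c1; rec. Qed.
Hint Resolve re_valid : redb.

Lemma pi2_extendable : pi2 (fun e => extendable (B e)).
Proof.
rewrite /extendable /extension; do 3!apply: pi2_all; apply: pi2_imp; first rec.
do 5!apply: re_ex; rec.
Qed.

End UpperBound.

(** * The complex numbers as a UHF algebra *)

Definition scalars (R : realType) : Type := R[i]^o.

Section Scalars.
Variable R : realType.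
Notation T := (scalars R).
Notation normc := (@Normc.normc R).

HB.instance Definition _ := GRing.Algebra.copy T R[i]^o.

Fact sc_starD (x y : T) : Num.conj (x + y) = Num.conj x + Num.conj y :> T.
Proof. exact: rmorphD. Qed.
Fact sc_starZ (c : R[i]) (x : T) : Num.conj (c *: x) = c^* *: (Num.conj x : T).
Proof. exact: rmorphM. Qed.
Fact sc_starM (x y : T) : Num.conj (x * y) = (Num.conj y : T) * (Num.conj x : T).
Proof. by rewrite rmorphM; exact: mulrC. Qed.
Fact sc_starK (x : T) : Num.conj (Num.conj x) = x.
Proof. exact: conjCK. Qed.
HB.instance Definition _ := Algebra_hasStar.Build R[i] T sc_starD sc_starZ sc_starM sc_starK.

Fact sc_normD (x y : T) : normc (x + y) <= normc x + normc y.
Proof. exact: le_normcD. Qed.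
Fact sc_normZ (c : R[i]) (x : T) : normc (c *: x) = normc c * normc x.
Proof. exact: Normc.normcM. Qed.
Fact sc_norm0_eq0 (x : T) : normc x = 0 -> x = 0.
Proof. exact: Normc.eq0_normc. Qed.
Fact sc_normM (x y : T) : normc (x * y) <= normc x * normc y.
Proof. by rewrite Normc.normcM. Qed.
Fact sc_norm_star (x : T) : normc (star x * x) = normc x ^+ 2.
Proof.
rewrite Normc.normcM expr2; congr (_ * _).
by case: x => a b; rewrite /= sqrrN.
Qed.
Fact sc_complete (u : nat -> T) :
  (forall eps : R, 0 < eps -> exists K : nat, forall m n : nat,
    (K <= m)%N -> (K <= n)%N -> normc (u m - u n) < eps) ->
  exists l : T, forall eps : R, 0 < eps -> exists K : nat, forall n : nat,
    (K <= n)%N -> normc (u n - l) < eps.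
Proof.
move=> uC; pose re n := complex.Re (u n : R[i]); pose im n := complex.Im (u n : R[i]).
have uE m n : (u m - u n : R[i]) = ((re m - re n) +i* (im m - im n))%C.
  by rewrite /re /im; case: (u m) => a b; case: (u n).
have [x rx] : exists x : R, (re @ \oo --> x)%classic.
  apply: real_cauchy => eps /uC [K KP]; exists K => m n Km Kn.
  by apply: le_lt_trans (KP m n Km Kn); rewrite uE; exact: normc_ge_re.
have [y iy] : exists y : R, (im @ \oo --> y)%classic.
  apply: real_cauchy => eps /uC [K KP]; exists K => m n Km Kn.
  by apply: le_lt_trans (KP m n Km Kn); rewrite uE; exact: normc_ge_im.
exists (x +i* y)%C => eps eps0; have e2 : 0 < eps / 2 by lra.
have [K _ KP] := filterI ((cvgrPdistC_lt _ _).1 rx _ e2) ((cvgrPdistC_lt _ _).1 iy _ e2).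
exists K => n Kn; have [h1 h2] := KP n Kn.
have -> : (u n - (x +i* y)%C : R[i]) = ((re n - x) +i* (im n - y))%C.
  by rewrite /re /im; case: (u n).
apply: le_lt_trans (normc_le_sum _ _) _; lra.
Qed.
HB.instance Definition _ := StarAlgebra_isCStar.Build R T
  sc_normD sc_normZ sc_norm0_eq0 sc_normM sc_norm_star sc_complete.

Lemma UHF_scalars : UHF T.
Proof.
pose i (s : nat) (x : 'M[R[i]]_1) : T := x ord0 ord0.
have hi s : unital_star_hom (i s).
  split.
  - by move=> c x y; rewrite /i !mxE.
  - by split => [|x y]; rewrite /i !mxE ?eqxx // big_ord1.
  - by move=> x; rewrite /i !mxE.
have coc : is_cocone (D := fun s => 'M[R[i]]_((0 : nat).+1)) (fun _ x => x) i by split.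
apply: (@dense_cocone_UHF _ (fun=> 0%N) (fun _ x => x) T i coc) => //.
move=> x; apply: cl_in; exists 0%N, (\matrix_(_, _) (x : R[i])).
by rewrite /i mxE.
Qed.

Definition zero_seq (n : nat) : T := 0.

Lemma zero_presentation : is_presentation zero_seq.
Proof.
move=> x eps eps0; exists x; last by rewrite subrr cnorm0.
have -> : x = (x : R[i]) *: (1 : T) by rewrite -[RHS]/((x : R[i]) * 1) mulr1.
by apply: in_scale; exact: in_one.
Qed.

Lemma gp_zero_seq q : generated_point zero_seq q =
  \sum_(t <- dec q) if p2 t == 0%N then ccoef R (p1 t) else 0.
Proof.
rewrite gpE; apply: eq_bigr => t _; rewrite /tval /wval.
have [->|t0] := eqVneq (p2 t) 0%N; first by rewrite big_nil -[LHS]/(_ * 1) mulr1.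
case E: (dec (p2 t)) => [|l s].
  by move: t0; rewrite -[p2 t]CodeSeq.decodeK E eqxx.
rewrite big_cons (_ : lval _ l = 0) ?mul0r ?scaler0 //.
by rewrite /lval /eval_letter; case: (decode_letter l) => j [] //=; rewrite star0.
Qed.

End Scalars.

(** At the zero sequence only the terms with the empty word, coded by 0, contribute; the value is a
    number in Q(i) computed from q. *)
Definition const_part (q : nat) : nat :=
  foldr (fun t r => if p2 t == 0 then cfadd (p1 t) r else r)%N 0%N (dec q).

Lemma recf_const_part q : recf q -> recf (fun x => const_part (q x)).
Proof.
move=> cq; rewrite /const_part.
by apply: (@recf_foldr (fun _ t r => if p2 t == 0 then cfadd (p1 t) r else r)%N); cmp.
Qed.
#[global] Hint Resolve recf_const_part : recfdb.

Lemma const_partE (R : realType) q : generated_point (@zero_seq R) q = ccoef R (const_part q).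
Proof.
rewrite gp_zero_seq /const_part; elim: (dec q) => [|t s IH]; first by rewrite big_nil ccoef0.
by rewrite big_cons IH /=; case: eqP => _; rewrite ?ccoef_add ?add0r.
Qed.

(** * Approximation of absolute values *)

Lemma countb_threshold n (P : pred nat) : (forall i, P i.+1 -> P i) ->
  (countb n P <= n)%N /\ forall i, (i < n)%N -> P i = (i < countb n P)%N.
Proof.
move=> anti.
have anti' i j : (i <= j)%N -> P j -> P i.
  by move=> ij; rewrite -(subnK ij); elim: (j - i)%N => // k IH /anti.
elim: n => [//|n [le IH]].
have -> : countb n.+1 P = (countb n P + P n)%N by [].
case Pn: (P n) => /=.
  have E : countb n P = n.
    apply/eqP; rewrite eqn_leq le /= leqNgt; apply/negP => lt.
    have := IH _ lt; rewrite ltnn => /negbT/negP; apply.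
    by apply: anti' Pn; exact: ltnW.
  rewrite E addn1; split => // i; rewrite ltnS => lt.
  by rewrite lt; exact: anti' lt Pn.
rewrite addn0; split; first by lia.
move=> i; rewrite ltnS leq_eqVlt => /orP [/eqP ->|/IH //].
by rewrite Pn ltnNge le.
Qed.

(* The square of the modulus of the coefficient [c] is [(a - b) / d]; the value is
   (m + 2) / 2^K, where m is the integer part of |c| 2^K and K = k + 2. *)
Definition sqmod (c : nat) : nat := radd (rmul (p1 c) (p1 c)) (rmul (p2 c) (p2 c)).
Definition isqrt (c k : nat) : nat :=
  countb ((rnum (sqmod c) - rneg (sqmod c)) * 4 ^ k)
    (fun i => i.+1 * i.+1 * rden (sqmod c) <= (rnum (sqmod c) - rneg (sqmod c)) * 4 ^ k)%N.
Definition modulus (c k : nat) : nat := ratc (isqrt c k.+2).+2 0 (2 ^ k.+2).-1.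

Lemma recf_modulus c k : recf c -> recf k -> recf (fun x => modulus (c x) (k x)).
Proof. by move=> *; rewrite /modulus /isqrt /sqmod; cmp. Qed.
#[global] Hint Resolve recf_modulus : recfdb.

Section Modulus.
Variable R : realType.
Implicit Types c k : nat.
Notation X c := (Normc.normc (ccoef R c)).

Lemma sqmodE c : rval R (sqmod c) = X c ^+ 2.
Proof.
rewrite rval_add !rval_mul ccoef_rval /Normc.normc sqr_sqrtr ?addr_ge0 ?sqr_ge0 //.
Qed.

Lemma isqrtP c k : (isqrt c k)%:R <= X c * 2 ^+ k < (isqrt c k).+1%:R.
Proof.
set T := ((rnum (sqmod c) - rneg (sqmod c)) * 4 ^ k)%N.
set d := rden (sqmod c).
have d0 : 0 < d%:R :> R by rewrite ltr0n.
have X0 : 0 <= X c by exact: normc_ge0.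
have ge : (rneg (sqmod c) <= rnum (sqmod c))%N.
  have : 0 <= rval R (sqmod c) by rewrite sqmodE sqr_ge0.
  rewrite /rval ler0q /nrat pmulr_lge0 ?invr_gt0 ?ltr0n //.
  by rewrite subr_ge0 ler_nat.
have TE : T%:R = (X c * 2 ^+ k) ^+ 2 * d%:R :> R.
  rewrite exprMn -sqmodE /T natrM natrB // /rval /nrat.
  rewrite fmorph_div rmorphB !rmorph_nat -/d -exprM mulnC exprM.
  rewrite natrX -[4 ^+ k]/((4%:R : R) ^+ k) (_ : 2 ^+ 2 = 4%:R :> R); last by ring.
  by field; rewrite gt_eqF.
pose P i := (i.+1 * i.+1 * d <= T)%N.
have anti i : P i.+1 -> P i.
  by rewrite /P; apply: leq_trans; rewrite leq_mul2r leq_mul ?orbT.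
have [le thr] := countb_threshold T anti.
have Y0 : 0 <= X c * 2 ^+ k by rewrite mulr_ge0 ?exprn_ge0.
have sq i : (i * i * d <= T)%N = (i%:R <= X c * 2 ^+ k).
  rewrite -(ler_nat R) TE !natrM ler_pM2r // -expr2 ler_pXn2r ?nnegrE //.
rewrite /isqrt -/T -/d -/P; set m := countb T P in le thr *.
apply/andP; split.
  case E: m => [|j] //; rewrite -sq.
  have jm : (j < m)%N by rewrite E.
  by have := thr j (leq_trans jm le); rewrite jm /P => ->.
rewrite ltNge -sq; apply/negP => H.
(* The count is limited by T. Reaching that bound would give (T + 1)^2 d <= T, which is absurd as d
   > 0. *)
case: (ltnP m T) => [mT|Tm]; first by have := thr m mT; rewrite ltnn /P H.
have mT : m = T by apply/eqP; rewrite eqn_leq le Tm.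
have : (0 < d)%N by [].
move: H; rewrite mT; clear; case: d => // d; nia.
Qed.

(** With m <= 2^K |c| < m + 1, the value (m + 2) / 2^K exceeds |c| by more than one and at most two
    units of 2^-K. The ranges of the excess for successive k do not overlap, so one function serves
    both as an approximation within 2^-k and as a strictly decreasing sequence. *)
Lemma modulusP c k :
  2^-1 ^+ k.+2 < rval R (modulus c k) - X c <= 2^-1 ^+ k.+1.
Proof.
have -> : rval R (modulus c k) = (isqrt c k.+2).+2%:R * 2^-1 ^+ k.+2.
  rewrite /rval /modulus nrat_ratc prednK ?expn_gt0 // subr0 fmorph_div !rmorph_nat.
  by rewrite natrX exprVn.
have /andP [h1 h2] := isqrtP c k.+2.
have e0 : 0 < 2^-1 ^+ k.+2 :> R by apply: exprn_gt0; lra.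
have eE : 2 ^+ k.+2 * 2^-1 ^+ k.+2 = 1 :> R by rewrite -exprMn mulfV ?expr1n // pnatr_eq0.
have qE : 2^-1 ^+ k.+1 = 2 * 2^-1 ^+ k.+2 :> R.
  by rewrite [2^-1 ^+ k.+2]exprS mulrA mulfV ?mul1r // pnatr_eq0.
have XE : X c = X c * 2 ^+ k.+2 * 2^-1 ^+ k.+2 by rewrite -mulrA eE mulr1.
rewrite qE XE -mulrBl.
move: h1 h2; move: (X c * 2 ^+ k.+2) => x h1 h2.
have n2 : (isqrt c k.+2).+2%:R = (isqrt c k.+2)%:R + 2 :> R by rewrite -addn2 natrD.
have n1 : (isqrt c k.+2).+1%:R = (isqrt c k.+2)%:R + 1 :> R by rewrite -addn1 natrD.
rewrite n2; rewrite n1 in h2.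
apply/andP; split; last by rewrite ler_pM2r //; lra.
by rewrite -[ltLHS]mul1r ltr_pM2r //; lra.
Qed.

Lemma modulus_close c k : `|rval R (modulus c k) - X c| < 2^-1 ^+ k.
Proof.
have /andP [h1 h2] := modulusP c k.
have e0 : 0 < 2^-1 ^+ k :> R by apply: exprn_gt0; lra.
have e2 : 0 < 2^-1 ^+ k.+2 :> R by apply: exprn_gt0; lra.
rewrite exprS in h2; rewrite ger0_norm; lra.
Qed.

Lemma modulus_decr c k : rval R (modulus c k.+1) < rval R (modulus c k).
Proof.
have /andP [_ h2] := modulusP c k.+1; have /andP [h1 _] := modulusP c k.
lra.
Qed.

End Modulus.

(** * Indices of norms *)

(** A non-strict comparison suffices here and in [ce_below], since y + 2^-k, like every term of a
    strictly decreasing sequence, is already strictly above the norm. *)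
Definition comp_below (e q r : nat) : Prop :=
  exists k y, phi e (pairn q k) y /\ rle (radd y (rhalf k)) r.
Definition ce_below (e q r : nat) : Prop := exists k y, phi e (pairn q k) y /\ rle y r.

Definition total (e : nat) : Prop := forall q k, exists y, phi e (pairn q k) y.

(* The last clause recovers the strict inequality |y - N(q)| < 2^-k at the limit. *)
Definition comp_wf (e : nat) : Prop :=
  total e /\
  ((forall q k j y y', phi e (pairn q k) y /\ phi e (pairn q j) y' ->
      rlt y (radd y' (radd (rhalf k) (rhalf j)))) /\
   (forall q k, exists j y y', (phi e (pairn q k) y /\ phi e (pairn q j) y') /\
      (rlt (radd y (rhalf j)) (radd y' (rhalf k)) /\
       rlt (radd y' (rhalf j)) (radd y (rhalf k))))).
(** Positivity of the values makes the decreasing sequences converge, so such an index determines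
    some N; that N is a C*-seminorm is left to the structure axioms. *)
Definition ce_wf (e : nat) : Prop :=
  total e /\
  ((forall q k y y', phi e (pairn q k) y /\ phi e (pairn q k.+1) y' -> rlt y' y) /\
   (forall q k y, phi e (pairn q k) y -> rlt 0 y)).

Lemma re_comp_below e q r : recf e -> recf q -> recf r ->
  re (fun z => comp_below (e z) (q z) (r z)).
Proof. by move=> *; rewrite /comp_below; do 2!apply: re_ex; rec. Qed.
Lemma re_ce_below e q r : recf e -> recf q -> recf r -> re (fun z => ce_below (e z) (q z) (r z)).
Proof. by move=> *; rewrite /ce_below; do 2!apply: re_ex; rec. Qed.
Lemma pi2_comp_wf : pi2 comp_wf.
Proof.
rewrite /comp_wf /total; apply: pi2_and; first rec.
apply: pi2_and; first rec.
by do 2!apply: pi2_all; apply: pi2_re; do 3!apply: re_ex; rec.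
Qed.
Lemma pi2_ce_wf : pi2 ce_wf.
Proof. by rewrite /ce_wf /total; rec. Qed.

Section Norms.
Variable R : realType.
Implicit Types (N : nat -> R) (e q r k : nat).

Definition comp_norm N e : Prop :=
  forall q k, exists2 r, phi e (pairn q k) r & `|rval R r - N q| < 2^-1 ^+ k.
Definition ce_norm N e : Prop := forall q, exists r : nat -> nat,
  [/\ forall k, phi e (pairn q k) (r k), forall k, rlt (r k.+1) (r k) &
      ((fun k => rval R (r k)) @ \oo --> N q)%classic].

Lemma half_lt (eps : R) : 0 < eps -> exists K, forall k, (K <= k)%N -> 2^-1 ^+ k < eps.
Proof.
move=> eps0; have [K _ KP] := cv0_lt (@cv0_half R) eps0.
by exists K => k /KP.
Qed.

Lemma comp_norm_below N e : comp_norm N e -> forall q r, comp_below e q r <-> N q < rval R r.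
Proof.
move=> Ne q r; split.
  move=> [k [y [yP le]]]; have [y' yP' close] := Ne q k.
  move: close; rewrite -(eval_det yP yP') ltr_norml => /andP [? _].
  by move: le; rewrite -(rval_le R) rval_add rval_half; lra.
move=> Nr; have [|K KP] := half_lt (_ : 0 < (rval R r - N q) / 2); first by lra.
have [y yP close] := Ne q K; exists K, y; split => //.
rewrite -(rval_le R) rval_add rval_half; have := KP K (leqnn K).
by move: close; rewrite ltr_norml => /andP [_ ?]; lra.
Qed.

Lemma comp_norm_wf N e : comp_norm N e -> comp_wf e.
Proof.
move=> Ne.
have close q k y : phi e (pairn q k) y -> `|rval R y - N q| < 2^-1 ^+ k.
  by move=> yP; have [y' yP' ?] := Ne q k; rewrite (eval_det yP yP').
have tot : total e by move=> q k; have [y yP _] := Ne q k; exists y.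
split => //; split.
  move=> q k j y y' [/close h1 /close h2].
  rewrite -(rval_lt R) !rval_add !rval_half.
  by move: h1 h2; rewrite !ltr_norml => /andP [? ?] /andP [? ?]; lra.
move=> q k; have [y yP] := tot q k; have h := close _ _ _ yP.
have [|j jP] := half_lt (_ : 0 < (2^-1 ^+ k - `|rval R y - N q|) / 2); first by lra.
have [y' yP'] := tot q j; have h' := close _ _ _ yP'.
exists j, y, y'; split => //; rewrite -!(rval_lt R) !rval_add !rval_half.
have := jP j (leqnn j); have := ler_norm (rval R y - N q).
have := ler_norm (- (rval R y - N q)); rewrite normrN.
by move: h'; rewrite ltr_norml => /andP [? ?]; split; lra.
Qed.

Lemma comp_wf_norm e : comp_wf e -> exists N, comp_norm N e.
Proof.
move=> [tot [cau strict]].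
have [y yP] := choice (fun z => tot (p1 z) (p2 z)).
have {}yP q k : phi e (pairn q k) (y (pairn q k)) by have := yP (pairn q k); rewrite !pairnE.
pose v q k := rval R (y (pairn q k)).
have vc q k j : v q k < v q j + (2^-1 ^+ k + 2^-1 ^+ j).
  by have := cau _ _ _ _ _ (conj (yP q k) (yP q j)); rewrite -(rval_lt R) !rval_add !rval_half.
have lim q : exists l : R, (v q @ \oo --> l)%classic.
  apply: real_cauchy => eps eps0.
  have [|K KP] := half_lt (_ : 0 < eps / 2); first by lra.
  exists K => m n /KP hm /KP hn.
  by have := vc q m n; have := vc q n m; rewrite ltr_norml => ? ?; apply/andP; split; lra.
have [N NP] := choice lim; exists N => q k; exists (y (pairn q k)) => //.
have close j : `|v q j - N q| <= 2^-1 ^+ j.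
  apply/ler_addgt0Pl => eps eps0; have e2 : 0 < eps / 2 by lra.
  have [K KP] := half_lt e2; have [K' _ KP'] := (cvgrPdistC_lt _ _).1 (NP q) _ e2.
  pose n := maxn K K'.
  have h1 := KP n (leq_maxl _ _); have h2 := KP' n (leq_maxr _ _).
  have h3 := vc q j n; have h4 := vc q n j.
  by move: h2; rewrite /= ltr_norml ler_norml => /andP [? ?]; apply/andP; split; lra.
have [j [z [z' [[zP zP'] [s1 s2]]]]] := strict q k.
move: s1 s2; rewrite -!(rval_lt R) !rval_add !rval_half.
rewrite (eval_det zP (yP q k)) (eval_det zP' (yP q j)).
have := close j; rewrite /v ler_norml ltr_norml => /andP [? ?] ? ?.
by apply/andP; split; lra.
Qed.

Lemma ce_norm_below N e : ce_norm N e -> forall q r, ce_below e q r <-> N q < rval R r.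
Proof.
move=> Ne q r; have [y [yP dec cvg]] := Ne q.
have noninc : nonincreasing_seq (fun k => rval R (y k)).
  by apply/nonincreasing_seqP => k; rewrite ltW // rval_lt.
(* The limit is at most the next term, which is strictly smaller than this one. *)
have ge k : N q < rval R (y k).
  apply: le_lt_trans (_ : _ <= rval R (y k.+1)) _; last by rewrite rval_lt.
  have <- : lim ((fun k => rval R (y k)) @ \oo) = N q by exact: cvg_lim cvg.
  by apply: nonincreasing_cvgn_ge => //; apply/cvg_ex; exists (N q).
split=> [[k [z [zP le]]]|Nr].
  by apply: lt_le_trans (ge k) _; rewrite rval_le (eval_det (yP k) zP).
have [k [_ /=]] := near_ex (filterI (near_ge 0) ((cvgrPdistC_lt _ _).1 cvg _ (ltac:(by rewrite subr_gt0) : 0 < rval R r - N q))).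
rewrite ltr_norml => /andP [_ h]; exists k, (y k); split => //.
by rewrite -(rval_le R); lra.
Qed.

Lemma ce_norm_wf N e : (forall q, 0 <= N q) -> ce_norm N e -> ce_wf e.
Proof.
move=> N0 Ne.
have tot : total e by move=> q k; have [y [yP _ _]] := Ne q; exists (y k).
split => //; split.
  move=> q k z z' [zP zP']; have [y [yP dec _]] := Ne q.
  by rewrite (eval_det zP (yP k)) (eval_det zP' (yP k.+1)).
move=> q k z zP; rewrite (rval_gt0 R); apply: le_lt_trans (N0 q) _.
by apply/(ce_norm_below Ne); exists k, z; rewrite -(rval_le R).
Qed.

Lemma ce_wf_norm e : ce_wf e -> exists N, ce_norm N e.
Proof.
move=> [tot [dec pos]].
have [y yP] := choice (fun z => tot (p1 z) (p2 z)).
have {}yP q k : phi e (pairn q k) (y (pairn q k)) by have := yP (pairn q k); rewrite !pairnE.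
pose v q k := rval R (y (pairn q k)).
have decr q k : rlt (y (pairn q k.+1)) (y (pairn q k)) by exact: dec (conj (yP q k) (yP q k.+1)).
exists (fun q => inf (range (v q))) => q; exists (fun k => y (pairn q k)); split => //.
apply: nonincreasing_cvgn.
  by apply/nonincreasing_seqP => k; rewrite ltW // rval_lt.
by exists 0 => _ [k _ <-]; rewrite ltW // -rval_gt0; exact: pos (yP q k).
Qed.

End Norms.

(** * Completeness of the index sets *)

Section IndexPi2.
Variables (R : realType) (below : nat -> nat -> nat -> Prop) (wf : nat -> Prop).
Variable norm_index : (nat -> R) -> nat -> Prop.
Hypothesis re_below : forall e q r, recf e -> recf q -> recf r ->
  re (fun z => below (e z) (q z) (r z)).
Hypothesis pi2_wf : pi2 wf.
Hypothesis indexP : forall N e, norm_index N e -> forall q r, below e q r <-> N q < rval R r.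
Hypothesis index_wf : forall N e, (forall q, 0 <= N q) -> norm_index N e -> wf e.
Hypothesis wf_index : forall e, wf e -> exists N, norm_index N e.

(** Both kinds of index are treated at once: they enter only through an r.e. upper cut and a [pi2]
    well-formedness condition ensuring that the index describes some N. *)
Lemma Pi02_index : Pi02 (fun e => exists (A : cstarAlgType R) (a : nat -> A),
  [/\ UHF A, is_presentation a & norm_index (fun q => cnorm (generated_point a q)) e]).
Proof.
apply: pi2_Pi02.
apply: (@pi2_iff (fun e => wf e /\ (structure_axioms (below e) /\ extendable (below e)))); last first.
  apply: pi2_and => //; apply: pi2_and; [exact: pi2_structure|exact: pi2_extendable].
move=> e; split=> [[/wf_index [N Ne] [struct ext]]|[A [a [uhf pres Ne]]]]; last first.
  split; first by apply: index_wf Ne => q; exact: cnorm_ge0.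
  split; first exact: structure_sound (indexP Ne).
  exact: UHF_extendable (indexP Ne) pres uhf.
have BN := indexP Ne.
have N0 q : 0 <= N q.
  apply: (@rval_above R) => r /BN; rewrite -rval_gt0.
  by move: struct => [[[[[[pos _] _] _] _] _] _]; exact: pos.
have [P PN] := structure_precstar N0 BN struct.
have NE q : cnorm (generated_point (gen_seq P) q) = N q by rewrite gen_norm PN.
exists (compl P), (gen_seq P); split; first last.
- by rewrite (_ : (fun q => _) = N) //; apply/funext.
- exact: gen_presentation.
- by apply: extendable_UHF (@gen_presentation _ P) ext => q r; rewrite NE.
Qed.

End IndexPi2.

(** * Hardness *)

Lemma search_code (S : nat -> nat -> bool) (g : nat -> nat) :
  recf (fun z => nat_of_bool (S (p1 z) (p2 z))) -> recf g ->
  exists c, forall x r, eval c x r <-> (exists z, S x z) /\ r = g x.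
Proof.
move=> cS cg.
have [F FP] : recf (fun z => nat_of_bool (~~ S (p1 z) (p2 z))) by cmp.
have [G GP] := recf_comp cg (recf_p1 recf_id); have [I IP] := recf_id.
have FE x z v : eval F (pairn x z) v <-> v = ~~ S x z.
  by have := FP (pairn x z); rewrite !pairnE => H; split=> [/(eval_det H)|->].
exists (CComp G (CPair I (CFind F))) => x r; split.
  move=> [u [i [z [iP [zP _] uE]]] rP]; split.
    by exists z; move/FE: zP; case: (S x z).
  by rewrite (eval_det rP (GP u)) uE pairnE (eval_det iP (IP x)).
move=> [ex ->]; pose z := ex_minn ex.
have [Sz zmin] : S x z /\ forall m, S x m -> (z <= m)%N by rewrite /z; case: ex_minnP.
exists (pairn x z); last by have := GP (pairn x z); rewrite pairnE.
exists x, z; split => //.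
split=> [|m mz]; first by apply/FE; rewrite Sz.
exists 0%N; apply/FE; case Sm: (S x m) => //.
by have := zmin _ Sm; rewrite leqNgt mz.
Qed.

(** One number y plays two roles: it is the input <q, k> on which a norm is requested, and the
    instance of the universal quantifier whose witness must be found first. Since every y is a pair,
    totality of the program amounts to membership in Q, and the same f serves both index sets. *)
Lemma pi02_modulus Q : Pi02 Q -> exists2 f, recf f & forall x,
  ((forall y, exists r, phi (f x) y r) -> Q x) /\
  (Q x -> forall q k, phi (f x) (pairn q k) (modulus (const_part q) k)).
Proof.
move=> [S [e0 e0P] SQ].
have cS : recf (fun z => nat_of_bool (S (p1 (p1 z)) (p2 (p1 z)) (p2 z))).
  have cT : recf (fun z => nat_of_bool (S (p1 z) (p1 (p2 z)) (p2 (p2 z)))).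
    by exists (decode_code e0) => z; have := e0P (p1 z) (p1 (p2 z)) (p2 (p2 z)); rewrite /phi !pairn_p.
  by cmp.
have cg : recf (fun x => modulus (const_part (p1 (p2 x))) (p2 (p2 x))) by cmp.
have [c cP] := @search_code (fun x => S (p1 x) (p2 x)) _ cS cg.
have [f cf fP] := smn c; exists f => // x; split.
  by move=> tot; apply/SQ => y; have [r /fP /cP [[z]]] := tot y; rewrite !pairnE; exists z.
by move=> /SQ Sx q k; apply/fP/cP; rewrite !pairnE.
Qed.

Theorem theorem12p4 (R : realType) :
  Pi02_complete (computable_index_set (@UHF R)) /\
  Pi02_complete (ce_index_set (@UHF R)).
Proof.
have compE (A : cstarAlgType R) (a : nat -> A) e :
    computable_index a e <-> comp_norm (fun q => cnorm (generated_point a q)) e.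
  by split=> H q k; have [r rP close] := H q k; exists r => //; move: close; rewrite decode_ratE.
have ceE (A : cstarAlgType R) (a : nat -> A) e :
    ce_index a e <-> ce_norm (fun q => cnorm (generated_point a q)) e.
  have E (r : nat -> nat) : (fun k => ratr (decode_rat (r k)) : R) = (fun k => rval R (r k)).
    by apply/funext => k; rewrite decode_ratE.
  split=> H q; have [r [rP dec cvg]] := H q; exists r.
    by split=> [//|k|]; [have := dec k; rewrite rltE !decode_ratE | rewrite -E].
  by split=> [//|k|]; [have := dec k; rewrite rltE !decode_ratE | rewrite E].
have normE q k : `|rval R (modulus (const_part q) k) -
    cnorm (generated_point (@zero_seq R) q)| < 2^-1 ^+ k.
  by rewrite const_partE; exact: modulus_close.
split; split.
- have [S cS SP] := Pi02_index re_comp_below pi2_comp_wf (@comp_norm_below R)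
    (fun N e _ => @comp_norm_wf R N e) (@comp_wf_norm R).
  exists S => // e; rewrite -SP.
  by split=> [] [A [a [uhf pres /compE H]]]; exists A, a.
- move=> Q /pi02_modulus [f cf fP]; exists f; first exact: recf_computable.
  move=> x; have [totQ Qphi] := fP x; split.
    move=> /Qphi H; exists (scalars R), (@zero_seq R).
    split; [exact: UHF_scalars|exact: zero_presentation|].
    by apply/compE => q k; exists (modulus (const_part q) k).
  (* Whatever algebra is presented, an index halts on every pair, and every number is a pair. *)
  move=> [A [a [_ _ H]]]; apply: totQ => y.
  by have [r rP _] := H (p1 y) (p2 y); exists r; rewrite -(pairn_p y).
- have [S cS SP] := Pi02_index re_ce_below pi2_ce_wf (@ce_norm_below R)
    (@ce_norm_wf R) (@ce_wf_norm R).
  exists S => // e; rewrite -SP.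
  by split=> [] [A [a [uhf pres /ceE H]]]; exists A, a.
- move=> Q /pi02_modulus [f cf fP]; exists f; first exact: recf_computable.
  move=> x; have [totQ Qphi] := fP x; split.
    move=> /Qphi H; exists (scalars R), (@zero_seq R).
    split; [exact: UHF_scalars|exact: zero_presentation|].
    (* The same program is a c.e. index because its values decrease strictly in k. *)
    apply/ceE => q; exists (modulus (const_part q)); split => //.
      by move=> k; rewrite -(rval_lt R) modulus_decr.
    apply/cvgrPdistC_lt => eps /half_lt [K KP]; exists K => // k Kk /=.
    by apply: (@lt_trans _ R (2^-1 ^+ k)); [exact: normE | exact: KP].
  move=> [A [a [_ _ H]]]; apply: totQ => y; have [r [rP _ _]] := H (p1 y).
  by exists (r (p2 y)); rewrite -{1}(pairn_p y).
Qed.
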